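(* Let $\beta\in(0,\pi]$, let $\mathcal I\subset\mathbb R$ be an open interval, and let $\gamma:\mathcal I\times[0,T)\to\mathbb R^2$ be a curve shortening flow with initially radial ends at angles $\frac{\pi}{2}+\frac{\beta}{2}$ and $\frac{\pi}{2}-\frac{\beta}{2}$, which is smooth down to $t=0$. Suppose that the swept area of the initial curve has bounds $$\mathcal A_-\le \mathcal A(v,w,0)\le \mathcal A_+$$ for all $v,w\in\mathcal I$ with $v\le w$. Then for $t\in(0,T)$ with $t>\frac{2(\mathcal A_+-\mathcal A_-)}{\beta}$, i.e. for $t>0$ satisfying $\frac{\mathcal A_+-\mathcal A_-}{t}<\frac{\beta}{2}$: 1. $\gamma(\cdot,t)$ can be written as the graph of a function $y(\cdot,t)$ over the $x$-axis which satisfies $$\|y_x(\cdot,t)\|_{L^\infty}\le \tan\left[\frac{\pi}{2}-\frac{\beta}{2}+\frac{\mathcal A_+-\mathcal A_-}{t}\right];$$ 2. the portion of $\gamma(\cdot,t)$ lying within the double sector consisting of all points $re^{i\theta}\in\mathbb C\simeq\mathbb R^2$ with $r\in\mathbb R$ and $$\theta\in\mathcal S:=\left(\frac{\pi}{2}-\frac{\beta}{2}+\frac{\mathcal A_+-\mathcal A_-}{t},\ \frac{\pi}{2}+\frac{\beta}{2}-\frac{\mathcal A_+-\mathcal A_-}{t}\right)$$ can be written as a polar graph, i.e. as $\{r(\theta)e^{i\theta}:\theta\in\mathcal S\}$ for some $r:\mathcal S\to\mathbb R$.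
   Context: Identify $\mathbb R^2\simeq\mathbb C$. Curve shortening flow: a smooth family of embedded curves $\gamma(\cdot,t)$ satisfies curve shortening flow if $\langle \partial_t\gamma,\nu\rangle=-\kappa$, where $\nu$ is a unit normal to $\gamma(\cdot,t)$ and $\kappa$ the corresponding geodesic curvature, so that the curvature vector is $\vec\kappa=-\kappa\nu$ (tangential motion is allowed). Uniformly proper solution: let $\mathcal I\subset\mathbb R$ be an open interval and $\mathcal J=[0,T)$ or $(0,T)$ with $T\in(0,\infty]$. A map $\gamma:\mathcal I\times\mathcal J\to\mathbb R^2$ is a uniformly proper solution to curve shortening flow if (1) $\gamma$ is continuous; (2) $\gamma$ is smooth on $\mathcal I\times(0,T)$; (3) $\gamma$ is proper on $\mathcal I\times[a,b]$ for any $[a,b]\subset\mathcal J$; (4) for each $t\in\mathcal J$ the curve $\gamma(\cdot,t)$ is embedded; (5) $\gamma$ satisfies the curve shortening flow equation for $t\in(0,T)$. ''Smooth down to $t=0$'' means smooth on $\mathcal I\times[0,T)$. Initially radial ends: for $a\in\mathbb R$ let $L_a:=\{re^{ia}: r\ge0\}$. A curve shortening flow with initially radial ends at angles $a$ and $b$ is a uniformly proper solution $\gamma:\mathcal I\times[0,T)\to\mathbb R^2$ for which there exist $u_1<u_2$ in $\mathcal I$ such that $\gamma(u,0)\in L_a$ for $u\in\mathcal I\cap(-\infty,u_1)$ and $\gamma(u,0)\in L_b$ for $u\in\mathcal I\cap(u_2,\infty)$. Swept area: for a smooth immersed curve $\gamma:\mathcal I\to\mathbb R^2$ and $v\le w$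 in $\mathcal I$, $\mathcal A(v,w):=\frac12\int_v^w *(\gamma_u\wedge\gamma)\,du$, where $*:\Lambda^2\mathbb R^2\to\mathbb R$ is the linear map with $*(e_1\wedge e_2)=1$. The swept area of $\gamma(\cdot,t)$ is written $\mathcal A(v,w,t)$. *)

(* Defs.v *)
(* The plane, identified with C, is R * R for R : realType. *)
From HB Require Import structures.
From mathcomp Require Import all_boot all_order all_algebra.
From mathcomp Require Import all_classical all_reals all_analysis.

Set Implicit Arguments.
Unset Strict Implicit.
Unset Printing Implicit Defensive.

Import Order.TTheory GRing.Theory Num.Theory.
Import numFieldNormedType.Exports.

Local Open Scope ring_scope.
Local Open Scope classical_set_scope.

Section Smooth.
Context {R : realType} {V W : normedModType R}.

(* C^infty on an open set: all iterated directional derivatives are Frechet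
   differentiable (hence continuous) there. *)
Definition smooth_open (U : set V) (f : V -> W) : Prop :=
  forall (s : seq V) (p : V), U p ->
    differentiable (foldr (fun v (g : V -> W) x => 'D_v g x) f s) p.

(* Smoothness on an arbitrary set: local extension to smooth functions on open
   sets.  On I x [0, T) this is smoothness up to the boundary t = 0; values of
   f outside D are irrelevant. *)
Definition smooth_on (D : set V) (f : V -> W) : Prop :=
  forall p, D p -> exists (U : set V) (g : V -> W),
    [/\ open U, U p, smooth_open U g & forall q, U q -> D q -> f q = g q].

End Smooth.

Section Plane.
Context {R : realType}.

(* The product norm of the library on R * R is the sup norm, so the Euclidean
   structure is spelled out. *)
Definition dot (p q : R * R) : R := p.1 * q.1 + p.2 * q.2.
Definition enorm (p : R * R) : R := Num.sqrt (dot p p).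
Definition rot90 (p : R * R) : R * R := (- p.2, p.1).

(* The linear map * on Lambda^2, with *(e1 /\ e2) = 1, applied to p /\ q. *)
Definition star_wedge (p q : R * R) : R := p.1 * q.2 - p.2 * q.1.

(* r e^{i a} *)
Definition polar (r a : R) : R * R := (r * cos a, r * sin a).

Definition ray (a : R) : set (R * R) := [set polar r a | r in [set r | 0 <= r]].

Definition double_sector (S : set R) : set (R * R) :=
  [set p | exists r theta, S theta /\ p = polar r theta].

End Plane.

Section Curves.
Context {R : realType}.
Implicit Types (I : set R) (c : R -> R * R).

Definition unit_tangent c (u : R) : R * R :=
  (enorm (derive1 c u))^-1 *: derive1 c u.

(* The choice of unit normal is immaterial: both sides of the flow equation
   change sign with it. *)
Definition unit_normal c (u : R) : R * R := rot90 (unit_tangent c u).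

(* Arclength derivative of the unit tangent. *)
Definition curvature_vector c (u : R) : R * R :=
  (enorm (derive1 c u))^-1 *: derive1 (unit_tangent c) u.

(* curvature_vector = - curvature * normal *)
Definition curvature c (u : R) : R :=
  - dot (curvature_vector c u) (unit_normal c u).

(* A homeomorphism onto its image and, if the curve is smooth, an immersion;
   the initial curve of a uniformly proper solution is in general only
   continuous. *)
Definition embedded I c : Prop :=
  [/\ {within I, continuous c},
      exists2 g : R * R -> R, {within c @` I, continuous g} &
                              forall u, I u -> g (c u) = u
    & smooth_on I c -> forall u, I u -> derive1 c u != 0].

Definition swept_area c (v w : R) : R :=
  2^-1 * \int[@lebesgue_measure R]_(u in `[v, w])
    star_wedge (derive1 c u) (c u).

End Curves.

Section Flow.
Context {R : realType}.
Implicit Types (I : set R) (T : \bar R) (gamma : R * R -> R * R).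

Definition slice gamma (t : R) : R -> R * R := fun u => gamma (u, t).

(* [0, T) and (0, T), where T may be +oo *)
Definition times0 T : set R := [set t | 0 <= t /\ (t%:E < T)%E].
Definition times T : set R := [set t | 0 < t /\ (t%:E < T)%E].

(* <d_t gamma, nu> = - kappa *)
Definition csf_equation gamma (u t : R) : Prop :=
  dot (derive1 (fun s => gamma (u, s)) t) (unit_normal (slice gamma t) u) =
  - curvature (slice gamma t) u.

(* Uniformly proper solutions on I x J for J = [0, T). *)
Definition uniformly_proper_csf I T gamma : Prop :=
  [/\ {within I `*` times0 T, continuous gamma},
      smooth_on (I `*` times T) gamma,
      forall a b : R, `[a, b] `<=` times0 T ->
        forall K : set (R * R), compact K ->
          compact ((I `*` `[a, b]) `&` gamma @^-1` K),
      forall t, times0 T t -> embedded I (slice gamma t)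
    & forall u t, I u -> times T t -> csf_equation gamma u t].

Definition csf_radial_ends I T gamma (a b : R) : Prop :=
  uniformly_proper_csf I T gamma /\
  exists u1 u2 : R,
    [/\ I u1, I u2, u1 < u2,
        forall u, I u -> u < u1 -> ray a (gamma (u, 0))
      & forall u, I u -> u2 < u -> ray b (gamma (u, 0))].

Definition smooth_down_to_zero I T gamma : Prop :=
  smooth_on (I `*` times0 T) gamma.

End Flow.

(* Main.v *)
(** On the flow, with [q] the squared speed and [theta] the tangent angle, the density
    [alpha = (x_u y - y_u x) / 2 - t theta_u] is the [u]-derivative of [A - t theta], and
    curve shortening gives [alpha_t = G_u] with [G = alpha_u / q + tau alpha], where [tau] is the
    tangential velocity.  Hence the integral of [alpha] from [u] to [v] obeys a two-point maximum
    principle, and [A(v) - A(u) - t (theta(v) - theta(u)) <= D := A_+ - A_-] for all [u], [v] and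
    all times.  Noncompactness is handled by barriers: each end stays within bounded distance of
    its initial ray, and its tangent direction there tends to that of the ray.

    The rest happens on a single time slice.  If the tangent angle exceeds by more than [D / t] the
    angle of the cone containing the tangents and the long chords near the ends, then at a maximum
    [p] of [A] it still exceeds that angle, by the estimate; and at [p] the position vector is
    parallel to the tangent.  The long chord from [p] towards the right or the left end lies on
    the side of the tangent that forces [A], by embeddedness and the same estimate, to exceed its
    maximum.  So all tangents have angle at most [pi / 2 - beta / 2 + D / t], which makes the curve a
    graph over every line outside the corresponding double cone. *)

(* Curve shortening changes the area swept between two points at the rate of the turning of the
   tangent between them, up to terms at the endpoints; this is the origin of [A - t theta]. The
   estimate trades turning for area, and bounds turning alone only where the sign of the area
   difference is known. That is why the argument on a slice starts from an extremum of [A]. The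
   obstacle is that an angle is defined modulo [2 pi] only and that the slice might wind. As in
   Hopf's proof of the theorem on turning tangents, embeddedness makes the difference quotient of
   the curve, completed by the derivative on the diagonal, a nonvanishing map on a square; a
   continuous angle of it puts tangents and chords on one branch, and the long chord between the two
   ends relates the tangents at both ends. That [A] exceeds its maximum is then proved by induction
   on the parameter length of an arc: a minimum of [A] inside it becomes, after reflection and
   possibly reversal, the starting point of the same problem on a shorter arc. A modulus of
   continuity of the chord angle supplies the fixed amount by which arcs get shorter. *)
Require Import Defs.
From HB Require Import structures.
From mathcomp Require Import all_boot all_order all_algebra.
From mathcomp Require Import all_classical all_reals all_analysis.
From mathcomp Require Import ess_sup_inf ring lra.

Set Implicit Arguments.
Unset Strict Implicit.
Unset Printing Implicit Defensive.

Import Order.TTheory GRing.Theory Num.Theory.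
Import numFieldNormedType.Exports.

Local Open Scope ring_scope.
Local Open Scope classical_set_scope.

(* The cost of [lra] grows steeply with the number of hypotheses that it parses: first try without
   those that are quantified or mention a nonlinear term. *)
Ltac opaque_fact T := lazymatch T with
  | context [is_derive] => fail
  | forall _, _ => idtac
  | _ => match T with
    | context [?f ?x] => is_var f
    | context [@Num.norm _ _ _] => idtac
    | context [@GRing.exp _ _ _] => idtac
    | context [@cos _ _] => idtac
    | context [@sin _ _] => idtac
    end
  end.

Ltac qlra := solve [
  repeat match goal with H : ?T |- _ => opaque_fact T; clear H end; lra | lra ].

(** * Real functions of one variable *)

Section RealFunctions.
Context {R : realType}.
Implicit Types (f g : R -> R) (a b c x : R).

(** Continuity is two-sided also at [a] and [b], so that facts on pointwise continuity apply as they
    stand. *)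
Definition cont_on a b f := forall x, a <= x <= b -> {for x, continuous f}.

Lemma cont_on_within a b f : cont_on a b f -> {within `[a, b], continuous f}.
Proof.
move=> cf; apply: continuous_in_subspaceT => x; rewrite inE/= in_itv/= => xab.
exact: cf.
Qed.

Lemma cont_on_sub a b a' b' f :
  a <= a' -> b' <= b -> cont_on a b f -> cont_on a' b' f.
Proof. by move=> aa bb cf x xab; apply: cf; qlra. Qed.

Lemma cont_onN a b f : cont_on a b f -> cont_on a b (fun x => - f x).
Proof. by move=> cf x /cf /continuousN. Qed.

Lemma ivt a b f v : a <= b -> cont_on a b f -> f a <= v <= f b ->
  exists2 c, a <= c <= b & f c = v.
Proof.
move=> ab /cont_on_within cf vf.
have [|c] := @IVT R f a b v ab cf; last by rewrite in_itv/=; exists c.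
by rewrite ge_min le_max; qlra.
Qed.

Lemma ivt_dec a b f v : a <= b -> cont_on a b f -> f b <= v <= f a ->
  exists2 c, a <= c <= b & f c = v.
Proof.
move=> ab /cont_onN cf vf; have [|c cab /eqP] := @ivt _ _ _ (- v) ab cf; first qlra.
by rewrite eqr_opp => /eqP; exists c.
Qed.

Lemma evt_max a b f : a <= b -> cont_on a b f ->
  exists2 c, a <= c <= b & forall x, a <= x <= b -> f x <= f c.
Proof.
move=> ab /cont_on_within cf; have [c cab fc] := EVT_max ab cf.
by exists c; move: cab; rewrite ?in_itv//= => _ x xab; apply: fc; rewrite in_itv.
Qed.

Lemma evt_min a b f : a <= b -> cont_on a b f ->
  exists2 c, a <= c <= b & forall x, a <= x <= b -> f c <= f x.
Proof.
move=> ab /cont_onN /evt_max -/(_ ab)[c cab fc].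
by exists c => // x /fc; rewrite lerN2.
Qed.

Lemma cont_nbhs f x (e : R) : {for x, continuous f} -> 0 < e ->
  exists2 d : R, 0 < d & forall y, x - d < y < x + d -> f x - e < f y < f x + e.
Proof.
move=> cf e0; have /cvgrPdist_lt/(_ _ e0) := cf.
case/nbhs_ballP => d /= d0 H; exists d => // y yd.
suff : `|f x - f y| < e by rewrite ltr_norml; qlra.
by apply: H; rewrite /ball/= ltr_norml; qlra.
Qed.

(** The witness is the supremum of the parameters up to which [c <= f]. The last clause later
    supplies a point just beyond [s] where the chord angle is already negative. *)
Lemma first_exit a b f c : a <= b -> cont_on a b f -> c <= f a -> f b < c ->
  exists s, [/\ a <= s < b, f s = c, forall x, a <= x <= s -> c <= f x &
    forall e, 0 < e -> exists2 x, s < x <= b /\ x < s + e & f x < c].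
Proof.
move=> ab cf fa fb.
pose E := [set v | a <= v <= b /\ forall x, a <= x <= v -> c <= f x].
have Ea : E a by split; [qlra|move=> x xa; have -> : x = a by qlra].
have ubE : ubound E b by move=> v []; qlra.
have supE : has_sup E by split; [exists a|exists b].
set s := sup E.
have s1 : a <= s by apply: (ub_le_sup supE.2).
have s2 : s <= b by apply: ge_sup => //; exists a.
have lts x : a <= x -> x < s -> c <= f x.
  move=> ax xs; have [e Ee xe] := sup_gt (ex_intro _ _ Ea) xs.
  by apply: Ee.2; qlra.
have fs : c <= f s.
  rewrite leNgt; apply/negP => fsc.
  have [||d d0 H] := @cont_nbhs f s (c - f s); [by apply: cf; qlra|qlra|].
  have as' : a < s by rewrite lt_neqAle s1 andbT; apply/eqP => as'; move: fa fsc; rewrite as'; qlra.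
  pose y := Num.max a (s - d / 2).
  have y1 : a <= y by rewrite le_max lexx.
  have y2 : y < s by rewrite gt_max as'/=; qlra.
  have y3 : s - d / 2 <= y by rewrite le_max lexx orbT.
  have /H : s - d < y < s + d by qlra.
  by have := lts _ y1 y2; qlra.
have sb : s < b by rewrite lt_neqAle s2 andbT; apply/eqP => sb; move: fs; rewrite sb; qlra.
have lec x : a <= x <= s -> c <= f x.
  by move=> /andP[ax]; rewrite le_eqVlt => /predU1P[->//|]; apply: lts.
have ex e : 0 < e -> exists2 x, s < x <= b /\ x < s + e & f x < c.
  move=> e0; apply: contrapT => nex.
  pose y := Num.min b (s + e / 2).
  have y1 : s < y by rewrite lt_min sb/=; qlra.
  have y2 : y <= b by rewrite ge_min lexx.
  have y3 : y <= s + e / 2 by rewrite ge_min lexx orbT.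
  suff : E y by move/(ub_le_sup supE.2); rewrite -/s; qlra.
  split; first qlra.
  move=> x xy; have [xs|sx] := leP x s; first by apply: lec; qlra.
  by rewrite leNgt; apply/negP => fx; apply: nex; exists x => //; qlra.
exists s; split => //; first qlra.
apply/eqP; rewrite eq_le fs andbT leNgt; apply/negP => cfs.
have [||d d0 H] := @cont_nbhs f s (f s - c); [by apply: cf; qlra|qlra|].
have [x [sx xs] fx] := ex d d0.
have /H : s - d < x < s + d by qlra.
by qlra.
Qed.

Lemma first_hit a b f c : a <= b -> cont_on a b f -> f a < c -> c <= f b ->
  exists s, [/\ a < s <= b, f s = c & forall x, a <= x < s -> f x < c].
Proof.
move=> ab cf fa fb.
pose E := [set v | a <= v <= b /\ c <= f v].
have Eb : E b by split; qlra.
have lbE : lbound E a by move=> v []; qlra.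
have infE : has_inf E by split; [exists b|exists a].
set s := inf E.
have s1 : s <= b by apply: (ge_inf infE.2).
have s2 : a <= s by apply: lb_le_inf => //; exists b.
have lts x : a <= x < s -> f x < c.
  move=> xs; rewrite ltNge; apply/negP => fx.
  suff : E x by move/(ge_inf infE.2); rewrite -/s; qlra.
  by split; qlra.
have fs : c <= f s.
  rewrite leNgt; apply/negP => fsc.
  have [||d d0 H] := @cont_nbhs f s (c - f s); [by apply: cf; qlra|qlra|].
  have sd : s < s + d by qlra.
  have [e Ee es] := inf_lt (ex_intro _ _ Eb) sd.
  have se : s <= e by apply: (ge_inf infE.2).
  have /H : s - d < e < s + d by qlra.
  by case: Ee => _; qlra.
have as' : a < s by rewrite lt_neqAle s2 andbT; apply/eqP => as'; move: fa fs; rewrite as'; qlra.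
exists s; split => //; first qlra.
apply/eqP; rewrite eq_le fs andbT leNgt; apply/negP => cfs.
have [||d d0 H] := @cont_nbhs f s (f s - c); [by apply: cf; qlra|qlra|].
pose y := Num.max a (s - d / 2).
have y1 : a <= y by rewrite le_max lexx.
have y2 : y < s by rewrite gt_max as'/=; qlra.
have y3 : s - d / 2 <= y by rewrite le_max lexx orbT.
have /H : s - d < y < s + d by qlra.
have /lts : a <= y < s by qlra.
by qlra.
Qed.

Notation isD f x l := (is_derive (x : R) (1 : R) (f : R -> R) l).

(** Derivatives are assembled as explicit terms from the rules below, and this lemma replaces the
    value so computed by the wanted one, mostly through [ring] or [field]. *)
Lemma isD_eq f x l l' : isD f x l -> l = l' -> isD f x l'.
Proof. by move=> ? <-. Qed.
Lemma isD_cst k x : isD (fun _ => k) x 0.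
Proof. exact: is_derive_cst. Qed.
Lemma isD_id x : isD (fun y => y) x 1.
Proof. exact: is_derive_id. Qed.
Lemma isD_add f g x l m : isD f x l -> isD g x m -> isD (fun y => f y + g y) x (l + m).
Proof. by move=> ? ?; exact: is_deriveD. Qed.
Lemma isD_sub f g x l m : isD f x l -> isD g x m -> isD (fun y => f y - g y) x (l - m).
Proof. by move=> ? ?; exact: is_deriveB. Qed.
Lemma isD_opp f x l : isD f x l -> isD (fun y => - f y) x (- l).
Proof. by move=> ?; exact: is_deriveN. Qed.
Lemma isD_mul f g x l m : isD f x l -> isD g x m ->
  isD (fun y => f y * g y) x (l * g x + f x * m).
Proof.
move=> H1 H2; apply: (is_derive_eq (is_deriveM H1 H2)).
by rewrite /GRing.scale/=; ring.
Qed.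
Lemma isD_comp f g x l m : isD g x m -> isD f (g x) l ->
  isD (fun y => f (g y)) x (l * m).
Proof. by move=> H1 H2; exact: (is_derive1_comp H2 H1). Qed.
Lemma isD_inv f x l : isD f x l -> f x != 0 ->
  isD (fun y => (f y)^-1) x (- l / (f x) ^+ 2).
Proof.
move=> H fx; apply: (is_derive_eq (is_deriveV fx H)).
by rewrite /GRing.scale/=; field.
Qed.
Lemma isD_cont f x l : isD f x l -> {for x, continuous f}.
Proof. by move=> [/derivable1_diffP/differentiable_continuous]. Qed.
Lemma isD_near f g x l : (\near x, f x = g x) -> isD f x l -> isD g x l.
Proof. by move=> fg; apply/near_eq_is_derive => //; rewrite oner_eq0. Qed.
Lemma isD_ext f g x l : f =1 g -> isD f x l -> isD g x l.
Proof. by move=> /funext ->. Qed.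
Lemma isD_sqrt f x l : isD f x l -> 0 < f x ->
  isD (fun y => Num.sqrt (f y)) x (l / (2 * Num.sqrt (f x))).
Proof.
move=> H fx; have := @is_derive1_sqrt R (f x) fx => H1.
apply: (isD_eq (isD_comp H H1)).
by rewrite mulrC.
Qed.
Lemma isD_rev f x l : isD f (- x) l -> isD (fun y => f (- y)) x (- l).
Proof.
move=> H; apply: (isD_eq (isD_comp (isD_opp (isD_id x)) H)).
by ring.
Qed.

Lemma isD_cont_on a b f f' :
  (forall x, a <= x <= b -> isD f x (f' x)) -> cont_on a b f.
Proof. by move=> H x /H /isD_cont. Qed.

Lemma mvt a b f f' : a < b -> (forall x, a <= x <= b -> isD f x (f' x)) ->
  exists2 c, a < c < b & f b - f a = f' c * (b - a).
Proof.
move=> ab H; have [||c] := @MVT R f f' a b ab.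
- by move=> x; rewrite in_itv/= => xab; apply: H; qlra.
- exact/cont_on_within/isD_cont_on.
- by rewrite in_itv/=; exists c.
Qed.

Lemma isD_nondecr a b f f' : a <= b -> (forall x, a <= x <= b -> isD f x (f' x)) ->
  (forall x, a <= x <= b -> 0 <= f' x) -> f a <= f b.
Proof.
rewrite le_eqVlt => /predU1P[->//|ab] H f0.
have [c cab] := mvt ab H; rewrite -subr_ge0 => ->.
by rewrite mulr_ge0 ?f0//; qlra.
Qed.

Lemma isD_incr a b f f' : a < b -> (forall x, a <= x <= b -> isD f x (f' x)) ->
  (forall x, a < x < b -> 0 < f' x) -> f a < f b.
Proof.
move=> ab H f0; have [c cab] := mvt ab H; rewrite -subr_gt0 => ->.
by rewrite mulr_gt0 ?f0//; qlra.
Qed.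

End RealFunctions.
Notation isD f x l := (is_derive (x : _) (1 : _) (f : _ -> _) l).

(** * Arcs with a lifted chord angle *)

Section Arc.
Context {R : realType} (D t eta eps : R).

(* [ath] is the tangent angle and [aTh u v] the angle of the chord from [u] to [v], lifted so that
   it extends [ath] on the diagonal; [am] and [ad] are the speed and the chord length.  [eps] is a
   modulus of continuity of [aTh] for [eta], and the step of the inductions on the length. *)
Record arc (p s : R) := Arc {
  aX : R -> R; aY : R -> R; aX' : R -> R; aY' : R -> R;
  aA : R -> R; ath : R -> R; aTh : R -> R -> R; am : R -> R; ad : R -> R -> R;
  a_dX : forall u, p <= u <= s -> isD aX u (aX' u);
  a_dY : forall u, p <= u <= s -> isD aY u (aY' u);
  a_dA : forall u, p <= u <= s -> isD aA u (2^-1 * (aX' u * aY u - aY' u * aX u));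
  a_m : forall u, p <= u <= s -> 0 < am u;
  a_X' : forall u, p <= u <= s -> aX' u = am u * cos (ath u);
  a_Y' : forall u, p <= u <= s -> aY' u = am u * sin (ath u);
  a_d : forall u v, p <= u -> u < v -> v <= s -> 0 < ad u v;
  a_chX : forall u v, p <= u -> u < v -> v <= s -> aX v - aX u = ad u v * cos (aTh u v);
  a_chY : forall u v, p <= u -> u < v -> v <= s -> aY v - aY u = ad u v * sin (aTh u v);
  a_diag : forall u, p <= u <= s -> aTh u u = ath u;
  a_cr : forall u, p <= u <= s -> cont_on p s (aTh u);
  a_cl : forall v, p <= v <= s -> cont_on p s (aTh ^~ v);
  a_mod : forall u v u' v', p <= u -> u <= v -> v <= s -> p <= u' -> u' <= v' -> v' <= s ->
    u - eps <= u' <= u + eps -> v - eps <= v' <= v + eps ->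
    aTh u v - eta < aTh u' v' < aTh u v + eta;
  a_F : forall u v, p <= u <= s -> p <= v <= s ->
    aA v - aA u - t * (ath v - ath u) <= D
}.

Lemma itv_sub (p s p' s' u : R) : p <= p' -> s' <= s -> p' <= u <= s' -> p <= u <= s.
Proof. by move=> pp ss /andP[u1 u2]; rewrite (le_trans pp u1) (le_trans u2 ss). Qed.

(** This and the following operations on arcs end with [Defined], because later proofs compute their
    fields by simplification. *)
Definition arc_sub p s p' s' (pp : p <= p') (ss : s' <= s) (G : arc p s) : arc p' s'.
Proof.
pose X := aX G; pose Y := aY G; pose X' := aX' G; pose Y' := aY' G; pose A := aA G.
pose th := ath G; pose Th := aTh G; pose m := am G; pose d := ad G.
move: (@a_dX _ _ G) (@a_dY _ _ G) (@a_dA _ _ G) (@a_m _ _ G) (@a_X' _ _ G) (@a_Y' _ _ G) (@a_d _ _ G)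
  (@a_chX _ _ G) (@a_chY _ _ G) (@a_diag _ _ G) (@a_cr _ _ G) (@a_cl _ _ G) (@a_mod _ _ G) (@a_F _ _ G).
rewrite -/X -/Y -/X' -/Y' -/A -/th -/Th -/m -/d => h1 h2 h3 h4 h5 h6 h7 h8 h9 h10 h11 h12 h13 h14.
pose sub u := itv_sub (u := u) pp ss.
refine (@Arc p' s' X Y X' Y' A th Th m d (fun u hu => h1 u (sub u hu)) (fun u hu => h2 u (sub u hu))
  (fun u hu => h3 u (sub u hu)) (fun u hu => h4 u (sub u hu)) (fun u hu => h5 u (sub u hu))
  (fun u hu => h6 u (sub u hu)) _ _ _ (fun u hu => h10 u (sub u hu)) _ _ _
  (fun u v hu hv => h14 u v (sub u hu) (sub v hv))).
- by move=> u v a1 a2 a3; apply: h7 => //; [exact: le_trans pp a1|exact: le_trans a3 ss].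
- by move=> u v a1 a2 a3; apply: h8 => //; [exact: le_trans pp a1|exact: le_trans a3 ss].
- by move=> u v a1 a2 a3; apply: h9 => //; [exact: le_trans pp a1|exact: le_trans a3 ss].
- by move=> u hu; apply: (cont_on_sub pp ss); apply/h11/sub.
- by move=> u hu; apply: (cont_on_sub pp ss); apply/h12/sub.
- move=> u v u' v' a1 a2 a3 a4 a5 a6; apply: h13 => //.
  + exact: le_trans pp a1.
  + exact: le_trans a3 ss.
  + exact: le_trans pp a4.
  + exact: le_trans a6 ss.
Defined.

(** Reflection in the x-axis. It negates both [A] and the angle, hence turns the estimate [a_F] from
    [u] to [v] into that from [v] to [u], with the same [D]. *)
Definition arc_mirror p s (G : arc p s) : arc p s.
Proof.
pose X := aX G; pose Y := aY G; pose X' := aX' G; pose Y' := aY' G; pose A := aA G.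
pose th := ath G; pose Th := aTh G; pose m := am G; pose d := ad G.
move: (@a_dX _ _ G) (@a_dY _ _ G) (@a_dA _ _ G) (@a_m _ _ G) (@a_X' _ _ G) (@a_Y' _ _ G) (@a_d _ _ G)
  (@a_chX _ _ G) (@a_chY _ _ G) (@a_diag _ _ G) (@a_cr _ _ G) (@a_cl _ _ G) (@a_mod _ _ G) (@a_F _ _ G).
rewrite -/X -/Y -/X' -/Y' -/A -/th -/Th -/m -/d => h1 h2 h3 h4 h5 h6 h7 h8 h9 h10 h11 h12 h13 h14.
refine (@Arc p s X (fun u => - Y u) X' (fun u => - Y' u) (fun u => - A u)
  (fun u => - th u) (fun u v => - Th u v) m d h1 _ _ h4 _ _ h7 _ _ _ _ _ _ _).
- by move=> u /h2 /isD_opp.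
- by move=> u /h3 /isD_opp H; apply: (isD_eq H); ring.
- by move=> u /h5; rewrite cosN.
- by move=> u /h6 ->; rewrite sinN mulrN.
- by move=> u v pu uv vs; rewrite cosN h8.
- by move=> u v pu uv vs; rewrite sinN mulrN -h9// opprB opprK addrC.
- by move=> u pu; rewrite h10.
- by move=> u /h11 /cont_onN.
- by move=> u /h12 /cont_onN.
- by move=> u v u' v' a1 a2 a3 a4 a5 a6 a7 a8; have := h13 u v u' v' a1 a2 a3 a4 a5 a6 a7 a8; qlra.
- by move=> u v hu hv; have := h14 v u hv hu; qlra.
Defined.

(** Reversal of the parameter. [A] is kept, since the area form changes sign together with the
    parameter, while tangents and chords turn by [pi]. *)
Definition arc_rev p s (G : arc p s) : arc (- s) (- p).
Proof.
pose X := aX G; pose Y := aY G; pose X' := aX' G; pose Y' := aY' G; pose A := aA G.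
pose th := ath G; pose Th := aTh G; pose m := am G; pose d := ad G.
move: (@a_dX _ _ G) (@a_dY _ _ G) (@a_dA _ _ G) (@a_m _ _ G) (@a_X' _ _ G) (@a_Y' _ _ G) (@a_d _ _ G)
  (@a_chX _ _ G) (@a_chY _ _ G) (@a_diag _ _ G) (@a_cr _ _ G) (@a_cl _ _ G) (@a_mod _ _ G) (@a_F _ _ G).
rewrite -/X -/Y -/X' -/Y' -/A -/th -/Th -/m -/d => h1 h2 h3 h4 h5 h6 h7 h8 h9 h10 h11 h12 h13 h14.
refine (@Arc (- s) (- p) (fun u => X (- u)) (fun u => Y (- u)) (fun u => - X' (- u))
  (fun u => - Y' (- u)) (fun u => A (- u))
  (fun u => th (- u) + pi) (fun u v => Th (- v) (- u) + pi) (fun u => m (- u))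
  (fun u v => d (- v) (- u)) _ _ _ _ _ _ _ _ _ _ _ _ _ _).
- by move=> u hu; apply: isD_rev; apply: h1; qlra.
- by move=> u hu; apply: isD_rev; apply: h2; qlra.
- move=> u hu; have /isD_rev H := h3 (- u) ltac:(qlra); apply: (isD_eq H); ring.
- by move=> u hu; apply: h4; qlra.
- by move=> u hu; rewrite cosDpi h5; [ring|qlra].
- by move=> u hu; rewrite sinDpi h6; [ring|qlra].
- by move=> u v ? ? ?; apply: h7; qlra.
- by move=> u v ? ? ?; rewrite cosDpi mulrN -h8; [ring|qlra..].
- by move=> u v ? ? ?; rewrite sinDpi mulrN -h9; [ring|qlra..].
- by move=> u hu; rewrite h10//; qlra.
- move=> u hu x hx; apply: continuousD; last exact: cst_continuous.
  apply: (@continuous_comp _ _ _ -%R (fun y => Th y (- u))); first exact: opp_continuous.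
  by apply: h12; qlra.
- move=> u hu x hx; apply: continuousD; last exact: cst_continuous.
  apply: (@continuous_comp _ _ _ -%R (fun y => Th (- u) y)); first exact: opp_continuous.
  by apply: h11; qlra.
- move=> u v u' v' a1 a2 a3 a4 a5 a6 a7 a8.
  by have := h13 (- v) (- u) (- v') (- u') ltac:(qlra) ltac:(qlra) ltac:(qlra) ltac:(qlra) ltac:(qlra)
    ltac:(qlra) ltac:(qlra) ltac:(qlra); qlra.
- by move=> u v hu hv; have := h14 (- u) (- v) ltac:(qlra) ltac:(qlra); qlra.
Defined.

(** Rotation by [- c] about the origin, which leaves the area form invariant. *)
Definition arc_rot (c : R) p s (G : arc p s) : arc p s.
Proof.
pose X := aX G; pose Y := aY G; pose X' := aX' G; pose Y' := aY' G; pose A := aA G.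
pose th := ath G; pose Th := aTh G; pose m := am G; pose d := ad G.
move: (@a_dX _ _ G) (@a_dY _ _ G) (@a_dA _ _ G) (@a_m _ _ G) (@a_X' _ _ G) (@a_Y' _ _ G) (@a_d _ _ G)
  (@a_chX _ _ G) (@a_chY _ _ G) (@a_diag _ _ G) (@a_cr _ _ G) (@a_cl _ _ G) (@a_mod _ _ G) (@a_F _ _ G).
rewrite -/X -/Y -/X' -/Y' -/A -/th -/Th -/m -/d => h1 h2 h3 h4 h5 h6 h7 h8 h9 h10 h11 h12 h13 h14.
refine (@Arc p s (fun u => cos c * X u + sin c * Y u) (fun u => cos c * Y u - sin c * X u)
  (fun u => cos c * X' u + sin c * Y' u) (fun u => cos c * Y' u - sin c * X' u) A
  (fun u => th u - c) (fun u v => Th u v - c) m d _ _ _ h4 _ _ h7 _ _ _ _ _ _ _).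
- move=> u hu; apply: (isD_eq (isD_add (isD_mul (isD_cst (cos c) u) (h1 _ hu)) (isD_mul (isD_cst (sin
    c) u) (h2 _ hu)))); ring.
- move=> u hu; apply: (isD_eq (isD_sub (isD_mul (isD_cst (cos c) u) (h2 _ hu)) (isD_mul (isD_cst (sin
    c) u) (h1 _ hu)))); ring.
- move=> u hu; apply: (isD_eq (h3 _ hu)).
  have cs := cos2Dsin2 c.
  transitivity (2^-1 * (X' u * Y u - Y' u * X u) * (cos c ^+ 2 + sin c ^+ 2)); last by ring.
  by rewrite cs mulr1.
- by move=> u hu; rewrite cosB h5// h6//; ring.
- by move=> u hu; rewrite sinB h5// h6//; ring.
- move=> u v a1 a2 a3; rewrite cosB mulrDr !mulrA -h8// -h9//; ring.
- move=> u v a1 a2 a3; rewrite sinB mulrBr !mulrA -h8// -h9//; ring.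
- by move=> u /h10 ->.
- by move=> u /h11 H x hx; apply: continuousB; [exact: H|exact: cst_continuous].
- by move=> u /h12 H x hx; apply: continuousB; [exact: H|exact: cst_continuous].
- by move=> u v u' v' a1 a2 a3 a4 a5 a6 a7 a8; have := h13 u v u' v' a1 a2 a3 a4 a5 a6 a7 a8; qlra.
- by move=> u v hu hv; have := h14 u v hu hv; qlra.
Defined.

End Arc.

(** * One-sided first-order conditions at extrema *)

Section Extrema.
Context {R : realType}.
Implicit Types (f : R -> R) (a b c x l : R).

Lemma isD_nbhs f x l (e : R) : isD f x l -> 0 < e ->
  exists2 d : R, 0 < d & forall h, h != 0 -> - d < h < d ->
    l - e < (f (h + x) - f x) / h < l + e.
Proof.
move=> [H <-] e0; have /cvgrPdist_lt/(_ _ e0) := H.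
case/nbhs_ballP => d /= d0 Hd; exists d => // h h0 hd.
have /Hd : ball 0 d h by rewrite /ball/= sub0r normrN ltr_norml; qlra.
move=> /(_ h0); rewrite /shift/= /GRing.scale/= mulr1 ltr_norml mulrC.
by rewrite /derive; qlra.
Qed.

Lemma isD_min_right f x l b : isD f x l -> x < b ->
  (forall y, x <= y <= b -> f x <= f y) -> 0 <= l.
Proof.
move=> H xb fm; rewrite leNgt; apply/negP => l0.
have [|d d0 Hd] := isD_nbhs H (e := - l); first qlra.
pose h := Num.min (b - x) (d / 2).
have h0 : 0 < h by rewrite lt_min; qlra.
have hd : h <= d / 2 by rewrite ge_min lexx orbT.
have hb : h <= b - x by rewrite ge_min lexx.
have := Hd h (lt0r_neq0 h0) ltac:(qlra); rewrite subrr => /andP[_].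
by rewrite ltr_pdivrMr// mul0r; have := fm (h + x) ltac:(qlra); qlra.
Qed.

Lemma isD_min_left f x l a : isD f x l -> a < x ->
  (forall y, a <= y <= x -> f x <= f y) -> l <= 0.
Proof.
move=> H ax fm; have H' : isD (fun y => f (- y)) (- x) (- l).
  by apply: isD_rev; rewrite opprK.
have := isD_min_right (b := - a) H'; rewrite oppr_ge0; apply; first qlra.
by move=> y hy; rewrite opprK; apply: fm; qlra.
Qed.

Lemma isD_pos_right f x l : isD f x l -> 0 < l ->
  exists2 d : R, 0 < d & forall y, x < y < x + d -> f x < f y.
Proof.
move=> H l0; have [d d0 Hd] := isD_nbhs H l0; exists d => // y xy.
have h0 : 0 < y - x by qlra.
have := Hd (y - x) (lt0r_neq0 h0) ltac:(qlra); rewrite subrK subrr => /andP[+ _].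
by rewrite ltr_pdivlMr// mul0r; qlra.
Qed.

Lemma sin_gt0_pi2 x : - (2 * pi) < x < - pi -> 0 < sin x.
Proof.
move=> h; rewrite -[x]opprK sinN oppr_gt0 -[- x](subrK pi) sinDpi oppr_lt0.
by apply: sin_gt0_pi; qlra.
Qed.

Lemma sin_lt0_npi x : - pi < x < 0 -> sin x < 0.
Proof. by move=> h; rewrite -[x]opprK sinN oppr_lt0; apply: sin_gt0_pi; qlra. Qed.

End Extrema.

(** * The chords from a maximum of the area, in normalised position *)

Section Core.
Context {R : realType} (D t eta eps p s : R) (G : arc D t eta eps p s).
Hypotheses (t0 : 0 < t) (eta0 : 0 < eta) (eps0 : 0 < eps).
Hypothesis (Dt : D + t * eta < t * (pi / 2)).
Hypothesis ps : p < s.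
Local Notation X := (aX G). Local Notation Y := (aY G).
Local Notation A := (aA G). Local Notation th := (ath G).
Local Notation Th := (aTh G). Local Notation d := (ad G).
Hypothesis Amax : forall v, p <= v <= s -> A v <= A p.
Hypothesis thp : th p = 0.
Hypothesis Yp : Y p = 0.
Hypothesis Xp : 0 <= X p.

Let pi0 : 0 < pi :> R := pi_gt0 R.

Ltac ctx := move: (t0) (eta0) (eps0) (Dt) (ps) (pi0) => ? ? ? ? ? ?.

Lemma D_ge0 : 0 <= D.
Proof. by ctx; have := a_F G (u := p) (v := p) ltac:(qlra) ltac:(qlra); qlra. Qed.

(** At the maximum [p] the area difference is one-signed, so the estimate from [v] to [p] bounds the
    turning alone. *)
Lemma core_th v : p <= v <= s -> t * th v <= D.
Proof.
ctx; move=> hv; have := a_F G (u := v) (v := p) hv ltac:(qlra).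
by have := Amax hv; rewrite thp; qlra.
Qed.

Lemma core_th_lt v : p <= v <= s -> th v < pi / 2 - eta.
Proof.
ctx; move=> hv; rewrite -(ltr_pM2l t0); have := core_th hv.
by rewrite mulrBr; qlra.
Qed.

Section Upto.
Variable s' : R.
Hypothesis ps' : p <= s'.
Hypothesis s's : s' <= s.
Hypothesis Thge : forall v, p <= v <= s' -> 0 <= Th p v.
Hypothesis Ths' : Th p s' = 0.

Ltac ctx' := ctx; move: (ps') (s's) => ? ?.

(** A first angle [pi] at [v1] would put the arc above the x-axis with [v1] on it, so no chord into
    [v1] would point upwards. But the angle of these chords starts at [pi] and ends at [th v1 < pi],
    hence passes through angles with positive sine. *)
Lemma core_turn v : p <= v <= s' -> Th p v < pi.
Proof.
ctx'; move=> hv; rewrite ltNge; apply/negP => hpi.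
have cTh : cont_on p v (Th p) by apply: (cont_on_sub (lexx p) _ (a_cr (a := G) (u := p) _)); qlra.
have pv : p <= v by qlra.
have [||v1 [v1v v1pi v1lt]] := first_hit (c := pi) pv cTh; [by have := a_diag G (u := p) ltac:(qlra);
  rewrite thp; qlra|by []|].
have Yge w : p <= w <= v1 -> 0 <= Y w.
  move=> /andP[pw wv1].
  have [->|pw'] := eqVneq w p; first by rewrite Yp.
  have lpw : p < w by rewrite lt_neqAle eq_sym pw'.
  have := a_chY G (lexx p) lpw ltac:(qlra); rewrite Yp subr0 => ->.
  apply: mulr_ge0; first by apply/ltW/(a_d G); qlra.
  apply: sin_ge0_pi; rewrite Thge//=; last qlra.
  have [->|wv] := eqVneq w v1; first by rewrite v1pi.
  by apply/ltW/v1lt; rewrite pw lt_neqAle wv.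
have Yv1 : Y v1 = 0.
  have := a_chY G (lexx p) (_ : p < v1) (_ : v1 <= s); rewrite Yp subr0 => ->; try qlra.
  by rewrite v1pi sinpi mulr0.
have sle w : p <= w < v1 -> sin (Th w v1) <= 0.
  move=> hw; have dw := a_d G (u := w) (v := v1) ltac:(qlra) ltac:(qlra) ltac:(qlra).
  have := a_chY G (u := w) (v := v1) ltac:(qlra) ltac:(qlra) ltac:(qlra).
  rewrite Yv1 sub0r => h; rewrite -(pmulr_rle0 _ dw) -h oppr_le0.
  by apply: Yge; qlra.
have thv1 : th v1 < pi by have := @core_th_lt v1 ltac:(qlra); qlra.
(* An angle in [(0, pi)] strictly between [th v1] and [pi], also when [th v1] is very negative. *)
pose val := Num.max (pi / 2) ((th v1 + pi) / 2).
have val1 : pi / 2 <= val by rewrite le_max lexx.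
have val2 : (th v1 + pi) / 2 <= val by rewrite le_max lexx orbT.
have val3 : val < pi by rewrite gt_max; qlra.
have [|||w hw wval] := @ivt_dec _ p v1 (Th ^~ v1) val.
- qlra.
- by apply: (cont_on_sub (lexx p) _ (a_cl (a := G) _)); qlra.
- by have := a_diag G (u := v1) ltac:(qlra); rewrite v1pi; qlra.
have wv1 : w != v1.
  by apply/eqP => wv1; move: wval (a_diag G (u := v1) ltac:(qlra)); rewrite wv1; qlra.
have : w < v1 by rewrite lt_neqAle wv1; qlra.
move=> wv1'; have := sle w ltac:(qlra); rewrite leNgt => /negP; apply.
by rewrite wval; apply: sin_gt0_pi; qlra.
Qed.

Lemma core_Y v : p <= v <= s' -> 0 <= Y v.
Proof.
ctx'; move=> /andP[pw wv1]; have [->|pw'] := eqVneq v p; first by rewrite Yp.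
have lpw : p < v by rewrite lt_neqAle eq_sym pw'.
have := a_chY G (lexx p) lpw ltac:(qlra); rewrite Yp subr0 => ->.
apply: mulr_ge0; first by apply/ltW/(a_d G); qlra.
have h1 := Thge (v := v) ltac:(qlra); have h2 := @core_turn v ltac:(qlra).
by apply: sin_ge0_pi; qlra.
Qed.

Lemma core_s' : p < s' -> Y s' = 0 /\ X p < X s'.
Proof.
ctx'; move=> lps; have ds := a_d G (lexx p) lps s's.
have := a_chY G (lexx p) lps s's; rewrite Yp subr0 Ths' sin0 mulr0; split => //.
have := a_chX G (lexx p) lps s's; rewrite Ths' cos0 mulr1 => h; qlra.
Qed.

(** The angle of the chords into [s'] is [0] at [p], and leaving [[- pi, 0]] on either side would
    produce a chord that ascends to [s'], although the arc lies above the x-axis and [s'] on it. *)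
Lemma core_Ths' w : p < s' -> p <= w <= s' -> - pi <= Th w s' <= 0.
Proof.
ctx'; move=> lps hw; have [Ys' _] := core_s' lps.
have sle v : p <= v < s' -> sin (Th v s') <= 0.
  move=> hv; have dv := a_d G (u := v) (v := s') ltac:(qlra) ltac:(qlra) ltac:(qlra).
  have := a_chY G (u := v) (v := s') ltac:(qlra) ltac:(qlra) ltac:(qlra).
  rewrite Ys' sub0r => h; rewrite -(pmulr_rle0 _ dv) -h oppr_le0.
  by apply: core_Y; qlra.
have cc : cont_on p w (Th ^~ s').
  by apply: (cont_on_sub (lexx p) _ (a_cl (a := G) _)); qlra.
apply/andP; split; rewrite leNgt; apply/negP => hlt.
- pose val := Num.max (- (3 / 2 * pi)) ((Th w s' - pi) / 2).
  have val1 : - (3 / 2 * pi) <= val by rewrite le_max lexx.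
  have val2 : (Th w s' - pi) / 2 <= val by rewrite le_max lexx orbT.
  have val3 : val < - pi by rewrite gt_max; qlra.
  have [|||v hv vval] := @ivt_dec _ p w (Th ^~ s') val; [qlra|by []|by rewrite Ths'; qlra|].
  have vw : v != w by apply/eqP => vw; move: vval; rewrite vw; qlra.
  have vw' : v < w by rewrite lt_neqAle vw; qlra.
  have := sle v ltac:(qlra); rewrite leNgt => /negP; apply.
  by rewrite vval; apply: sin_gt0_pi2; qlra.
- pose val := Num.min (pi / 2) (Th w s' / 2).
  have val1 : val <= pi / 2 by rewrite ge_min lexx.
  have val2 : val <= Th w s' / 2 by rewrite ge_min lexx orbT.
  have val3 : 0 < val by rewrite lt_min; qlra.
  have [|||v hv vval] := @ivt _ p w (Th ^~ s') val; [qlra|by []|by rewrite Ths'; qlra|].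
  have vw : v != w by apply/eqP => vw; move: vval; rewrite vw; qlra.
  have vw' : v < w by rewrite lt_neqAle vw; qlra.
  have := sle v ltac:(qlra); rewrite leNgt => /negP; apply.
  by rewrite vval; apply: sin_gt0_pi; qlra.
Qed.

End Upto.
End Core.

(** The curve has to cross the line through the origin of slope [- mu]. Until then it stays above
    this line, and in comparison with the line [zeta] shows a gain of area. *)
Lemma no_right_turn {R : realType} (X Y X' Y' A : R -> R) (a b : R) : a < b ->
  (forall u, a <= u <= b -> isD X u (X' u)) ->
  (forall u, a <= u <= b -> isD Y u (Y' u)) ->
  (forall u, a <= u <= b -> isD A u (2^-1 * (X' u * Y u - Y' u * X u))) ->
  (forall u, a <= u <= b -> 0 < X' u) ->
  0 <= X a -> Y a = 0 -> Y' a = 0 -> Y b < 0 ->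
  exists v, a <= v <= b /\ A a < A v.
Proof.
move=> ab dX dY dA X'0 Xa Ya Y'a Yb.
have Xb : X a < X b.
  by apply: (isD_incr ab dX) => x hx; apply: X'0; qlra.
(* Minus half the slope of the ray through the point at [b], so that [z] is negative at [b]. *)
pose mu := - Y b / (2 * X b).
have mu0 : 0 < mu by rewrite divr_gt0//; qlra.
have muX : mu * X b = - Y b / 2 by rewrite /mu; field; rewrite gt_eqF//; qlra.
pose z v := Y v + mu * X v.
have dz u : a <= u <= b -> isD z u (Y' u + mu * X' u).
  move=> hu; apply: (isD_eq (isD_add (dY _ hu) (isD_mul (isD_cst mu u) (dX _ hu)))); ring.
have aab : a <= a <= b by qlra.
have za : 0 <= z a by rewrite /z Ya add0r mulr_ge0// ltW.
have z'a : 0 < Y' a + mu * X' a by rewrite Y'a add0r mulr_gt0// X'0.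
have [d d0 Hd] := isD_pos_right (dz a aab) z'a.
(* If [X a = 0], then [z a = 0]; the search for a zero of [z] therefore starts slightly after [a],
   where [z] is positive because of its derivative at [a]. *)
pose w := Num.min ((a + b) / 2) (a + d / 2).
have w1 : a < w by rewrite lt_min; qlra.
have w2 : w <= (a + b) / 2 by rewrite ge_min lexx.
have w3 : w <= a + d / 2 by rewrite ge_min lexx orbT.
have zw : 0 < z w by apply: (le_lt_trans za); apply: Hd; qlra.
have cz : cont_on w b (fun v => - z v).
  by apply/cont_onN/(isD_cont_on (f' := fun u => Y' u + mu * X' u)) => u hu; apply: dz; qlra.
have [|||s [hs zs zlt]] := first_hit (c := 0) _ cz; [qlra|qlra|by rewrite /z muX; qlra|].
exists s; split; first qlra.
(* The terms in [Y'] cancel in the derivative, and where [z = 0] only [2 * (A v - A a)] remains. *)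
pose zeta v := Y v * X v + 2 * (A v - A a) + mu * (X v * X v).
have dzeta u : a <= u <= b -> isD zeta u (2 * X' u * z u).
  move=> hu; apply: (isD_eq (isD_add (isD_add (isD_mul (dY _ hu) (dX _ hu))
    (isD_mul (isD_cst 2 u) (isD_sub (dA _ hu) (isD_cst (A a) u))))
    (isD_mul (isD_cst mu u) (isD_mul (dX _ hu) (dX _ hu))))); rewrite /z; qlra.
have zpos u : a < u < s -> 0 < z u.
  move=> hu; have [uw|wu] := ltP u w.
    by apply: (le_lt_trans za); apply: Hd; qlra.
  by have := zlt u ltac:(qlra); qlra.
have as' : a < s by qlra.
have : zeta a < zeta s.
  apply: (isD_incr (f' := fun u => 2 * X' u * z u) as') => y hy; first by apply: dzeta; qlra.
  by rewrite mulr_gt0 ?zpos// mulr_gt0// X'0//; qlra.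
have -> : zeta a = mu * (X a * X a) by rewrite /zeta Ya subrr; ring.
have Ys : Y s = - (mu * X s) by move: zs; rewrite /z; qlra.
have -> : zeta s = 2 * (A s - A a) by rewrite /zeta Ys; ring.
have : 0 <= mu * (X a * X a) by apply: mulr_ge0; [exact: ltW|exact: mulr_ge0].
qlra.
Qed.

(** * The induction step: minima of the area on shorter arcs *)

Section Step.
Context {R : realType} (D t eta eps : R).
Local Notation arc := (arc D t eta eps).

(** The inductive statement. It concerns all arcs over [[p, s]], because the induction hypothesis is
    applied to reflected and reversed pieces of the given one. Geometrically, the arc ends to the
    right of a radial tangent at [p]. *)
Definition rising (p s : R) := forall (G : arc p s) r, p < s -> 0 <= r ->
  aX G p = r * cos (ath G p) -> aY G p = r * sin (ath G p) ->
  aTh G p s < ath G p -> exists v, p <= v <= s /\ aA G p < aA G v.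

Lemma falling p s (G : arc p s) r : rising p s -> p < s -> 0 <= r ->
  aX G p = r * cos (ath G p) -> aY G p = r * sin (ath G p) ->
  ath G p < aTh G p s -> exists v, p <= v <= s /\ aA G v < aA G p.
Proof.
move=> H ps r0 Xp Yp thTh; have [|||v] := H (arc_mirror G) r ps r0.
- by rewrite /= cosN.
- by rewrite /= sinN mulrN -Yp.
- by rewrite /= ltrN2.
by rewrite /= ltrN2; exists v.
Qed.

(** Reversal adds [pi] to the tangent angle, which turns a nonpositive multiple of the tangent at
    the last point into a nonnegative one at the first. *)
Lemma falling_rev p s (G : arc p s) r : rising (- s) (- p) -> p < s -> r <= 0 ->
  aX G s = r * cos (ath G s) -> aY G s = r * sin (ath G s) ->
  ath G s < aTh G p s -> exists v, p <= v <= s /\ aA G v < aA G s.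
Proof.
move=> H ps r0 Xp Yp thTh.
have [|||||v [hv]] := @falling _ _ (arc_rev G) (- r) H; rewrite /= ?opprK.
- qlra.
- qlra.
- by rewrite cosDpi Xp; ring.
- by rewrite sinDpi Yp; ring.
- by rewrite ltrD2r.
by move=> h; exists (- v); split => //; qlra.
Qed.

Variables (p s : R) (G : arc p s).
Local Notation X := (aX G). Local Notation Y := (aY G).
Local Notation A := (aA G). Local Notation th := (ath G).
Local Notation Th := (aTh G). Local Notation d := (ad G).

(** [A + X Y / 2] has derivative [X' Y], the area under a graph, and the correction vanishes at both
    ends. *)
Lemma area_nondecr s' : p <= s' -> s' <= s -> Y p = 0 -> Y s' = 0 ->
  (forall v, p <= v <= s' -> 0 <= Y v) -> (forall v, p <= v <= s' -> 0 <= cos (th v)) -> A p <= A s'.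
Proof.
move=> ps' s's Yp Ys' HY cosge.
have := @isD_nondecr R p s' (fun u => A u + 2^-1 * (X u * Y u)) (fun u => aX' G u * Y u) ps'.
rewrite Ys' Yp !mulr0 !addr0; apply=> u hu; have hu' : p <= u <= s by qlra.
  apply: (isD_eq (isD_add (a_dA G hu') (isD_mul (isD_cst 2^-1 u) (isD_mul (a_dX G hu') (a_dY G hu'))))).
  by field.
by rewrite mulr_ge0 ?HY// (a_X' G)// mulr_ge0 ?cosge//; apply/ltW/(a_m G).
Qed.

(** Since [A m <= A v], the estimate from [m] to [v] bounds the downward turning by [D / t];
    together with [th m >= - eta] this keeps the angle above [- pi / 2]. *)
Lemma cos_ge0_of_min m v : 0 < t -> D + t * eta < t * (pi / 2) -> 0 < eta -> p <= m <= s -> p <= v <= s ->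
  A m <= A v -> - eta <= th m -> th v < pi / 2 - eta -> 0 <= cos (th v).
Proof.
move=> t0 Dt eta0 hm hv Hm thm thv; apply: cos_ge0_pihalf; apply/andP; split; last qlra.
have HF := a_F G (u := m) (v := v) hm hv.
rewrite -(ler_pM2l t0).
have : t * (- eta) <= t * th m by rewrite ler_pM2l.
qlra.
Qed.

(** Inside the interval the derivative of [A] vanishes at the minimum. At [m = s'] minimality gives
    only one sign, and the other comes from the position on the nonnegative x-axis and the tangent
    angle in [[- pi, 0]]. *)
Lemma min_radial m s' : p < m -> m <= s' -> s' <= s -> Y s' = 0 -> 0 <= X s' -> - pi <= th s' <= 0 ->
  (forall v, p <= v <= s' -> A m <= A v) ->
  exists rho, X m = rho * cos (th m) /\ Y m = rho * sin (th m).
Proof.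
move=> pm ms'' s's Ys' Xs' hth mmin.
have hm' : p <= m <= s by qlra.
have hs' : p <= s' <= s by qlra.
have ms'0 : 0 <= 2^-1 * (aX' G m * Y m - aY' G m * X m).
  have [ms'|ms'] := eqVneq m s'.
    rewrite ms' Ys' mulr0 sub0r (a_Y' G)//.
    have hs : sin (th s') <= 0.
      rewrite -[th s']opprK sinN oppr_le0; apply: sin_ge0_pi; qlra.
    have ms : 0 < am G s' by apply: (a_m G).
    have h1 : am G s' * sin (th s') <= 0 by rewrite mulr_ge0_le0// ltW.
    have : am G s' * sin (th s') * X s' <= 0 by rewrite mulr_le0_ge0.
    qlra.
  apply: (isD_min_right (b := s') (a_dA G hm')); first by rewrite lt_neqAle ms'.
  by move=> y hy; apply: mmin; qlra.
have ms'1 : 2^-1 * (aX' G m * Y m - aY' G m * X m) <= 0.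
  apply: (isD_min_left (a := p) (a_dA G hm') pm) => y hy; apply: mmin; qlra.
have crit : cos (th m) * Y m = sin (th m) * X m.
  have : aX' G m * Y m = aY' G m * X m by qlra.
  rewrite (a_X' G)// (a_Y' G)// -!mulrA => /(mulfI _); apply.
  by rewrite gt_eqF// (a_m G).
pose rho := X m * cos (th m) + Y m * sin (th m).
have cs := cos2Dsin2 (th m).
have Xm : X m = rho * cos (th m).
  rewrite /rho mulrDl -[Y m * _ * _]mulrA [sin _ * cos _]mulrC mulrA [Y m * _]mulrC crit.
  by rewrite -[LHS]mulr1 -cs; ring.
have Ym : Y m = rho * sin (th m).
  rewrite /rho mulrDl -[X m * _ * _]mulrA [cos _ * sin _]mulrC mulrA [X m * _]mulrC -crit.
  by rewrite -[LHS]mulr1 -cs; ring.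
by exists rho.
Qed.

(* Where [A] is minimal the position is parallel to the tangent, so a shorter arc, on the side given
   by the sign of [rho], contains a smaller value of [A]. *)
Lemma step_A s' : 0 < t -> 0 < eta -> 0 < eps ->
  D + t * eta < t * (pi / 2) -> p < s -> (forall v, p <= v <= s -> A v <= A p) ->
  th p = 0 -> Y p = 0 -> 0 <= X p ->
  (forall p' s', s' - p' <= s - p - eps -> rising p' s') ->
  p < s' -> s' <= s -> (forall v, p <= v <= s' -> 0 <= Th p v) -> Th p s' = 0 -> A p <= A s'.
Proof.
move=> t0 eta0 eps0 Dt ps Amax thp Yp Xp IH ps' s's Thge Ths'; have pi0 := pi_gt0 R.
have pps : p <= p <= s by qlra.
have Xp0 := Xp.
have ps'w : p <= s' by qlra.
have [Ys' Xs'] := core_s' t0 eta0 eps0 Dt ps Yp ps'w s's Ths' ps'.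
have HY := core_Y t0 eta0 eps0 Dt ps Amax thp Yp ps'w s's Thge.
have HT := fun w => core_Ths' (w := w) t0 eta0 eps0 Dt ps Amax thp Yp ps'w s's Thge Ths' ps'.
have Hturn := core_turn t0 eta0 eps0 Dt ps Amax thp Yp ps'w s's Thge.
rewrite leNgt; apply/negP => As'.
have cA : cont_on p s' A.
  by apply: (isD_cont_on (f' := fun u => 2^-1 * (aX' G u * Y u - aY' G u * X u))) => u hu;
    apply: (a_dA G); qlra.
have [m hm mmin] := evt_min ps'w cA.
have Am : A m < A p by have := mmin s' ltac:(qlra); qlra.
have pm : p < m.
  by rewrite lt_neqAle; apply/andP; split; [apply/eqP => pm; move: Am; rewrite -pm; qlra|qlra].
have hm' : p <= m <= s by qlra.
have mles : m <= s by case/andP: hm'.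
(* If the tangent angle at the minimum is at least [- eta], no tangent up to [s'] points to the
   left; as the arc is above the axis, no area is lost. *)
have [thm|thm] := leP (- eta) (th m).
- have : A p <= A s'; last by rewrite leNgt As'.
  apply: area_nondecr => // v hv; have hv' : p <= v <= s by qlra.
  apply: (@cos_ge0_of_min m) => //; first exact: mmin.
  exact: (core_th_lt t0 eta0 eps0 Dt ps Amax thp hv').
have [rho [Xm Ym]] : exists rho, X m = rho * cos (th m) /\ Y m = rho * sin (th m).
  have hs' : p <= s' <= s' by rewrite ps'w lexx.
  apply: (min_radial pm (s' := s')) => //; [by case/andP: hm|exact: le_trans Xp (ltW Xs')|].
  by rewrite -(a_diag G) ?HT// ps'w.
(* Tangent angles vary by less than [eta] over a parameter length [eps], and those at [p] and [m]
   differ by more. *)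
have mp : eps < m - p.
  rewrite ltNge; apply/negP => me.
  have e1 := a_diag G pps; have e2 := a_diag G hm'; rewrite thp in e1.
  have hb : p - eps <= m <= p + eps by qlra.
  by have := a_mod G (lexx p) (lexx p) (ltW ps) (ltW pm) (lexx m) mles hb hb; qlra.
clear t0 Dt Amax cA As' Am Ys' thp Xp0.
have [rho0|rho0] := leP rho 0.
(* Cutting off a piece of length [eps] makes the induction hypothesis applicable; the chord angle to
   [m] drops by less than [eta] and stays above [th m]. *)
- pose p' := p + eps.
  have pp' : p <= p' <= p + eps by rewrite /p'; qlra.
  have pp1 : p <= p' by qlra.
  have p'm : p' < m by rewrite /p'; qlra.
  have Thp'm : th m < Th p' m.
    have h1 := Thge m hm.
    have hb : p - eps <= p' <= p + eps by rewrite /p'; qlra.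
    have hc : m - eps <= m <= m + eps by qlra.
    by have := a_mod G (lexx p) (ltW pm) mles pp1 (ltW p'm) mles hb hc; qlra.
  have [|v [hv Av]] := @falling_rev p' m (arc_sub pp1 mles G) rho _ p'm rho0 Xm Ym Thp'm.
    by apply: IH; rewrite /p'; qlra.
  have hvs : p <= v <= s' by qlra.
  by move: Av; rewrite /= ltNge mmin.
(* With [rho > 0] the height of [m] has the sign of the sine of the tangent angle, so this negative
   angle must be at most [- pi]. *)
have sthm : 0 <= sin (th m).
  by rewrite -(pmulr_rge0 _ rho0) -Ym; apply: HY.
have thmpi : th m <= - pi.
  rewrite leNgt; apply/negP => h.
  by move: sthm; rewrite leNgt sin_lt0_npi// h (lt_trans thm)// oppr_lt0.
have ms' : m < s'.
  rewrite lt_neqAle; apply/andP; split; last qlra.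
  apply/eqP => ms'; have := HT s' ltac:(qlra); rewrite (a_diag G) -?ms'// => h.
  have e : th m = - pi by qlra.
  have : X m < 0 by rewrite Xm e cosN cospi mulrN1 oppr_lt0.
  by rewrite ltNge ms' (le_trans Xp (ltW Xs')).
have thlt : th m < Th m s'.
  have := HT m hm => h.
  suff : th m != - pi by rewrite neq_lt; qlra.
  (* Equality would put [m] on the negative x-axis, whereas a horizontal chord from [p] with angle
     in [[0, pi)] points to the right. *)
  apply/eqP => e; have Xneg : X m < 0 by rewrite Xm e cosN cospi mulrN1 oppr_lt0.
  have Ym0 : Y m = 0 by rewrite Ym e sinN sinpi oppr0 mulr0.
  have dm := a_d G (lexx p) pm mles.
  have := a_chY G (lexx p) pm mles; rewrite Ym0 Yp subrr => /esym/eqP.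
  rewrite mulf_eq0 gt_eqF//= => /eqP sT.
  have T0 := Thge m hm; have T1 := Hturn m hm.
  have T : Th p m = 0.
    apply/eqP; rewrite eq_le T0 andbT leNgt; apply/negP => T2.
    by have := @sin_gt0_pi _ (Th p m); rewrite T2 T1 sT ltxx => /(_ isT).
  have E := a_chX G (lexx p) pm mles; rewrite T cos0 mulr1 in E.
  by move: dm; rewrite -E subr_gt0 ltNge (le_trans (ltW Xneg) Xp).
have ppm := ltW pm.
have [||v [hv Av]] := @falling m s' (arc_sub ppm s's G) rho _ ms' _ Xm Ym thlt.
- by apply: IH; qlra.
- by apply: ltW.
have hvs : p <= v <= s' by qlra.
by move: Av; rewrite /= ltNge mmin.
Qed.

End Step.

(** * Induction on the length of the arc *)

Section Rising.
Context {R : realType} (D t eta eps : R).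
Local Notation arc := (arc D t eta eps).

(** Unless [s'] is [p], [step_A] makes it a second maximum, interior to the arc, so that the tangent
    there is horizontal. The estimate between the two maxima, in both directions, confines its angle
    to [(- pi / 2, pi / 2)] and leaves only [0]. *)
Lemma return_to_max (t0 : 0 < t) (eta0 : 0 < eta) (eps0 : 0 < eps)
  (Dt : D + t * eta < t * (pi / 2)) (p s : R) (G : arc p s) s' :
  (forall p' s', s' - p' <= s - p - eps -> rising D t eta eps p' s') ->
  p < s -> 0 <= aX G p -> aY G p = 0 -> ath G p = 0 -> (forall v, p <= v <= s -> aA G v <= aA G p) ->
  p <= s' -> s' < s -> (forall v, p <= v <= s' -> 0 <= aTh G p v) -> aTh G p s' = 0 ->
  [/\ aA G s' = aA G p, ath G s' = 0, aY G s' = 0 & 0 <= aX G s'].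
Proof.
move=> IH ps Xp Yp thp Amax ps' s's1 Thge Ths'.
have D0 := D_ge0 G t0 eta0 eps0 Dt ps.
have etapi : eta < pi / 2 by rewrite -(ltr_pM2l t0); qlra.
have pps : p <= p <= s by qlra.
have s's : s' <= s by exact: ltW.
have hs' : p <= s' <= s by rewrite ps'.
have [->//|s'p] := eqVneq s' p.
have lps' : p < s' by rewrite lt_neqAle eq_sym s'p; qlra.
have [Ys' Xs'] := core_s' t0 eta0 eps0 Dt ps Yp (ltW lps') s's Ths' lps'.
have As' : aA G s' = aA G p.
  apply/eqP; rewrite eq_le Amax//=.
  exact: (step_A t0 eta0 eps0 Dt ps Amax thp Yp Xp IH lps' s's Thge Ths').
have d0 : 2^-1 * (aX' G s' * aY G s' - aY' G s' * aX G s') = 0.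
  have H := isD_opp (a_dA G hs').
  apply/eqP; rewrite -oppr_eq0 eq_le; apply/andP; split.
    apply: (isD_min_left (a := p) H lps') => y hy; rewrite lerN2 As'; apply: Amax; qlra.
  apply: (isD_min_right (b := s) H s's1) => y hy; rewrite lerN2 As'; apply: Amax; qlra.
have : aY' G s' * aX G s' = 0 by move: d0; rewrite Ys'; qlra.
move=> /eqP; rewrite mulf_eq0 [aX G s' == 0]gt_eqF ?orbF; last qlra.
rewrite (a_Y' G)// mulf_eq0 gt_eqF ?(a_m G)//= => /eqP sth.
have F1 := a_F G pps hs'; have F2 := a_F G hs' pps.
have t1 : t * ath G s' < t * (pi / 2) by rewrite thp in F2; nra.
have t2 : t * - (pi / 2) < t * ath G s' by rewrite thp in F1; nra.
rewrite ltr_pM2l// in t1; rewrite ltr_pM2l// in t2.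
split=> //; last by rewrite (le_trans Xp (ltW Xs')).
have pi0 := @pi_gt0 R.
apply/eqP; rewrite eq_le !leNgt; apply/andP; split; apply/negP => h.
  by have := @sin_gt0_pi _ (ath G s'); rewrite sth; qlra.
by have := @sin_lt0_npi _ (ath G s'); rewrite sth; qlra.
Qed.

(* Let [s'] be the point up to which the chord angle from [p] stays nonnegative.  If [A <= A p], then
   [step_A] gives [A s' = A p], so [p] and [s'] are both maxima on the same ray; but the curve turns
   right at [s'], where [no_right_turn] makes [A] increase. *)
Lemma rising_aux (t0 : 0 < t) (eta0 : 0 < eta) (eps0 : 0 < eps)
  (Dt : D + t * eta < t * (pi / 2)) (p s : R) (G : arc p s) :
  (forall p' s', s' - p' <= s - p - eps -> rising D t eta eps p' s') ->
  p < s -> 0 <= aX G p -> aY G p = 0 -> ath G p = 0 -> aTh G p s < 0 ->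
  exists v, p <= v <= s /\ aA G p < aA G v.
Proof.
move=> IH ps Xp Yp thp Thps; apply: contrapT => nex.
have Amax v : p <= v <= s -> aA G v <= aA G p.
  by move=> hv; rewrite leNgt; apply/negP => h; apply: nex; exists v.
have pps : p <= p <= s by qlra.
have D0 := D_ge0 G t0 eta0 eps0 Dt ps.
have etapi : eta < pi / 2 by rewrite -(ltr_pM2l t0); qlra.
have hTp : 0 <= aTh G p p by rewrite (a_diag G)// thp.
have [s' [ps' Ths' Thge ex]] := first_exit (ltW ps) (a_cr (a := G) pps) hTp Thps.
have s's : s' <= s by qlra.
have hs' : p <= s' <= s by qlra.
have [As' ths' Ys' Xs'] :=
  return_to_max t0 eta0 eps0 Dt IH ps Xp Yp thp Amax (andP ps').1 (andP ps').2 Thge Ths'.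
(* [b] is within [eps] of [s']: the tangents in between are within [eta] of the horizontal and the
   chord angle from [p] lies in [(- eta, 0)], so the curve moves to the right and ends below the
   axis. *)
have [b [s'b bs] Thb] := ex _ eps0.
have pi0 := @pi_gt0 R.
have thb v : s' <= v <= b -> - eta < ath G v < eta.
  move=> hv.
  have hv' : p <= v <= s by qlra.
  have e1 := a_diag G hs'; have e2 := a_diag G hv'; rewrite ths' in e1.
  have h1 : p <= s' by qlra. have h2 : s' <= s' by []. have h3 : p <= v by qlra.
  have h4 : v <= v by []. have h5 : v <= s by qlra.
  have h6 : s' - eps <= v <= s' + eps by qlra.
  by have := a_mod G h1 h2 s's h3 h4 h5 h6 h6; qlra.
have pb : p < b by qlra.
have bs' : b <= s by qlra.
have Yb : aY G b < 0.
  have := a_chY G (lexx p) pb bs'; rewrite Yp subr0 => ->.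
  rewrite pmulr_rlt0; last by apply: (a_d G).
  apply: sin_lt0_npi; rewrite Thb andbT.
  have h1 : p <= s' by qlra. have h2 : p <= b by qlra.
  have h3 : p - eps <= p <= p + eps by qlra.
  have h4 : s' - eps <= b <= s' + eps by qlra.
  by have := a_mod G (lexx p) h1 s's (lexx p) h2 bs' h3 h4; qlra.
have s'b1 : s' < b by qlra.
have sub u : s' <= u <= b -> p <= u <= s by qlra.
have [||||||||v [hv Av]] := @no_right_turn _ (aX G) (aY G) (aX' G) (aY' G) (aA G) s' b s'b1.
- by move=> u /sub; apply: (a_dX G).
- by move=> u /sub; apply: (a_dY G).
- by move=> u /sub; apply: (a_dA G).
- move=> u hu; rewrite (a_X' G) ?sub// mulr_gt0 ?(a_m G) ?sub//.
  by apply: cos_gt0_pihalf; have := thb _ hu; qlra.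
- by [].
- by [].
- by rewrite (a_Y' G)// ths' sin0 mulr0.
- by [].
by apply: nex; exists v; rewrite -As'; split => //; qlra.
Qed.

(** [n] counts the steps of length [eps] that cover the arc, and the hypothesis is used on arcs
    shorter by one step. A rotation brings the tangent at [p] to angle [0]. *)
Theorem rising_all (t0 : 0 < t) (eta0 : 0 < eta) (eps0 : 0 < eps)
  (Dt : D + t * eta < t * (pi / 2)) (p s : R) : rising D t eta eps p s.
Proof.
have [n hn] : exists n : nat, s - p <= n%:R * eps.
  exists (Num.Def.trunc ((s - p) / eps)).+1.
  by rewrite -ler_pdivrMr// ltW// truncnS_gt.
elim: n p s hn => [|n IHn] p s hn G r ps r0 Xp Yp Thps.
  by move: hn; rewrite mul0r; qlra.
have cs := cos2Dsin2 (ath G p).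
have pps : p <= p <= s by qlra.
have [||||||v] := @rising_aux t0 eta0 eps0 Dt p s (arc_rot (ath G p) G).
- move=> p' s' hp's'; apply: IHn; apply: (le_trans hp's').
  by move: hn; rewrite -natr1; qlra.
- by [].
- rewrite /= Xp Yp.
  have -> : cos (ath G p) * (r * cos (ath G p)) + sin (ath G p) * (r * sin (ath G p)) =
    r * (cos (ath G p) ^+ 2 + sin (ath G p) ^+ 2) by ring.
  by rewrite cs mulr1.
- by rewrite /= Xp Yp; ring.
- by rewrite /= subrr.
- by rewrite /= subr_lt0.
by exists v.
Qed.

End Rising.

(** * Lifting the angle of a nonvanishing planar map *)

Lemma cont_fst (X Y Z : topologicalType) (f : X -> Z) (x : X * Y) :
  {for x.1, continuous f} -> {for x, continuous (fun y => f y.1)}.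
Proof. by move=> cf; apply: (@continuous_comp _ _ _ fst f) => //; exact: cvg_fst. Qed.

Lemma cont_snd (X Y Z : topologicalType) (f : Y -> Z) (x : X * Y) :
  {for x.2, continuous f} -> {for x, continuous (fun y => f y.2)}.
Proof. by move=> cf; apply: (@continuous_comp _ _ _ snd f) => //; exact: cvg_snd. Qed.

Lemma cont_pair (X U V : topologicalType) (f : X -> U) (g : X -> V) (x : X) :
  {for x, continuous f} -> {for x, continuous g} ->
  {for x, continuous (fun y => (f y, g y))}.
Proof. by move=> cf cg; exact: (cvg_pair cf cg). Qed.

Section Lift.
Context {R : realType}.
Implicit Types (z w : R) (p : R * R).

Lemma polar_exists z1 z2 : 0 < z1 ^+ 2 + z2 ^+ 2 ->
  exists al, z1 = Num.sqrt (z1 ^+ 2 + z2 ^+ 2) * cos al /\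
             z2 = Num.sqrt (z1 ^+ 2 + z2 ^+ 2) * sin al.
Proof.
move=> z0; set r := Num.sqrt _.
have r0 : 0 < r by rewrite sqrtr_gt0.
have r2 : r ^+ 2 = z1 ^+ 2 + z2 ^+ 2 by rewrite sqr_sqrtr// ltW.
have zr : -1 <= z1 / r <= 1.
  have : `|z1| <= r.
    by rewrite -sqrtr_sqr /r ler_wsqrtr// lerDl sqr_ge0.
  by rewrite ler_norml => h; rewrite ler_pdivlMr// ler_pdivrMr//; qlra.
have [_ ca] := acos_def zr.
set al := acos _ in ca *.
have c1 : z1 = r * cos al by rewrite ca; field; rewrite gt_eqF.
have s2 : z2 ^+ 2 = (r * sin al) ^+ 2.
  have cs := cos2Dsin2 al.
  have : z2 ^+ 2 = r ^+ 2 - (r * cos al) ^+ 2 by rewrite -c1; qlra.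
  by move=> ->; rewrite -[in LHS](mulr1 (r ^+ 2)) -cs; ring.
move/eqP : s2; rewrite eqf_sqr => /orP[] /eqP h.
  by exists al.
by exists (- al); rewrite cosN sinN mulrN.
Qed.

(** The turn from [z] to [w] as the arctangent of cross product over dot product. For a positive dot
    product this is the turn of absolute value below [pi / 2], and it depends continuously on both
    vectors. *)
Definition ang z1 z2 w1 w2 : R := atan ((z1 * w2 - z2 * w1) / (z1 * w1 + z2 * w2)).

Lemma angP z1 z2 w1 w2 r al : 0 < r -> z1 = r * cos al -> z2 = r * sin al ->
  0 < z1 * w1 + z2 * w2 ->
  w1 = Num.sqrt (w1 ^+ 2 + w2 ^+ 2) * cos (al + ang z1 z2 w1 w2) /\
  w2 = Num.sqrt (w1 ^+ 2 + w2 ^+ 2) * sin (al + ang z1 z2 w1 w2).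
Proof.
move=> r0 z1E z2E zw; rewrite /ang; set x := (_ / _).
have cs := cos2Dsin2 al.
have r2 : z1 ^+ 2 + z2 ^+ 2 = r ^+ 2 by rewrite z1E z2E -[RHS]mulr1 -cs; ring.
have w0 : 0 < w1 ^+ 2 + w2 ^+ 2.
  rewrite lt_neqAle addr_ge0 ?sqr_ge0// andbT eq_sym paddr_eq0 ?sqr_ge0//.
  rewrite !sqrf_eq0; apply/negP => /andP[/eqP h1 /eqP h2]; move: zw; rewrite h1 h2; qlra.
set m := Num.sqrt _; have m0 : 0 < m by rewrite sqrtr_gt0.
have m2 : m ^+ 2 = w1 ^+ 2 + w2 ^+ 2 by rewrite sqr_sqrtr// ltW.
have [atanr atanx] := atan_def x.
have c0 := cos_gt0_pihalf atanr.
have x2 : 1 + x ^+ 2 = (r * m / (z1 * w1 + z2 * w2)) ^+ 2.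
  rewrite /x !exprMn m2 -r2 exprVn; field; rewrite gt_eqF//.
have cE : cos (atan x) = (z1 * w1 + z2 * w2) / (r * m).
  rewrite cos_atan x2 sqrtr_sqr gtr0_norm; last by rewrite divr_gt0// mulr_gt0.
  by rewrite invf_div.
have sE : sin (atan x) = (z1 * w2 - z2 * w1) / (r * m).
  have : tan (atan x) = x by [].
  rewrite /tan => /(canRL (mulfVK _)) ->; last by rewrite gt_eqF.
  rewrite cE /x; field; rewrite !gt_eqF//.
rewrite cosD sinD cE sE.
have e1 : cos al = z1 / r by rewrite z1E; field; rewrite gt_eqF.
have e2 : sin al = z2 / r by rewrite z2E; field; rewrite gt_eqF.
rewrite e1 e2; split.
  transitivity (w1 * (z1 ^+ 2 + z2 ^+ 2) / r ^+ 2); first by rewrite r2; field; rewrite gt_eqF.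
  by field; rewrite !gt_eqF.
transitivity (w2 * (z1 ^+ 2 + z2 ^+ 2) / r ^+ 2); first by rewrite r2; field; rewrite gt_eqF.
by field; rewrite !gt_eqF.
Qed.

(** The pairs of points of the compact square where [Phi <= 0] avoid the diagonal, so the distance
    [dist] of the two points has a positive minimum on them. *)
Lemma unif_pos (a b : R) (Phi : (R * R) * (R * R) -> R) : continuous Phi ->
  (forall p, a <= p.1 <= b -> a <= p.2 <= b -> 0 < Phi (p, p)) ->
  exists2 d, 0 < d & forall p p', a <= p.1 <= b -> a <= p.2 <= b ->
    a <= p'.1 <= b -> a <= p'.2 <= b -> `|p.1 - p'.1| < d -> `|p.2 - p'.2| < d ->
    0 < Phi (p, p').
Proof.
move=> cPhi Phi0.
pose sq : set (R * R) := `[a, b] `*` `[a, b].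
pose K := (sq `*` sq) `&` [set x | Phi x <= 0].
have cK : compact K.
  apply: compact_closedI.
    by apply: compact_setX; apply: compact_setX; exact: segment_compact.
  by apply: (@closed_comp _ _ Phi [set y | y <= 0]) => [x _|]; [exact: cPhi|exact: closed_le].
pose dist (x : (R * R) * (R * R)) := Num.max `|x.1.1 - x.2.1| `|x.1.2 - x.2.2|.
have cdist : continuous dist.
  move=> x; apply: (@continuous_max _ _ (fun x : (R * R) * (R * R) => `|x.1.1 - x.2.1|) (fun x : (R *
    R) * (R * R) => `|x.1.2 - x.2.2|)).
    apply: (@continuous_comp _ _ _ (fun x : (R * R) * (R * R) => x.1.1 - x.2.1) (fun y => `|y|));
      last exact: norm_continuous.
    apply: cvgB; [apply: (@cont_fst _ _ _ fst); exact: cvg_fst|apply: (@cont_snd _ _ _ fst); exact: cvg_fst].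
  apply: (@continuous_comp _ _ _ (fun x : (R * R) * (R * R) => x.1.2 - x.2.2) (fun y => `|y|));
    last exact: norm_continuous.
  apply: cvgB; [apply: (@cont_fst _ _ _ snd); exact: cvg_snd|apply: (@cont_snd _ _ _ snd); exact: cvg_snd].
have [K0|K0] := pselect (K !=set0); last first.
  exists 1 => // p p' h1 h2 h3 h4 _ _; rewrite ltNge; apply/negP => h.
  by apply: K0; exists (p, p'); split => //; split; split; rewrite /= in_itv.
have [[p0 p0'] Kp0 pmin] := compact_EVT_min K0 cK (continuous_subspaceT cdist).
rewrite inE in Kp0; have [[[/= i1 i2] [/= i3 i4]] /= P0] := Kp0.
rewrite !in_itv/= in i1 i2 i3 i4.
exists (dist (p0, p0')).
  rewrite lt_max !normr_gt0 !subr_eq0 -negb_and; apply/negP => /andP[/eqP e1 /eqP e2].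
  have e : p0 = p0' by move: e1 e2; clear; case: p0 => ? ?; case: p0' => ? ? /= -> ->.
  by have := Phi0 p0 i1 i2; rewrite {2}e; qlra.
move=> p p' h1 h2 h3 h4 d1 d2; rewrite ltNge; apply/negP => h.
have : dist (p0, p0') <= dist (p, p').
  by apply: pmin; rewrite inE; split => //; split; split; rewrite /= in_itv.
by rewrite leNgt {1}/dist/= gt_max d1 d2.
Qed.

(** Composition with this retraction extends functions from [[a, b]] to the line and makes
    continuity on the interval plain continuity. *)
Definition clamp (a b x : R) := Num.max a (Num.min b x).

Lemma clamp_itv a b x : a <= b -> a <= clamp a b x <= b.
Proof.
by move=> ab; rewrite /clamp le_max lexx/= ge_max ab ge_min lexx.
Qed.

Lemma clampK a b x : a <= x <= b -> clamp a b x = x.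
Proof. by move=> /andP[ax xb]; rewrite /clamp (min_idPr xb) (max_idPr ax). Qed.

Lemma clamp_cont a b : continuous (clamp a b).
Proof.
move=> x; apply: (@continuous_max _ _ (fun _ => a) (fun x => Num.min b x)); first exact: cst_continuous.
by apply: (@continuous_min _ _ (fun _ => b) (fun x => x)); [exact: cst_continuous|exact: cvg_id].
Qed.

End Lift.

Section LiftSquare.
Context {R : realType}.

Lemma unif_cont (a b : R) (f : R * R -> R) (e : R) : continuous f -> 0 < e ->
  exists2 d, 0 < d & forall p p', a <= p.1 <= b -> a <= p.2 <= b ->
    a <= p'.1 <= b -> a <= p'.2 <= b -> `|p.1 - p'.1| < d -> `|p.2 - p'.2| < d ->
    f p - e < f p' < f p + e.
Proof.
move=> cf e0.
have [||d d0 H] := @unif_pos R a b (fun x => e - `|f x.1 - f x.2|).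
- move=> x; apply: cvgB; first exact: cvg_cst.
  apply: (@continuous_comp _ _ _ (fun x : (R * R) * (R * R) => f x.1 - f x.2) (fun y => `|y|));
    last exact: norm_continuous.
  by apply: cvgB; [exact/cont_fst/cf|exact/cont_snd/cf].
- by move=> p _ _; rewrite subrr normr0 subr0.
exists d => // p p' h1 h2 h3 h4 h5 h6; have := H p p' h1 h2 h3 h4 h5 h6.
by rewrite subr_gt0 ltr_norml => /andP[? ?]; apply/andP; split; qlra.
Qed.

(** The angle is lifted along the segments from the corner [(a, a)]. One subdivision into [N] steps
    serves all endpoints, so the lift is a finite sum of small turns, each continuous in the
    endpoint. *)
Lemma lift_square (a b : R) (q1 q2 : R * R -> R) : a <= b ->
  (forall p, a <= p.1 <= b -> a <= p.2 <= b -> {for p, continuous q1}) ->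
  (forall p, a <= p.1 <= b -> a <= p.2 <= b -> {for p, continuous q2}) ->
  (forall p, a <= p.1 <= b -> a <= p.2 <= b -> 0 < q1 p ^+ 2 + q2 p ^+ 2) ->
  exists Th : R * R -> R, continuous Th /\
    forall p, a <= p.1 <= b -> a <= p.2 <= b ->
      q1 p = Num.sqrt (q1 p ^+ 2 + q2 p ^+ 2) * cos (Th p) /\
      q2 p = Num.sqrt (q1 p ^+ 2 + q2 p ^+ 2) * sin (Th p).
Proof.
move=> ab c1 c2 q0.
pose cl (p : R * R) := (clamp a b p.1, clamp a b p.2).
have ccl : continuous cl.
  move=> p; apply: (@cont_pair _ _ _ (fun p : R * R => clamp a b p.1) (fun p : R * R => clamp a b p.2)).
    by apply: (@continuous_comp _ _ _ fst (clamp a b)); [exact: cvg_fst|exact: clamp_cont].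
  by apply: (@continuous_comp _ _ _ snd (clamp a b)); [exact: cvg_snd|exact: clamp_cont].
pose Q1 p := q1 (cl p); pose Q2 p := q2 (cl p).
have C1 : continuous Q1.
  by move=> p; apply: continuous_comp; [exact: ccl|apply: c1; exact: clamp_itv].
have C2 : continuous Q2.
  by move=> p; apply: continuous_comp; [exact: ccl|apply: c2; exact: clamp_itv].
have Q0 p : 0 < Q1 p ^+ 2 + Q2 p ^+ 2 by apply: q0; exact: clamp_itv.
have [||d d0 H] := @unif_pos R a b (fun x => Q1 x.1 * Q1 x.2 + Q2 x.1 * Q2 x.2).
- move=> x; apply: cvgD; apply: cvgM.
  + exact/cont_fst/C1.
  + exact/cont_snd/C1.
  + exact/cont_fst/C2.
  + exact/cont_snd/C2.
- by move=> p _ _ /=; rewrite -!expr2; exact: Q0.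
(* Each step moves both coordinates by at most [(b - a) / N < d], which keeps the dot product of
   consecutive values positive. *)
pose N := (Num.Def.trunc ((b - a) / d)).+1.
have hN : (b - a) / d < N%:R by exact: truncnS_gt.
have N0 : 0 < N%:R :> R by rewrite ltr0n.
pose pt (k : nat) (p : R * R) : R * R :=
  (a + k%:R / N%:R * (clamp a b p.1 - a), a + k%:R / N%:R * (clamp a b p.2 - a)).
have cpt k : continuous (pt k).
  move=> p; apply: (@cont_pair _ _ _ (fun p : R * R => a + k%:R / N%:R * (clamp a b p.1 - a))
    (fun p : R * R => a + k%:R / N%:R * (clamp a b p.2 - a))); apply: cvgD; try exact: cvg_cst;
      apply: cvgM; try exact: cvg_cst;
  apply: cvgB; try exact: cvg_cst.
    by apply: (@continuous_comp _ _ _ fst (clamp a b)); [exact: cvg_fst|exact: clamp_cont].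
  by apply: (@continuous_comp _ _ _ snd (clamp a b)); [exact: cvg_snd|exact: clamp_cont].
have coef k x : (k <= N)%N -> a <= a + k%:R / N%:R * (clamp a b x - a) <= b.
  move=> kN; have := clamp_itv x ab => /andP[h1 h2].
  have k0 : 0 <= k%:R / N%:R :> R by rewrite divr_ge0.
  have k1 : k%:R / N%:R <= 1 :> R by rewrite ler_pdivrMr// mul1r ler_nat.
  apply/andP; split; first by rewrite lerDl mulr_ge0//; qlra.
  have : k%:R / N%:R * (clamp a b x - a) <= 1 * (clamp a b x - a).
    by apply: ler_wpM2r => //; qlra.
  qlra.
have step k x : `|a + k%:R / N%:R * (clamp a b x - a) - (a + k.+1%:R / N%:R * (clamp a b x - a))| < d.
  have -> : a + k%:R / N%:R * (clamp a b x - a) - (a + k.+1%:R / N%:R * (clamp a b x - a)) =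
     - ((clamp a b x - a) / N%:R) by rewrite -natr1; field; rewrite gt_eqF.
  have /andP[h1 h2] := clamp_itv x ab.
  rewrite normrN ger0_norm; last by rewrite divr_ge0 ?(ltW N0)//; qlra.
  rewrite ltr_pdivrMr//; rewrite ltr_pdivrMr// in hN; rewrite mulrC; qlra.
have [th0 [th01 th02]] := polar_exists (Q0 (a, a)).
pose A k p := ang (Q1 (pt k p)) (Q2 (pt k p)) (Q1 (pt k.+1 p)) (Q2 (pt k.+1 p)).
pose Th := fix F k p := if k is k'.+1 then F k' p + A k' p else th0.
have pos k p : (k < N)%N -> 0 < Q1 (pt k p) * Q1 (pt k.+1 p) + Q2 (pt k p) * Q2 (pt k.+1 p).
  by move=> kN; apply: (H (pt k p) (pt k.+1 p)); [apply: coef; exact: ltnW|apply: coef;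
    exact: ltnW|exact: coef|exact: coef|exact: step|exact: step].
have cQ k : (continuous (fun p => Q1 (pt k p)) * continuous (fun p => Q2 (pt k p)))%type.
  by split => p; (apply: continuous_comp; [exact: cpt|]); [exact: C1|exact: C2].
have cTh k : (k <= N)%N -> continuous (Th k).
  elim: k => [_ p|k IHk kN p]; first exact: cvg_cst.
  apply: cvgD; first by apply: IHk; exact: ltnW.
  apply: (@continuous_comp _ _ _ (fun p =>
    (Q1 (pt k p) * Q2 (pt k.+1 p) - Q2 (pt k p) * Q1 (pt k.+1 p)) /
    (Q1 (pt k p) * Q1 (pt k.+1 p) + Q2 (pt k p) * Q2 (pt k.+1 p))) atan); last exact: continuous_atan.
  apply: cvgM.
    by apply: cvgB; apply: cvgM; first [exact: (cQ _).1|exact: (cQ _).2].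
  apply: cvgV; first by rewrite gt_eqF// pos.
  by apply: cvgD; apply: cvgM; first [exact: (cQ _).1|exact: (cQ _).2].
have pTh k p : (k <= N)%N ->
   Q1 (pt k p) = Num.sqrt (Q1 (pt k p) ^+ 2 + Q2 (pt k p) ^+ 2) * cos (Th k p) /\
   Q2 (pt k p) = Num.sqrt (Q1 (pt k p) ^+ 2 + Q2 (pt k p) ^+ 2) * sin (Th k p).
  elim: k => [_|k IHk kN].
    have -> : pt 0%N p = (a, a) by rewrite /pt !mul0r !addr0.
    by split.
  have [e1 e2] := IHk (ltnW kN).
  by apply: (angP _ e1 e2 (pos _ _ kN)); rewrite sqrtr_gt0.
exists (Th N); split; first exact: cTh.
move=> p h1 h2; have := pTh N p (leqnn N).
have e : pt N p = p.
  by rewrite /pt divff ?gt_eqF// !mul1r !clampK// [p in RHS]surjective_pairing; congr pair; qlra.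
rewrite e /Q1 /Q2; have -> // : cl p = p.
by rewrite /cl !clampK// -surjective_pairing.
Qed.

End LiftSquare.

(** * First touching points *)

Section Touching.
Context {R : realType}.

(** Continuity is assumed at the points of [K] only, so the sublevel set is not known to be closed
    in [T]; the argument works with a cluster point in [K]. *)
Lemma compact_sublevel (T : topologicalType) (K : set T) (f : T -> R) :
  compact K -> (forall p, K p -> {for p, continuous f}) ->
  compact (K `&` [set p | f p <= 0]).
Proof.
move=> cK cf F PF FK.
have [|p [Kp clp]] := cK F PF; first by apply: filterS FK => ? [].
exists p; split => //; split => //=; rewrite leNgt; apply/negP => fp.
have : nbhs p [set x | 0 < f x].
  have op : nbhs (f p) [set y | 0 < y] by apply: open_nbhs_nbhs; split; [exact: open_gt|].
  exact: (cf p Kp _ op).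
move=> /(clp _ _ FK)[x [[_ /= h1] /= h2]]; qlra.
Qed.

(** [Dom] is typically noncompact, but [K] catches every point with [J <= 0]. The touching time is
    the minimum of the time over the compact set of these points. *)
Lemma first_touching (S : topologicalType) (Dom : set S) (K : set (S * R)) (t0 : R)
    (J : S * R -> R) :
  compact K -> (forall p, K p -> Dom p.1 /\ 0 <= p.2 <= t0) ->
  (forall p, K p -> {for p, continuous J}) ->
  (forall x t, Dom x -> 0 <= t <= t0 -> J (x, t) <= 0 -> K (x, t)) ->
  (forall x, Dom x -> 0 < J (x, 0)) ->
  (forall x t, Dom x -> 0 <= t <= t0 -> 0 < J (x, t)) \/
  exists x1 t1, [/\ Dom x1, 0 < t1 <= t0, J (x1, t1) = 0,
    (forall t, 0 <= t < t1 -> 0 < J (x1, t)) & (forall x, Dom x -> 0 <= J (x, t1))].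
Proof.
move=> cK KD cJ JK J0.
pose K' := K `&` [set p | J p <= 0].
have cK' : compact K' by exact: compact_sublevel.
have [K'0|K'0] := pselect (K' !=set0); last first.
  left => x t Dx ht; rewrite ltNge; apply/negP => h; apply: K'0.
  by exists (x, t); split => //; exact: JK.
right; have csnd : continuous (@snd S R) by move=> ?; exact: cvg_snd.
have [[x1 t1] + tmin] := compact_EVT_min K'0 cK' (continuous_subspaceT csnd).
rewrite inE => -[K1 /= J1]; have [/= D1 ht1] := KD _ K1.
have early x t : Dom x -> 0 <= t < t1 -> 0 < J (x, t).
  move=> Dx ht; rewrite ltNge; apply/negP => h.
  have : (x, t) \in K' by rewrite inE; split => //; apply: JK => //; qlra.
  by move=> /tmin /=; qlra.
have t10 : 0 < t1.
  rewrite lt_neqAle; apply/andP; split; last qlra.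
  by apply/eqP => e; have := J0 x1 D1; rewrite e; qlra.
(* A negative value at time [t1] would persist at slightly earlier times, where [J] is still
   positive. *)
have Jge x : Dom x -> 0 <= J (x, t1).
  move=> Dx; rewrite leNgt; apply/negP => h.
  have Kx : K (x, t1) by apply: JK => //; qlra.
  have : nbhs (x, t1) [set p | J p < 0].
    have op : nbhs (J (x, t1)) [set y | y < 0] by apply: open_nbhs_nbhs; split; [exact: open_lt|].
    exact: (cJ _ Kx _ op).
  move=> [[A B] /= [nA nB] AB].
  have [e /= e0 He] : exists2 e : R, 0 < e & forall t, t1 - e < t < t1 + e -> B t.
    case/nbhs_ballP : nB => e /= e0 He; exists e => // t ht.
    by apply: He; rewrite /ball/= ltr_norml; qlra.
  pose t := Num.max (t1 / 2) (t1 - e / 2).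
  have h1 : t1 / 2 <= t by rewrite le_max lexx.
  have h2 : t1 - e / 2 <= t by rewrite le_max lexx orbT.
  have h3 : t < t1 by rewrite gt_max; qlra.
  have : J (x, t) < 0 by apply: (AB (x, t)); split => /=; [exact: nbhs_singleton|apply: He; qlra].
  by have := early x t Dx ltac:(qlra); qlra.
exists x1, t1; split => //; first qlra.
- by apply/eqP; rewrite eq_le J1 Jge.
- by move=> t ht; exact: early.
Qed.

Lemma second_derivative_min (f f' : R -> R) (l u e : R) : 0 < e ->
  (forall v, u - e < v < u + e -> isD f v (f' v)) -> isD f' u l ->
  (forall v, u - e < v < u + e -> f u <= f v) -> f' u = 0 /\ 0 <= l.
Proof.
move=> e0 df df' fmin.
have fu0 : f' u = 0.
  have du : isD f u (f' u) by apply: df; qlra.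
  apply/eqP; rewrite eq_le; apply/andP; split.
    by apply: (isD_min_left (a := u - e / 2) du) => [|y hy]; [qlra|apply: fmin; qlra].
  by apply: (isD_min_right (b := u + e / 2) du) => [|y hy]; [qlra|apply: fmin; qlra].
split => //; rewrite leNgt; apply/negP => l0.
have l0' : 0 < - l by qlra.
have [d d0 Hd] := isD_pos_right (isD_opp df') l0'.
pose w := u + Num.min (d / 2) (e / 2).
have w0 : u < w by rewrite /w ltrDl lt_min; qlra.
have w1 : w <= u + d / 2 by rewrite /w lerD2l ge_min lexx.
have w2 : w <= u + e / 2 by rewrite /w lerD2l ge_min lexx orbT.
have : - f u < - f w.
  apply: (isD_incr (f := fun v => - f v) (f' := fun v => - f' v) w0) => v hv.
    by apply: isD_opp; apply: df; qlra.
  by have := Hd v ltac:(qlra); rewrite fu0; qlra.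
by have := fmin w ltac:(qlra); qlra.
Qed.

End Touching.

(** * Jets of a flow and the evolution of angle and area *)

Section Flow.
Context {R : realType}.

Definition cont2 (f : R -> R -> R) u t := {for (u, t), continuous (fun p : R * R => f p.1 p.2)}.

(* [j1], [j2], [j3] are the [u]-derivatives of [j0], [jt] its time derivative, and [j1t], [j2t] the
   mixed ones.  At [t = 0] no time derivative is required. *)
Record jet (I : set R) (T1 : R) := Jet {
  j0 : R -> R -> R; j1 : R -> R -> R; j2 : R -> R -> R; j3 : R -> R -> R;
  jt : R -> R -> R; j1t : R -> R -> R; j2t : R -> R -> R;
  j0_du : forall u t, I u -> 0 <= t < T1 -> isD (j0 ^~ t) u (j1 u t);
  j1_du : forall u t, I u -> 0 <= t < T1 -> isD (j1 ^~ t) u (j2 u t);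
  j2_du : forall u t, I u -> 0 < t < T1 -> isD (j2 ^~ t) u (j3 u t);
  j0_dt : forall u t, I u -> 0 < t < T1 -> isD (j0 u) t (jt u t);
  j1_dt : forall u t, I u -> 0 < t < T1 -> isD (j1 u) t (j1t u t);
  jt_du : forall u t, I u -> 0 < t < T1 -> isD (jt ^~ t) u (j1t u t);
  j2_dt : forall u t, I u -> 0 < t < T1 -> isD (j2 u) t (j2t u t);
  j1t_du : forall u t, I u -> 0 < t < T1 -> isD (j1t ^~ t) u (j2t u t);
  j0_c : forall u t, I u -> t < T1 -> cont2 j0 u t;
  j1_c : forall u t, I u -> t < T1 -> cont2 j1 u t;
  j2_c : forall u t, I u -> t < T1 -> cont2 j2 u t;
  jt_c : forall u t, I u -> 0 < t < T1 -> cont2 jt u t;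
  j1t_c : forall u t, I u -> 0 < t < T1 -> cont2 j1t u t;
  j2t_c : forall u t, I u -> 0 < t < T1 -> cont2 j2t u t
}.

(* [f_eq] is curve shortening multiplied by the speed, free of the choice of a normal. *)
Record flow (I : set R) (T1 : R) := Flow {
  fX : jet I T1; fY : jet I T1;
  f_open : forall u, I u -> exists2 e, 0 < e & forall v, u - e < v < u + e -> I v;
  f_itv : forall u v w, I u -> I v -> u <= w <= v -> I w;
  f_reg : forall u t, I u -> t < T1 -> 0 < j1 fX u t ^+ 2 + j1 fY u t ^+ 2;
  f_eq : forall u t, I u -> 0 < t < T1 ->
    j1 fX u t * jt fY u t - j1 fY u t * jt fX u t =
    (j1 fX u t * j2 fY u t - j1 fY u t * j2 fX u t) / (j1 fX u t ^+ 2 + j1 fY u t ^+ 2);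
  f_inj : forall u v t, I u -> I v -> 0 <= t < T1 ->
    j0 fX u t = j0 fX v t -> j0 fY u t = j0 fY v t -> u = v;
  f_proper : forall B t0, t0 < T1 -> exists c d, [/\ I c, I d, c <= d &
    forall u t, I u -> 0 <= t <= t0 -> j0 fX u t ^+ 2 + j0 fY u t ^+ 2 <= B -> c <= u <= d]
}.

Definition jet_rev (I : set R) T1 (F : jet I T1) : jet [set u | I (- u)] T1.
Proof.
apply: (@Jet _ T1 (fun u t => j0 F (- u) t) (fun u t => - j1 F (- u) t)
  (fun u t => j2 F (- u) t) (fun u t => - j3 F (- u) t) (fun u t => jt F (- u) t)
  (fun u t => - j1t F (- u) t) (fun u t => j2t F (- u) t)) => u t /= Iu ht.
- exact: (isD_rev (j0_du F Iu ht)).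
- by apply: (isD_eq (isD_opp (isD_rev (j1_du F Iu ht)))); rewrite opprK.
- exact: (isD_rev (j2_du F Iu ht)).
- exact: j0_dt.
- exact/isD_opp/j1_dt.
- exact: (isD_rev (jt_du F Iu ht)).
- exact: j2_dt.
- by apply: (isD_eq (isD_opp (isD_rev (j1t_du F Iu ht)))); rewrite opprK.
all: have crev f : cont2 f (- u) t -> cont2 (fun u t => f (- u) t) u t by
  move=> cf; apply: (@continuous_comp _ _ _ (fun p : R * R => (- p.1, p.2)) (fun p => f p.1 p.2)) => //;
  apply: (@cont_pair _ _ _ (fun p : R * R => - p.1) snd); [apply: (@cont_fst _ _ _ -%R);
    exact: opp_continuous|exact: cvg_snd].
- exact/crev/j0_c.
- by apply: cvgN; exact/crev/j1_c.
- exact/crev/j2_c.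
- exact/crev/jt_c.
- by apply: cvgN; exact/crev/j1t_c.
- exact/crev/j2t_c.
Defined.

(** Reversal of the parameter, by which statements on a right end apply to a left end. Both sides of
    [f_eq] change sign. *)
Definition flow_rev (I : set R) T1 (F : flow I T1) : flow [set u | I (- u)] T1.
Proof.
apply: (@Flow _ T1 (jet_rev (fX F)) (jet_rev (fY F))) => /=.
- move=> u /(f_open F)[e e0 H]; exists e => // v hv; apply: H; qlra.
- move=> u v w Iu Iv hw; apply: (f_itv F Iv Iu); qlra.
- by move=> u t Iu ht; rewrite !sqrrN; exact: f_reg.
- by move=> u t Iu ht; rewrite !sqrrN !mulNr -!opprD mulNr f_eq.
- by move=> u v t Iu Iv ht e1 e2; apply: oppr_inj; exact: (f_inj Iu Iv ht e1 e2).
- move=> B t0 ht; have [c [d [Ic Id cd H]]] := f_proper F B ht.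
  exists (- d), (- c); rewrite !opprK; split => //; first qlra.
  by move=> u t Iu h1 h2; have := H _ _ Iu h1 h2; qlra.
Defined.

End Flow.

Ltac opaque_fact T ::= lazymatch T with
  | context [is_derive] => fail
  | forall _, _ => idtac
  | _ => match T with
    | context [?f ?x] => is_var f
    | context [@Num.norm _ _ _] => idtac
    | context [@GRing.exp _ _ _] => idtac
    | context [@cos _ _] => idtac
    | context [@sin _ _] => idtac
    | context [@j0 _ _ _] => idtac
    | context [@j1 _ _ _] => idtac
    end
  end.

Section FlowCalc.
Context {R : realType} {I : set R} {T1 : R} (F : flow I T1).
Local Notation X := (j0 (fX F)). Local Notation Y := (j0 (fY F)).
Local Notation a := (j1 (fX F)). Local Notation b := (j1 (fY F)).
Local Notation a1 := (j2 (fX F)). Local Notation b1 := (j2 (fY F)).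
Local Notation a2 := (j3 (fX F)). Local Notation b2 := (j3 (fY F)).
Local Notation Xt := (jt (fX F)). Local Notation Yt := (jt (fY F)).
Local Notation at' := (j1t (fX F)). Local Notation bt := (j1t (fY F)).
Local Notation a1t := (j2t (fX F)). Local Notation b1t := (j2t (fY F)).

Definition speed2 u t := a u t ^+ 2 + b u t ^+ 2.
(** The [u]-derivative of the tangent angle; below, its own derivatives and the time derivative of
    the angle. All are written in coordinates, as no angle is chosen along the flow. *)
Definition ang_u u t := (a u t * b1 u t - b u t * a1 u t) / speed2 u t.
Definition ang_uu u t := (a u t * b2 u t - b u t * a2 u t) / speed2 u t -
  ang_u u t * (2 * (a u t * a1 u t + b u t * b1 u t)) / speed2 u t.
Definition ang_t u t := (a u t * bt u t - b u t * at' u t) / speed2 u t.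
Definition ang_ut u t := (at' u t * b1 u t + a u t * b1t u t - bt u t * a1 u t - b u t * a1t u t) /
  speed2 u t -
  ang_u u t * (2 * (a u t * at' u t + b u t * bt u t)) / speed2 u t.
(** The density [alpha] of the conservation law. *)
Definition area_u u t := 2^-1 * (a u t * Y u t - b u t * X u t) - t * ang_u u t.
Definition area_uu u t := 2^-1 * (a1 u t * Y u t - b1 u t * X u t) - t * ang_uu u t.
Definition area_ut u t := 2^-1 * (at' u t * Y u t + a u t * Yt u t - bt u t * X u t - b u t * Xt u t)
  - ang_u u t - t * ang_ut u t.
(** The flux [G], in a form without [tau]: formally the time derivative of a primitive of [area_u],
    up to a function of time. *)
Definition area_t u t := 2^-1 * (Xt u t * Y u t - Yt u t * X u t) - t * ang_t u t.

Lemma speed2_gt0 u t : I u -> t < T1 -> 0 < speed2 u t.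
Proof. exact: f_reg. Qed.

Lemma isD_speed2_u u t : I u -> 0 <= t < T1 ->
  isD (speed2 ^~ t) u (2 * (a u t * a1 u t + b u t * b1 u t)).
Proof.
move=> Iu ht; have da := j1_du (fX F) Iu ht; have db := j1_du (fY F) Iu ht.
by apply: (isD_eq (isD_add (isD_mul da da) (isD_mul db db))); ring.
Qed.

Lemma isD_speed2_t u t : I u -> 0 < t < T1 ->
  isD (speed2 u) t (2 * (a u t * at' u t + b u t * bt u t)).
Proof.
move=> Iu ht; have da := j1_dt (fX F) Iu ht; have db := j1_dt (fY F) Iu ht.
by apply: (isD_eq (isD_add (isD_mul da da) (isD_mul db db))); ring.
Qed.

Lemma isD_div (f g : R -> R) (x l m : R) : isD f x l -> isD g x m -> g x != 0 ->
  isD (fun y => f y / g y) x (l / g x - f x / g x * m / g x).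
Proof.
move=> df dg g0; apply: (isD_eq (isD_mul df (isD_inv dg g0))).
by field.
Qed.

Lemma isD_ang_u_u u t : I u -> 0 < t < T1 -> isD (ang_u ^~ t) u (ang_uu u t).
Proof.
move=> Iu ht; have ht' : 0 <= t < T1 by qlra.
have q0 : speed2 u t != 0 by rewrite gt_eqF// speed2_gt0//; qlra.
have H := isD_div (isD_sub (isD_mul (j1_du (fX F) Iu ht') (j2_du (fY F) Iu ht))
  (isD_mul (j1_du (fY F) Iu ht') (j2_du (fX F) Iu ht))) (isD_speed2_u Iu ht') q0.
by apply: (isD_eq H); rewrite /ang_uu /ang_u; field.
Qed.

Lemma isD_ang_u_t u t : I u -> 0 < t < T1 -> isD (ang_u u) t (ang_ut u t).
Proof.
move=> Iu ht.
have q0 : speed2 u t != 0 by rewrite gt_eqF// speed2_gt0//; qlra.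
have H := isD_div (isD_sub (isD_mul (j1_dt (fX F) Iu ht) (j2_dt (fY F) Iu ht))
  (isD_mul (j1_dt (fY F) Iu ht) (j2_dt (fX F) Iu ht))) (isD_speed2_t Iu ht) q0.
by apply: (isD_eq H); rewrite /ang_ut /ang_u; field.
Qed.

Lemma csf_ang_u u t : I u -> 0 < t < T1 -> a u t * Yt u t - b u t * Xt u t = ang_u u t.
Proof. exact: f_eq. Qed.

(** By the flow equation the velocity and [gamma_uu / q] have equal normal components, so they
    differ by a multiple [tau] of [gamma_u]. The equation for the angle comes from differentiating
    [csf_ang_u] along the curve. *)
Lemma csf_heat u t : I u -> 0 < t < T1 -> exists tau,
  [/\ Xt u t = a1 u t / speed2 u t + tau * a u t, Yt u t = b1 u t / speed2 u t + tau * b u t &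
   ang_t u t = ang_uu u t / speed2 u t + tau * ang_u u t].
Proof.
move=> Iu ht; have ht' : 0 <= t < T1 by qlra.
have q0 : 0 < speed2 u t by rewrite speed2_gt0//; qlra.
have qE : speed2 u t = a u t ^+ 2 + b u t ^+ 2 by [].
have e0 := csf_ang_u Iu ht.
pose tau := ((Xt u t - a1 u t / speed2 u t) * a u t + (Yt u t - b1 u t / speed2 u t) * b u t) / speed2 u t.
have qn : speed2 u t != 0 by rewrite gt_eqF.
have hX : Xt u t = a1 u t / speed2 u t + tau * a u t.
  have : speed2 u t * (Xt u t - a1 u t / speed2 u t - tau * a u t) =
     - b u t * (a u t * Yt u t - b u t * Xt u t - ang_u u t).
    by rewrite /tau /ang_u; move: qn; rewrite qE => qn; field.
  by rewrite e0 subrr mulr0 => /eqP; rewrite mulf_eq0 (negbTE qn)/= => /eqP; qlra.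
have hY : Yt u t = b1 u t / speed2 u t + tau * b u t.
  have : speed2 u t * (Yt u t - b1 u t / speed2 u t - tau * b u t) =
     a u t * (a u t * Yt u t - b u t * Xt u t - ang_u u t).
    by rewrite /tau /ang_u; move: qn; rewrite qE => qn; field.
  by rewrite e0 subrr mulr0 => /eqP; rewrite mulf_eq0 (negbTE qn)/= => /eqP; qlra.
exists tau; split => //.
have H1 := isD_sub (isD_mul (j1_du (fX F) Iu ht') (jt_du (fY F) Iu ht))
  (isD_mul (j1_du (fY F) Iu ht') (jt_du (fX F) Iu ht)).
have H2 : isD (ang_u ^~ t) u (a1 u t * Yt u t + a u t * bt u t - (b1 u t * Xt u t + b u t * at' u t)).
  apply: (isD_near _ H1); have [e e0' He] := f_open F Iu.
  apply/nbhs_ballP; exists e => //= v; rewrite /ball/= ltr_norml => hv.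
  by apply: csf_ang_u => //; apply: He; qlra.
have H3 := isD_ang_u_u Iu ht.
have : ang_uu u t = a1 u t * Yt u t + a u t * bt u t - (b1 u t * Xt u t + b u t * at' u t).
  by case: H2 => _ <-; case: H3 => _ <-.
move=> e3; have e4 : a u t * bt u t - b u t * at' u t = ang_uu u t - (a1 u t * Yt u t - b1 u t * Xt u
  t) by rewrite e3; ring.
rewrite /ang_t e4 hX hY /ang_u; field.
by [].
Qed.

Lemma isD_area_u_u u t : I u -> 0 < t < T1 -> isD (area_u ^~ t) u (area_uu u t).
Proof.
move=> Iu ht; have ht' : 0 <= t < T1 by qlra.
have H := isD_sub (isD_mul (isD_cst 2^-1 u) (isD_sub (isD_mul (j1_du (fX F) Iu ht') (j0_du (fY F) Iu ht'))
  (isD_mul (j1_du (fY F) Iu ht') (j0_du (fX F) Iu ht')))) (isD_mul (isD_cst t u) (isD_ang_u_u Iu ht)).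
by apply: (isD_eq H); rewrite /area_uu; ring.
Qed.

Lemma isD_area_u_t u t : I u -> 0 < t < T1 -> isD (area_u u) t (area_ut u t).
Proof.
move=> Iu ht.
have H := isD_sub (isD_mul (isD_cst 2^-1 t) (isD_sub (isD_mul (j1_dt (fX F) Iu ht) (j0_dt (fY F) Iu ht))
  (isD_mul (j1_dt (fY F) Iu ht) (j0_dt (fX F) Iu ht)))) (isD_mul (isD_id t) (isD_ang_u_t Iu ht)).
by apply: (isD_eq H); rewrite /area_ut; ring.
Qed.

(** The conservation law. Compared with the time derivative of the density, only the term [ang_u],
    which comes from the factor [t], has to be accounted for, and the flow equation supplies it. *)
Lemma isD_area_t_u u t : I u -> 0 < t < T1 -> isD (area_t ^~ t) u (area_ut u t).
Proof.
move=> Iu ht; have ht' : 0 <= t < T1 by qlra.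
have q0 : speed2 u t != 0 by rewrite gt_eqF// speed2_gt0//; qlra.
have Ht := isD_div (isD_sub (isD_mul (j1_du (fX F) Iu ht') (j1t_du (fY F) Iu ht))
  (isD_mul (j1_du (fY F) Iu ht') (j1t_du (fX F) Iu ht))) (isD_speed2_u Iu ht') q0.
have H := isD_sub (isD_mul (isD_cst 2^-1 u) (isD_sub (isD_mul (jt_du (fX F) Iu ht) (j0_du (fY F) Iu ht'))
  (isD_mul (jt_du (fY F) Iu ht) (j0_du (fX F) Iu ht')))) (isD_mul (isD_cst t u) Ht).
apply: (isD_eq H); rewrite /area_ut -(csf_ang_u Iu ht) /ang_ut /ang_u; move: q0; rewrite /speed2 => q0; field.
by rewrite q0.
Qed.

Lemma area_t_heat u t tau : I u -> 0 < t < T1 ->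
  Xt u t = a1 u t / speed2 u t + tau * a u t -> Yt u t = b1 u t / speed2 u t + tau * b u t ->
  ang_t u t = ang_uu u t / speed2 u t + tau * ang_u u t ->
  area_t u t = area_uu u t / speed2 u t + tau * area_u u t.
Proof.
move=> Iu ht hX hY hth; have q0 : speed2 u t != 0 by rewrite gt_eqF// speed2_gt0//; qlra.
by rewrite /area_t hX hY hth /area_uu /area_u; field.
Qed.

End FlowCalc.

(** * The maximum principle on a half-line *)

Section MaxPrinciple.
Context {R : realType} {I : set R} {T1 : R} (F : flow I T1).
Local Notation X := (j0 (fX F)). Local Notation Y := (j0 (fY F)).
Local Notation a := (j1 (fX F)). Local Notation b := (j1 (fY F)).
Local Notation a1 := (j2 (fX F)). Local Notation b1 := (j2 (fY F)).
Local Notation Xt := (jt (fX F)). Local Notation Yt := (jt (fY F)).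
Local Notation at' := (j1t (fX F)). Local Notation bt := (j1t (fY F)).
Local Notation q := (speed2 F). Local Notation thu := (ang_u F).
Local Notation thuu := (ang_uu F). Local Notation tht := (ang_t F).

(* The compactness of [{J <= 0}] replaces that of the half-line. *)
Lemma max_principle (ub t0 B : R) (J Ju Juu Jt : R -> R -> R) : I ub -> 0 <= t0 < T1 ->
  (forall u t, I u -> ub <= u -> 0 <= t <= t0 -> cont2 J u t) ->
  (forall u t, I u -> ub <= u -> 0 <= t <= t0 -> J u t <= 0 -> X u t ^+ 2 + Y u t ^+ 2 <= B) ->
  (forall u, I u -> ub <= u -> 0 < J u 0) ->
  (forall t, 0 <= t <= t0 -> 0 < J ub t) ->
  (forall u t, I u -> 0 < t <= t0 -> isD (J ^~ t) u (Ju u t)) ->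
  (forall u t, I u -> 0 < t <= t0 -> isD (Ju ^~ t) u (Juu u t)) ->
  (forall u t, I u -> 0 < t <= t0 -> isD (J u) t (Jt u t)) ->
  (forall u t tau, I u -> ub < u -> 0 < t <= t0 -> J u t = 0 ->
    Xt u t = a1 u t / q u t + tau * a u t -> Yt u t = b1 u t / q u t + tau * b u t ->
    tht u t = thuu u t / q u t + tau * thu u t ->
    Jt u t - Juu u t / q u t - tau * Ju u t <= 0 -> False) ->
  forall u t, I u -> ub <= u -> 0 <= t <= t0 -> 0 < J u t.
Proof.
move=> Iub t00 cJ JB J0 Jl dJu dJuu dJt notouch.
have t0T : t0 < T1 by qlra.
have [c [d [Ic Id cd Hcd]]] := f_proper F B t0T.
pose m := Num.max c ub.
have mc : c <= m by rewrite le_max lexx.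
have mub : ub <= m by rewrite le_max lexx orbT.
pose K : set (R * R) := `[m, d] `*` `[0, t0].
have [|||||H|[u1 [s1 [[Iu1 ubu1] hs1 J1 Jt1 Ju1]]]] :=
  @first_touching R R [set u | I u /\ ub <= u] K t0 (fun p => J p.1 p.2).
- by apply: compact_setX; exact: segment_compact.
- move=> p [/=]; rewrite !in_itv/= => h1 h2; split => //; split; last qlra.
  by apply: (f_itv F Ic Id); qlra.
- move=> [u t] [/=]; rewrite !in_itv/= => h1 h2; apply: cJ => //; last qlra.
  by apply: (f_itv F Ic Id); qlra.
- move=> u t [Iu ubu] ht Jut; split; rewrite /= in_itv/= //.
  have := Hcd u t Iu ht (JB u t Iu ubu ht Jut).
  by rewrite ge_max => ?; qlra.
- by move=> u [Iu ubu]; exact: J0.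
- by move=> u t Iu ubu ht; apply: H.
have ubu1' : ub < u1.
  rewrite lt_neqAle ubu1 andbT; apply/eqP => e; have := Jl s1; rewrite e; rewrite /= in J1; qlra.
have [tau [hX hY hth]] := csf_heat F Iu1 (t := s1) ltac:(qlra).
have q0 : 0 < q u1 s1 by apply: speed2_gt0 => //; qlra.
apply: (False_ind _ (notouch u1 s1 tau Iu1 ubu1' _ J1 hX hY hth _)) => //.
have [e1 e10 He1] := f_open F Iu1.
pose e := Num.min e1 (u1 - ub).
have e0 : 0 < e by rewrite lt_min; qlra.
have ee1 : e <= e1 by rewrite ge_min lexx.
have ee2 : e <= u1 - ub by rewrite ge_min lexx orbT.
have [|||Ju0 Juu0] := @second_derivative_min _ (J ^~ s1) (Ju ^~ s1) (Juu u1 s1) u1 e e0.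
- by move=> v hv; apply: dJu => //; apply: He1; qlra.
- by apply: dJuu.
- move=> v hv; rewrite /= in J1; rewrite J1; apply: (Ju1 v).
  by split; [apply: He1; qlra|qlra].
have Jt0 : Jt u1 s1 <= 0.
  apply: (isD_min_left (a := 0) (dJt u1 s1 Iu1 hs1)); first qlra.
  move=> y hy; rewrite /= in J1; rewrite J1.
  have [->|ys] := eqVneq y s1; first by rewrite J1.
  by apply/ltW/Jt1; move: ys; rewrite neq_lt; qlra.
rewrite Ju0 mulr0 subr0 subr_le0; apply: (le_trans Jt0).
by rewrite divr_ge0// ltW.
Qed.

Lemma cont2D (f g : R -> R -> R) u t : cont2 f u t -> cont2 g u t ->
  cont2 (fun u t => f u t + g u t) u t.
Proof. by move=> cf cg; apply: cvgD. Qed.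
Lemma cont2N (f : R -> R -> R) u t : cont2 f u t -> cont2 (fun u t => - f u t) u t.
Proof. by move=> cf; apply: cvgN. Qed.
Lemma cont2B (f g : R -> R -> R) u t : cont2 f u t -> cont2 g u t ->
  cont2 (fun u t => f u t - g u t) u t.
Proof. by move=> cf cg; apply: cvgB. Qed.
Lemma cont2M (f g : R -> R -> R) u t : cont2 f u t -> cont2 g u t ->
  cont2 (fun u t => f u t * g u t) u t.
Proof. by move=> cf cg; apply: cvgM. Qed.
Lemma cont2V (f : R -> R -> R) u t : cont2 f u t -> f u t != 0 ->
  cont2 (fun u t => (f u t)^-1) u t.
Proof. by move=> cf f0; apply: cvgV. Qed.
Lemma cont2C (k u t : R) : cont2 (fun _ _ => k) u t.
Proof. exact: cvg_cst. Qed.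
Lemma cont2t (u t : R) : cont2 (fun _ t => t) u t.
Proof. exact: cvg_snd. Qed.
Lemma cont2comp (f : R -> R -> R) (g : R -> R) u t : cont2 f u t -> {for f u t, continuous g} ->
  cont2 (fun u t => g (f u t)) u t.
Proof. by move=> cf cg; apply: (@continuous_comp _ _ _ (fun p : R * R => f p.1 p.2) g). Qed.

(** Linear functions of the position solve the heat equation of the flow, and [|gamma|^2] solves it
    with source [- 2]. So [1 + |gamma|^2 + 3 t] is a strict supersolution that dominates linear
    functions at infinity, and small multiples of it serve as barriers. *)
Lemma lin_max (ub t0 B e1 e2 : R) : I ub -> 0 <= t0 < T1 ->
  (forall u, I u -> ub <= u -> e1 * X u 0 + e2 * Y u 0 <= B) ->
  (forall t, 0 <= t <= t0 -> e1 * X ub t + e2 * Y ub t <= B) ->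
  forall u t, I u -> ub <= u -> 0 <= t <= t0 -> e1 * X u t + e2 * Y u t <= B.
Proof.
move=> Iub ht0 init lat u t Iu ubu ht.
apply/ler_addgt0Pr => e e0.
pose M := 1 + (X u t ^+ 2 + Y u t ^+ 2) + 3 * t.
have M0 : 0 < M by rewrite /M; have := sqr_ge0 (X u t); have := sqr_ge0 (Y u t); qlra.
pose ep := e / M.
have ep0 : 0 < ep by rewrite divr_gt0.
pose J u t := B + ep * (1 + (X u t * X u t + Y u t * Y u t) + 3 * t) - (e1 * X u t + e2 * Y u t).
pose Ju u t := ep * (2 * (X u t * a u t + Y u t * b u t)) - (e1 * a u t + e2 * b u t).
pose Juu u t := ep * (2 * (a u t * a u t + X u t * a1 u t + (b u t * b u t + Y u t * b1 u t))) - (e1 *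
  a1 u t + e2 * b1 u t).
pose Jt u t := ep * (2 * (X u t * Xt u t + Y u t * Yt u t) + 3) - (e1 * Xt u t + e2 * Yt u t).
have pos v s : 0 <= X v s * X v s + Y v s * Y v s by rewrite addr_ge0// -expr2 sqr_ge0.
suff : 0 < J u t.
  rewrite /J; have -> : ep * (1 + (X u t * X u t + Y u t * Y u t) + 3 * t) = e; last qlra.
  by rewrite /ep /M -!expr2; field; rewrite gt_eqF.
suff : forall u t, I u -> ub <= u -> 0 <= t <= t0 -> 0 < J u t by apply.
(* The bound on [|gamma|^2] where [J <= 0] results from the squares of [e1 - ep * X] and
   [e2 - ep * Y]. *)
refine (@max_principle ub t0 ((e1 ^+ 2 + e2 ^+ 2 - 2 * ep * B) / (ep ^+ 2)) J Ju Juu Jt Iub ht0 _ _ _ _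
  _ _ _ _).
- move=> v s Iv ubv hs; have sT : s < T1 by qlra.
  have cX := j0_c (j := fX F) Iv sT; have cY := j0_c (j := fY F) Iv sT.
  apply: cont2B; last by apply: cont2D; apply: cont2M => //; exact: cont2C.
  apply: cont2D; first exact: cont2C.
  apply: cont2M; first exact: cont2C.
  apply: cont2D; last by apply: cont2M; [exact: cont2C|exact: cont2t].
  apply: cont2D; first exact: cont2C.
  by apply: cont2D; apply: cont2M.
- move=> v s Iv ubv hs Jvs.
  rewrite ler_pdivlMr ?exprn_gt0//.
  have h1 := sqr_ge0 (e1 - ep * X v s); have h2 := sqr_ge0 (e2 - ep * Y v s).
  have h3 : 0 <= ep * s * ep by apply: mulr_ge0; [apply: mulr_ge0; [exact: ltW|qlra]|exact: ltW].
  have h4 : 0 <= ep * ep by apply: mulr_ge0; exact: ltW.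
  have : ep * J v s <= 0 by rewrite pmulr_rle0.
  rewrite /J; move: h1 h2; rewrite !sqrrB; qlra.
- move=> v Iv ubv; have := init v Iv ubv; have := pos v 0 => h1 h2; rewrite /J mulr0 addr0.
  have : 0 < ep * (1 + (X v 0 * X v 0 + Y v 0 * Y v 0)) by rewrite mulr_gt0//; qlra.
  qlra.
- move=> s hs; have := lat s hs; have := pos ub s => h1 h2; rewrite /J.
  have : 0 < ep * (1 + (X ub s * X ub s + Y ub s * Y ub s) + 3 * s) by rewrite mulr_gt0//; qlra.
  qlra.
- move=> v s Iv hs; have hs' : 0 <= s < T1 by qlra.
  have dX := j0_du (fX F) Iv hs'; have dY := j0_du (fY F) Iv hs'.
  have H := isD_sub (isD_add (isD_cst B v) (isD_mul (isD_cst ep v) (isD_add (isD_add (isD_cst 1 v)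
    (isD_add (isD_mul dX dX) (isD_mul dY dY))) (isD_cst (3 * s) v))))
    (isD_add (isD_mul (isD_cst e1 v) dX) (isD_mul (isD_cst e2 v) dY)).
  by apply: (isD_eq H); rewrite /Ju; ring.
- move=> v s Iv hs; have hs' : 0 <= s < T1 by qlra.
  have dX := j0_du (fX F) Iv hs'; have dY := j0_du (fY F) Iv hs'.
  have da := j1_du (fX F) Iv hs'; have db := j1_du (fY F) Iv hs'.
  have H := isD_sub (isD_mul (isD_cst ep v) (isD_mul (isD_cst 2 v) (isD_add (isD_mul dX da) (isD_mul dY db))))
    (isD_add (isD_mul (isD_cst e1 v) da) (isD_mul (isD_cst e2 v) db)).
  by apply: (isD_eq H); rewrite /Juu; ring.
- move=> v s Iv hs; have hs' : 0 < s < T1 by qlra.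
  have dX := j0_dt (fX F) Iv hs'; have dY := j0_dt (fY F) Iv hs'.
  have H := isD_sub (isD_add (isD_cst B s) (isD_mul (isD_cst ep s) (isD_add (isD_add (isD_cst 1 s)
    (isD_add (isD_mul dX dX) (isD_mul dY dY))) (isD_mul (isD_cst 3 s) (isD_id s)))))
    (isD_add (isD_mul (isD_cst e1 s) dX) (isD_mul (isD_cst e2 s) dY)).
  by apply: (isD_eq H); rewrite /Jt; ring.
- move=> v s tau Iv ubv hs _ hX hY _.
  have q0 : 0 < q v s by apply: speed2_gt0 => //; qlra.
  have -> : Jt v s - Juu v s / q v s - tau * Ju v s = ep; last qlra.
  rewrite /Jt /Juu /Ju hX hY; have : q v s != 0 by rewrite gt_eqF.
  by rewrite /speed2 => qn; field.
Qed.

End MaxPrinciple.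

(** * The tangent direction along a radial end *)

Section Tangent.
Context {R : realType}.

(** The unit tangent turns at the rate of its angle: the derivative of its component along
    [(e1, e2)] is that rate times its component along [(e2, - e1)]. *)
Lemma unit_deriv (e1 e2 : R) (a b : R -> R) (x a' b' : R) :
  isD a x a' -> isD b x b' -> 0 < a x ^+ 2 + b x ^+ 2 ->
  isD (fun y => (e1 * a y + e2 * b y) / Num.sqrt (a y ^+ 2 + b y ^+ 2)) x
    ((e2 * a x + - e1 * b x) / Num.sqrt (a x ^+ 2 + b x ^+ 2) *
     ((a x * b' - b x * a') / (a x ^+ 2 + b x ^+ 2))).
Proof.
move=> da db q0; set S := Num.sqrt (a x ^+ 2 + b x ^+ 2).
have S0 : S != 0 by rewrite gt_eqF// sqrtr_gt0.
have S2 : a x ^+ 2 + b x ^+ 2 = S ^+ 2 by rewrite sqr_sqrtr// ltW.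
have dq : isD (fun y => a y ^+ 2 + b y ^+ 2) x (2 * (a x * a' + b x * b')).
  apply: (isD_ext (f := fun y => a y * a y + b y * b y)); first by move=> y; rewrite -!expr2.
  by apply: (isD_eq (isD_add (isD_mul da da) (isD_mul db db))); ring.
have H := isD_div (isD_add (isD_mul (isD_cst e1 x) da) (isD_mul (isD_cst e2 x) db)) (isD_sqrt dq q0) S0.
apply: (isD_eq H); rewrite -/S S2.
transitivity (((e1 * a' + e2 * b') * S ^+ 2 - (e1 * a x + e2 * b x) * (a x * a' + b x * b')) / S ^+ 3).
  by field.
have -> : (e1 * a' + e2 * b') * S ^+ 2 - (e1 * a x + e2 * b x) * (a x * a' + b x * b') =
    (e2 * a x + - e1 * b x) * (a x * b' - b x * a') by rewrite -S2; ring.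
by field.
Qed.

Lemma box_bounded (c d t0 : R) (f : R -> R -> R) : c <= d -> 0 <= t0 ->
  (forall u t, c <= u <= d -> 0 <= t <= t0 -> cont2 f u t) ->
  exists C, forall u t, c <= u <= d -> 0 <= t <= t0 -> f u t <= C.
Proof.
move=> cd t00 cf; pose K : set (R * R) := `[c, d] `*` `[0, t0].
have cK : compact K by apply: compact_setX; exact: segment_compact.
have K0 : K !=set0 by exists (c, 0); split; rewrite /= in_itv/=; qlra.
have [|p _ pmax] := @compact_EVT_max _ R (fun p => f p.1 p.2) _ K0 cK.
  apply: continuous_in_subspaceT => -[u t]; rewrite inE => -[/=]; rewrite !in_itv/= => h1 h2.
  exact: cf.
exists (f p.1 p.2) => u t hu ht; apply: (pmax (u, t)).
by rewrite inE; split; rewrite /= in_itv.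
Qed.

End Tangent.

Section Ends.
Context {R : realType} {I : set R} {T1 : R} (F : flow I T1).
Local Notation X := (j0 (fX F)). Local Notation Y := (j0 (fY F)).
Local Notation a := (j1 (fX F)). Local Notation b := (j1 (fY F)).
Local Notation a1 := (j2 (fX F)). Local Notation b1 := (j2 (fY F)).
Local Notation Xt := (jt (fX F)). Local Notation Yt := (jt (fY F)).
Local Notation at' := (j1t (fX F)). Local Notation bt := (j1t (fY F)).
Local Notation q := (speed2 F). Local Notation thu := (ang_u F).
Local Notation thuu := (ang_uu F). Local Notation tht := (ang_t F).

(** For a unit vector [(e1, e2)], the cosine of the angle from it to the tangent. The arguments
    [e2], [- e1] give minus the sine, the derivative of the cosine. *)
Definition tdot e1 e2 u t := (e1 * a u t + e2 * b u t) / Num.sqrt (q u t).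

Lemma isD_tdot_u e1 e2 u t : I u -> 0 <= t < T1 ->
  isD (tdot e1 e2 ^~ t) u (tdot e2 (- e1) u t * thu u t).
Proof.
move=> Iu ht; apply: (unit_deriv _ _ (j1_du (fX F) Iu ht) (j1_du (fY F) Iu ht)).
by apply: f_reg => //; qlra.
Qed.

Lemma isD_tdot_t e1 e2 u t : I u -> 0 < t < T1 ->
  isD (tdot e1 e2 u) t (tdot e2 (- e1) u t * tht u t).
Proof.
move=> Iu ht; apply: (unit_deriv _ _ (j1_dt (fX F) Iu ht) (j1_dt (fY F) Iu ht)).
by apply: f_reg => //; qlra.
Qed.

Lemma tdotN e1 e2 u t : tdot (- e1) (- e2) u t = - tdot e1 e2 u t.
Proof. by rewrite /tdot -mulNr; congr (_ / _); ring. Qed.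

Lemma tdot_sqr e1 e2 u t : e1 ^+ 2 + e2 ^+ 2 = 1 -> I u -> t < T1 ->
  tdot e1 e2 u t ^+ 2 + tdot e2 (- e1) u t ^+ 2 = 1.
Proof.
move=> ee Iu ht; have q0 := speed2_gt0 F Iu ht.
have S0 : Num.sqrt (q u t) != 0 by rewrite gt_eqF// sqrtr_gt0.
have S2 : Num.sqrt (q u t) ^+ 2 = q u t by rewrite sqr_sqrtr// ltW.
have qn : q u t != 0 by rewrite gt_eqF.
rewrite /tdot !exprMn exprVn S2 -mulrDl.
have -> : (e1 * a u t + e2 * b u t) ^+ 2 + (e2 * a u t + - e1 * b u t) ^+ 2 =
  (e1 ^+ 2 + e2 ^+ 2) * q u t by rewrite /speed2; ring.
by rewrite ee mul1r divff.
Qed.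

Lemma tdot_bound e1 e2 u t : e1 ^+ 2 + e2 ^+ 2 = 1 -> I u -> t < T1 ->
  -1 <= tdot e1 e2 u t <= 1.
Proof.
move=> ee Iu ht; have := tdot_sqr ee Iu ht; have := sqr_ge0 (tdot e2 (- e1) u t).
by move=> h1 h2; apply/andP; split; nra.
Qed.

Lemma tdot_c e1 e2 u t : I u -> t < T1 -> cont2 (tdot e1 e2) u t.
Proof.
move=> Iu ht; have q0 := speed2_gt0 F Iu ht.
have ca := j1_c (j := fX F) Iu ht; have cb := j1_c (j := fY F) Iu ht.
apply: cont2M; first by apply: cont2D; apply: cont2M => //; exact: cont2C.
apply: cont2V; last by rewrite gt_eqF// sqrtr_gt0.
apply: cont2comp; last exact: sqrt_continuous.
by apply: cont2D; apply: cont2M.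
Qed.

Lemma tdot_speed e1 e2 u t : I u -> t < T1 ->
  e1 * a u t + e2 * b u t = Num.sqrt (q u t) * tdot e1 e2 u t.
Proof.
move=> Iu ht; have q0 := speed2_gt0 F Iu ht; rewrite /tdot; field.
by rewrite gt_eqF// sqrtr_gt0.
Qed.

End Ends.

(** The heat operator applied to the barrier of [graph_end] at one of its zeros, as an inequality
    between numbers. The squared curvature [k] is at most [C]. As [nu = j - Phi], the reaction term
    [nu k] is at least [- C Phi], which the growth of [M] compensates, and the decay of [j] at rate
    [L] outweighs the second derivative of the square root. *)
Lemma kink_ineq {R : realType} (q S nu mu thu thuu tht tau y yt yu yuu j dj Q M dM C L : R) :
  0 < q -> 0 < S -> S ^+ 2 = q -> tht = thuu / q + tau * thu -> yt = yuu / q + tau * yu ->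
  yu = S * nu -> 0 < j -> 0 < M -> j <= Q -> Q ^+ 2 = y ^+ 2 + j ^+ 2 ->
  nu - j + M * (Q - j) = 0 -> dj = - (L * j) -> dM = C * M -> thu ^+ 2 / q <= C ->
  2 * M * (1 + M ^+ 2) < L ->
  mu * tht - dj + (dM * (Q - j) + M * ((y * yt + j * dj) / Q - dj))
  - (- nu * thu * thu + mu * thuu + M * ((yu * yu + y * yuu) / Q - y * yu * (y * yu / Q) / Q ^+ 2)) / q
  - tau * (mu * thu + M * (y * yu / Q)) <= 0 -> False.
Proof.
move=> q0 S0 S2 -> -> -> j0 M0 jQ Q2 J0 -> -> kC ML; set W := (W in W <= 0) => W0.
have Q0 : 0 < Q by qlra.
have Qn : Q != 0 by rewrite gt_eqF. have Sn : S != 0 by rewrite gt_eqF.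
pose k := thu ^+ 2 / q.
have k0 : 0 <= k by rewrite divr_ge0 ?sqr_ge0// ltW.
pose Phi := M * (Q - j).
have Phi0 : 0 <= Phi by apply: mulr_ge0; [exact: ltW|qlra].
have nuE : nu = j - Phi by rewrite /Phi; qlra.
have WE : W = nu * k + L * j + C * Phi + M * L * j * (1 - j / Q) - M * nu ^+ 2 * (j / Q) ^+ 2 / Q.
  have e1 : (j / Q) ^+ 2 = 1 - y ^+ 2 / Q ^+ 2.
    have : j ^+ 2 = Q ^+ 2 - y ^+ 2 by qlra.
    by rewrite expr_div_n => ->; field.
  by rewrite e1 /W /k /Phi -S2; field; rewrite Sn Qn.
have jQ1 : j / Q <= 1 by rewrite ler_pdivrMr// mul1r.
have jQ0 : 0 <= j / Q by rewrite divr_ge0 ?ltW.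
have h1 : - (C * Phi) <= nu * k.
  have : - Phi * k <= nu * k by apply: ler_wpM2r => //; qlra.
  have : Phi * k <= Phi * C by apply: ler_wpM2l.
  qlra.
have h2 : 0 <= M * L * j * (1 - j / Q).
  have L0 : 0 <= L by apply: ltW; apply: le_lt_trans ML; rewrite !mulr_ge0 ?ltW// addr_gt0// exprn_gt0.
  by rewrite !mulr_ge0 ?(ltW M0) ?(ltW j0)// subr_ge0.
have h3 : nu ^+ 2 <= 2 * (j ^+ 2 + M ^+ 2 * Q ^+ 2).
  have hP : Phi <= M * Q by rewrite ler_wpM2l ?ltW//; qlra.
  have hP2 : Phi ^+ 2 <= (M * Q) ^+ 2 by rewrite ler_pXn2r ?nnegrE// mulr_ge0 ?ltW.
  rewrite nuE; clearbody Phi; have := sqr_ge0 (j + Phi); qlra.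
have h4 : M * nu ^+ 2 * (j / Q) ^+ 2 / Q <= 2 * M * (1 + M ^+ 2) * j.
  have e : 0 <= M * (j / Q) ^+ 2 / Q by rewrite divr_ge0 ?(ltW Q0)// mulr_ge0 ?sqr_ge0// ltW.
  have : M * (j / Q) ^+ 2 / Q * nu ^+ 2 <= M * (j / Q) ^+ 2 / Q * (2 * (j ^+ 2 + M ^+ 2 * Q ^+ 2)) by
    apply: ler_wpM2l.
  have -> : M * (j / Q) ^+ 2 / Q * (2 * (j ^+ 2 + M ^+ 2 * Q ^+ 2)) =
     2 * M * ((j / Q) ^+ 3 + M ^+ 2 * (j / Q)) * j by field.
  have -> : M * nu ^+ 2 * (j / Q) ^+ 2 / Q = M * (j / Q) ^+ 2 / Q * nu ^+ 2 by ring.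
  have h5 : (j / Q) ^+ 3 <= 1 by rewrite exprn_ile1.
  have h6 : M ^+ 2 * (j / Q) <= M ^+ 2 by rewrite ler_piMr ?sqr_ge0.
  have h7 : 2 * M * ((j / Q) ^+ 3 + M ^+ 2 * (j / Q)) * j <= 2 * M * (1 + M ^+ 2) * j.
    apply: ler_wpM2r; first exact: ltW.
    by apply: ler_wpM2l; [rewrite mulr_ge0 ?ltW|qlra].
  qlra.
have h5 : 2 * M * (1 + M ^+ 2) * j < L * j by rewrite ltr_pM2r.
by rewrite WE in W0; qlra.
Qed.

Section Graph.
Context {R : realType} {I : set R} {T1 : R} (F : flow I T1).
Local Notation X := (j0 (fX F)). Local Notation Y := (j0 (fY F)).
Local Notation a := (j1 (fX F)). Local Notation b := (j1 (fY F)).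
Local Notation a1 := (j2 (fX F)). Local Notation b1 := (j2 (fY F)).
Local Notation Xt := (jt (fX F)). Local Notation Yt := (jt (fY F)).
Local Notation q := (speed2 F). Local Notation thu := (ang_u F).
Local Notation thuu := (ang_uu F). Local Notation tht := (ang_t F).
Local Notation nu := (tdot F).

Lemma unit_frame_norm (e1 e2 x y : R) : e1 ^+ 2 + e2 ^+ 2 = 1 ->
  x ^+ 2 + y ^+ 2 = (e1 * x + e2 * y) ^+ 2 + (e1 * y - e2 * x) ^+ 2.
Proof. by move=> ee; rewrite -[LHS]mul1r -ee; ring. Qed.

Lemma isD_expR_lin (k c s : R) : isD (fun t => k * expR (c * t)) s (c * (k * expR (c * s))).
Proof.
have H := isD_comp (isD_mul (isD_cst c s) (isD_id s)) (is_derive_expR (c * s)).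
by apply: (isD_eq (isD_mul (isD_cst k s) H)); ring.
Qed.

Lemma curvature_bound (B t0 : R) : 0 <= t0 < T1 -> exists2 C, 0 <= C &
  forall u t, I u -> 0 <= t <= t0 -> X u t ^+ 2 + Y u t ^+ 2 <= B -> thu u t ^+ 2 / q u t <= C.
Proof.
move=> ht0; have t0T : t0 < T1 by qlra.
have [c [d [Ic Id cd Hcd]]] := f_proper F B t0T.
have [||C HC] := @box_bounded R c d t0 (fun u t => thu u t ^+ 2 / q u t) cd; first qlra.
  move=> u t hu ht; have Iu : I u by exact: (f_itv F Ic Id).
  have tT : t < T1 by qlra.
  have qn : q u t != 0 by rewrite gt_eqF// speed2_gt0.
  have ca := j1_c (j := fX F) Iu tT; have cb := j1_c (j := fY F) Iu tT.
  have ca1 := j2_c (j := fX F) Iu tT; have cb1 := j2_c (j := fY F) Iu tT.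
  have cq : cont2 q u t by apply: cont2D; apply: cont2M.
  have cth : cont2 thu u t by apply: cont2M; [apply: cont2B; apply: cont2M|apply: cont2V].
  by apply: cont2M; [apply: cont2M|apply: cont2V].
have C0 : 0 <= C.
  apply: (le_trans _ (HC c 0 _ _)); [|qlra|qlra].
  by rewrite divr_ge0 ?sqr_ge0// ltW// speed2_gt0//; qlra.
by exists C => // u t Iu ht hB; apply: HC => //; exact: (Hcd u t).
Qed.

(** Constants for [graph_end]: the weight grows at the rate [C] of the curvature bound, and up to
    time [t0] the rate [L] exceeds the value that [kink_ineq] asks for. The factor [4] makes the
    barrier positive at distance [1] from its centre. *)
Lemma exp_weight_bound (C t0 : R) : 0 <= C -> exists2 L, 0 < L &
  forall t, 0 <= t <= t0 -> 4 <= 4 * expR (C * t) /\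
  2 * (4 * expR (C * t)) * (1 + (4 * expR (C * t)) ^+ 2) < L.
Proof.
move=> C0; pose M t := 4 * expR (C * t).
pose Mb := 4 * expR (C * t0).
pose L := 2 * Mb * (1 + Mb ^+ 2) + 1.
have Mb0 : 0 < Mb by rewrite mulr_gt0// expR_gt0.
have L0 : 0 < L.
  have h1 := sqr_ge0 Mb; have h2 : 0 < 1 + Mb ^+ 2 by qlra.
  have h3 : 0 < 2 * Mb * (1 + Mb ^+ 2) by apply: mulr_gt0 => //; apply: mulr_gt0.
  by rewrite /L; qlra.
have M4 t : 0 <= t -> 4 <= M t.
  move=> t0'; rewrite /M ler_peMr//; apply: le_trans (expR_ge1Dx _).
  by rewrite lerDl mulr_ge0.
have MMb t : t <= t0 -> M t <= Mb.
  by move=> ht; rewrite /M /Mb ler_pM2l// ler_expR ler_wpM2l.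
exists L => // t /andP[t1 t2]; split; first exact: M4.
have M0 : 0 < M t by apply: lt_le_trans (M4 t t1).
have MM : M t ^+ 2 <= Mb ^+ 2 by rewrite ler_pXn2r ?nnegrE ?MMb// ltW.
have : 2 * M t * (1 + M t ^+ 2) <= 2 * Mb * (1 + Mb ^+ 2).
  by apply: ler_pM; [rewrite mulr_ge0// ltW|rewrite addr_ge0// sqr_ge0|rewrite ler_pM2l// MMb|rewrite lerD2l].
by rewrite /L /M; qlra.
Qed.

(* Barrier: [J = nu - j + M (sqrt ((x - x0)^2 + j^2) - j)], with [j] decreasing and [M] increasing
   exponentially in time.  The kink at [x = x0] absorbs the unbounded reaction term of [nu]. *)
Lemma graph_end (ub t0 e1 e2 H R1 : R) : e1 ^+ 2 + e2 ^+ 2 = 1 -> I ub -> 0 <= t0 < T1 ->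
  (forall u, I u -> ub <= u -> nu e1 e2 u 0 = 1) ->
  (forall u t, I u -> ub <= u -> 0 <= t <= t0 -> (e1 * Y u t - e2 * X u t) ^+ 2 <= H) ->
  (forall t, 0 <= t <= t0 -> e1 * X ub t + e2 * Y ub t <= R1 - 1) ->
  forall u t, I u -> ub <= u -> 0 <= t <= t0 -> R1 <= e1 * X u t + e2 * Y u t ->
    0 < nu e1 e2 u t.
Proof.
move=> ee Iub ht0 init hH lat u0 s0 Iu0 ubu0 hs0 R1u0.
pose X0 := e1 * X u0 s0 + e2 * Y u0 s0.
pose B := (`|X0| + 1) ^+ 2 + H.
have t0T : t0 < T1 by qlra.
pose y u t := e1 * X u t + e2 * Y u t - X0.
have normB u t : I u -> ub <= u -> 0 <= t <= t0 -> y u t ^+ 2 <= 1 -> X u t ^+ 2 + Y u t ^+ 2 <= B.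
  move=> Iu ubu ht hy; rewrite (unit_frame_norm _ _ ee) /B lerD ?hH//.
  have y1 : `|y u t| <= 1 by rewrite -sqrtr_sqr -[leRHS]sqrtr1 ler_wsqrtr.
  rewrite -real_normK ?num_real// ler_pXn2r ?nnegrE ?addr_ge0//.
  have -> : e1 * X u t + e2 * Y u t = X0 + y u t by rewrite /y; ring.
  by apply: (le_trans (ler_normD _ _)); rewrite lerD2l.
have [C C0 HC] := curvature_bound B ht0.
have [L L0 HL] := exp_weight_bound t0 C0.
pose M t := 4 * expR (C * t).
pose j t := 2^-1 * expR (- L * t).
have M4 t : 0 <= t <= t0 -> 4 <= M t by move=> /HL[].
have j0' t : 0 < j t by rewrite mulr_gt0 ?invr_gt0 ?expR_gt0.
have j12 t : 0 <= t -> j t <= 2^-1.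
  by move=> ht; rewrite /j ler_piMr ?invr_ge0// -expR0 ler_expR mulNr oppr_le0 mulr_ge0// ltW.
pose Q u t := Num.sqrt (y u t ^+ 2 + j t ^+ 2).
have Qpos u t : 0 < y u t ^+ 2 + j t ^+ 2 by rewrite ltr_wpDl ?sqr_ge0// exprn_gt0.
have Q2 u t : Q u t ^+ 2 = y u t ^+ 2 + j t ^+ 2 by rewrite sqr_sqrtr// ltW.
have jQ u t : j t <= Q u t.
  by rewrite -[leLHS](@ger0_norm _ (j t)) ?(ltW (j0' _))// -sqrtr_sqr ler_wsqrtr// lerDr sqr_ge0.
(* With [M >= 4], [j <= 1 / 2] and [Q >= 1] the kink contributes at least [2], more than [1 + j]. *)
have MQ u t : 0 <= t <= t0 -> 1 <= Q u t -> 0 < - 1 - j t + M t * (Q u t - j t).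
  move=> ht Q1; have /andP[t1 _] := ht; have h1 := j12 t t1; have h2 := M4 t ht.
  have : 4 * 2^-1 <= M t * (Q u t - j t) by apply: ler_pM => //; qlra.
  qlra.
pose J u t := nu e1 e2 u t - j t + M t * (Q u t - j t).
pose yu u t := e1 * a u t + e2 * b u t.
pose yuu u t := e1 * a1 u t + e2 * b1 u t.
pose yt u t := e1 * Xt u t + e2 * Yt u t.
pose mu u t := nu e2 (- e1) u t.
pose Ju u t := mu u t * thu u t + M t * (y u t * yu u t / Q u t).
pose Juu u t := - nu e1 e2 u t * thu u t * thu u t + mu u t * thuu u t +
  M t * ((yu u t * yu u t + y u t * yuu u t) / Q u t - y u t * yu u t * (y u t * yu u t / Q u t) / Q u
    t ^+ 2).
pose Jt u t := mu u t * tht u t - - (L * j t) + (C * M t * (Q u t - j t) +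
  M t * ((y u t * yt u t + j t * - (L * j t)) / Q u t - - (L * j t))).
have far u t : I u -> 0 <= t <= t0 -> 1 < y u t ^+ 2 -> 0 < J u t.
  move=> Iu ht hy; have /andP[n1 _] : -1 <= nu e1 e2 u t <= 1 by apply: tdot_bound => //; qlra.
  have Q1 : 1 <= Q u t by rewrite -[leLHS]sqrtr1 ler_wsqrtr//; have := sqr_ge0 (j t); qlra.
  by have := MQ u t ht Q1; rewrite /J; qlra.
suff JP : forall u t, I u -> ub <= u -> 0 <= t <= t0 -> 0 < J u t.
  (* At the centre [Q = j], so the kink vanishes and the barrier gives [nu > j > 0]. *)
  have := JP u0 s0 Iu0 ubu0 hs0.
  have -> : J u0 s0 = nu e1 e2 u0 s0 - j s0.
    rewrite /J /Q; have -> : y u0 s0 = 0 by rewrite /y subrr.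
    by rewrite expr0n/= add0r sqrtr_sqr ger0_norm ?(ltW (j0' _))// subrr mulr0 addr0.
  by have := j0' s0; qlra.
have dQu u t : I u -> 0 <= t <= t0 -> isD (Q ^~ t) u (y u t * yu u t / Q u t).
  move=> Iu ht; have ht' : 0 <= t < T1 by qlra.
  have dy : isD (y ^~ t) u (yu u t).
    apply: (isD_eq (isD_sub (isD_add (isD_mul (isD_cst e1 u) (j0_du (fX F) Iu ht'))
      (isD_mul (isD_cst e2 u) (j0_du (fY F) Iu ht'))) (isD_cst X0 u))); rewrite /yu; ring.
  have d2 : isD (fun u => y u t ^+ 2 + j t ^+ 2) u (2 * (y u t * yu u t)).
    apply: (isD_ext (f := fun u => y u t * y u t + j t ^+ 2)); first by move=> v; rewrite -expr2.
    by apply: (isD_eq (isD_add (isD_mul dy dy) (isD_cst _ u))); ring.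
  have Qn : Q u t != 0 by rewrite gt_eqF// sqrtr_gt0.
  by apply: (isD_eq (isD_sqrt d2 (Qpos u t))); rewrite -/(Q u t); field.
refine (@max_principle _ _ _ F ub t0 B J Ju Juu Jt Iub ht0 _ _ _ _ _ _ _ _).
- move=> u t Iu ubu ht; have tT : t < T1 by qlra.
  have cj : cont2 (fun _ t => j t) u t.
    apply: cont2M; first exact: cont2C.
    by apply: cont2comp; [apply: cont2M; [exact: cont2C|exact: cont2t]|exact: continuous_expR].
  have cy : cont2 y u t.
    apply: cont2B; last exact: cont2C.
    by apply: cont2D; apply: cont2M; [exact: cont2C|exact: j0_c|exact: cont2C|exact: j0_c].
  apply: cont2D; first by apply: cont2B => //; exact: tdot_c.
  apply: cont2M.
    apply: cont2M; first exact: cont2C.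
    by apply: cont2comp; [apply: cont2M; [exact: cont2C|exact: cont2t]|exact: continuous_expR].
  apply: cont2B => //; apply: cont2comp; last exact: sqrt_continuous.
  by apply: cont2D; apply: cont2M.
- move=> u t Iu ubu ht Jle; apply: normB => //; rewrite leNgt; apply/negP => /far h.
  by have := h Iu ht; qlra.
- move=> u Iu ubu; rewrite /J init//.
  have h1 := j12 0 (lexx _); have h2 : 0 <= M 0 * (Q u 0 - j 0).
    by rewrite mulr_ge0 ?subr_ge0// /M mulr_ge0// expR_ge0.
  qlra.
- move=> t ht; have := lat t ht => hl.
  have [hy|hy] := ltP 1 (y ub t ^+ 2); first exact: far.
  have ym1 : y ub t <= -1 by rewrite /y /X0; qlra.
  have yE : y ub t = -1 by apply/eqP; rewrite eq_le ym1/=; nra.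
  have /andP[n1 _] : -1 <= nu e1 e2 ub t <= 1 by apply: tdot_bound => //; qlra.
  have Q1 : 1 <= Q ub t.
    by rewrite -[leLHS]sqrtr1 ler_wsqrtr// yE; have := sqr_ge0 (j t); qlra.
  by have := MQ ub t ht Q1; rewrite /J; qlra.
- move=> u t Iu ht; have ht' : 0 <= t < T1 by qlra.
  have H1 := isD_add (isD_sub (isD_tdot_u F e1 e2 Iu ht') (isD_cst (j t) u))
    (isD_mul (isD_cst (M t) u) (isD_sub (dQu u t Iu ltac:(qlra)) (isD_cst (j t) u))).
  by apply: (isD_eq H1); rewrite /Ju /mu; ring.
- move=> u t Iu ht; have ht' : 0 < t < T1 by qlra. have ht'' : 0 <= t < T1 by qlra.
  have dy : isD (y ^~ t) u (yu u t).
    apply: (isD_eq (isD_sub (isD_add (isD_mul (isD_cst e1 u) (j0_du (fX F) Iu ht''))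
      (isD_mul (isD_cst e2 u) (j0_du (fY F) Iu ht''))) (isD_cst X0 u))); rewrite /yu; ring.
  have dyu : isD (yu ^~ t) u (yuu u t).
    apply: (isD_eq (isD_add (isD_mul (isD_cst e1 u) (j1_du (fX F) Iu ht''))
      (isD_mul (isD_cst e2 u) (j1_du (fY F) Iu ht'')))); rewrite /yuu; ring.
  have Qn : Q u t != 0 by rewrite gt_eqF// sqrtr_gt0.
  have H1 := isD_add (isD_mul (isD_tdot_u F e2 (- e1) Iu ht'') (isD_ang_u_u F Iu ht'))
   (isD_mul (isD_cst (M t) u) (isD_div (isD_mul dy dyu) (dQu u t Iu ltac:(qlra)) Qn)).
  by apply: (isD_eq H1); rewrite /Juu /mu tdotN; field.
- move=> u t Iu ht; have ht' : 0 < t < T1 by qlra.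
  have dy : isD (y u) t (yt u t).
    apply: (isD_eq (isD_sub (isD_add (isD_mul (isD_cst e1 t) (j0_dt (fX F) Iu ht'))
      (isD_mul (isD_cst e2 t) (j0_dt (fY F) Iu ht'))) (isD_cst X0 t))); rewrite /yt; ring.
  have dj : isD j t (- (L * j t)) by apply: (isD_eq (isD_expR_lin 2^-1 (- L) t)); rewrite /j; ring.
  have dM : isD M t (C * M t) by apply: isD_expR_lin.
  have Qn : Q u t != 0 by rewrite gt_eqF// sqrtr_gt0.
  have d2 : isD (fun t => y u t ^+ 2 + j t ^+ 2) t (2 * (y u t * yt u t + j t * - (L * j t))).
    apply: (isD_ext (f := fun t => y u t * y u t + j t * j t)); first by move=> v; rewrite -!expr2.
    by apply: (isD_eq (isD_add (isD_mul dy dy) (isD_mul dj dj))); ring.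
  have dQ : isD (Q u) t ((y u t * yt u t + j t * - (L * j t)) / Q u t).
    by apply: (isD_eq (isD_sqrt d2 (Qpos u t))); rewrite -/(Q u t); field.
  have H1 := isD_add (isD_sub (isD_tdot_t F e1 e2 Iu ht') dj) (isD_mul dM (isD_sub dQ dj)).
  by apply: (isD_eq H1); rewrite /Jt /mu; ring.
- move=> u t tau Iu ubu ht Ju0 hX hY hth; have ht' : 0 < t < T1 by qlra.
  have tT : t < T1 by qlra.
  have q0 : 0 < q u t by apply: speed2_gt0.
  have hth' : 0 <= t <= t0 by qlra.
  have hB : X u t ^+ 2 + Y u t ^+ 2 <= B.
    apply: normB => //; first exact: ltW.
    by rewrite leNgt; apply/negP => /(far _ _ Iu hth'); rewrite Ju0 ltxx.
  apply: (@kink_ineq R (q u t) (Num.sqrt (q u t)) (nu e1 e2 u t) (mu u t) (thu u t) (thuu u t)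
    (tht u t) tau (y u t) (yt u t) (yu u t) (yuu u t) (j t) (- (L * j t)) (Q u t) (M t) (C * M t) C L) => //.
  + by rewrite sqrtr_gt0.
  + by rewrite sqr_sqrtr// ltW.
  + by rewrite /yt /yuu /yu hX hY; ring.
  + exact: tdot_speed.
  + exact: lt_le_trans (M4 t hth').
  + exact: HC.
  + by case: (HL t hth').
Qed.

End Graph.

Lemma ler_norm_sqr {R : realType} (x r : R) : 0 <= r -> (`|x| <= r) = (x ^+ 2 <= r ^+ 2).
Proof. by move=> r0; rewrite -(real_normK (num_real x)) ler_pXn2r ?nnegrE. Qed.

Lemma ltr_norm_sqr {R : realType} (x r : R) : 0 <= r -> (`|x| < r) = (x ^+ 2 < r ^+ 2).
Proof. by move=> r0; rewrite -(real_normK (num_real x)) ltr_pXn2r ?nnegrE. Qed.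

Section Graph.
Context {R : realType} {I : set R} {T1 : R} (F : flow I T1).
Local Notation X := (j0 (fX F)). Local Notation Y := (j0 (fY F)).
Local Notation a := (j1 (fX F)). Local Notation b := (j1 (fY F)).
Local Notation a1 := (j2 (fX F)). Local Notation b1 := (j2 (fY F)).
Local Notation Xt := (jt (fX F)). Local Notation Yt := (jt (fY F)).
Local Notation q := (speed2 F). Local Notation thu := (ang_u F).
Local Notation thuu := (ang_uu F). Local Notation tht := (ang_t F).
Local Notation nu := (tdot F).

(* Barrier: [nu - 1 + m (x - x0)^2 + 3 m t + al] with [m = 2 (x0 - R1)^-2]. *)
Lemma tangent_decay (ub t0 e1 e2 H R1 : R) : e1 ^+ 2 + e2 ^+ 2 = 1 -> I ub -> 0 <= t0 < T1 ->
  (forall u, I u -> ub <= u -> nu e1 e2 u 0 = 1) ->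
  (forall u t, I u -> ub <= u -> 0 <= t <= t0 -> (e1 * Y u t - e2 * X u t) ^+ 2 <= H) ->
  (forall t, 0 <= t <= t0 -> e1 * X ub t + e2 * Y ub t <= R1) ->
  (forall u t, I u -> ub <= u -> 0 <= t <= t0 -> R1 <= e1 * X u t + e2 * Y u t ->
    0 < nu e1 e2 u t) ->
  forall u t, I u -> ub <= u -> 0 <= t <= t0 -> R1 < e1 * X u t + e2 * Y u t ->
    1 - 6 * t / (e1 * X u t + e2 * Y u t - R1) ^+ 2 <= nu e1 e2 u t.
Proof.
move=> ee Iub ht0 init hH lat nupos u0 s0 Iu0 ubu0 hs0.
set X0 := e1 * X u0 s0 + e2 * Y u0 s0 => R1X0.
have t0T : t0 < T1 by qlra.
pose rho := X0 - R1; rewrite -/rho.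
have rho0 : 0 < rho by rewrite subr_gt0.
pose m := 2 / rho ^+ 2.
have r20 : 0 < rho ^+ 2 by rewrite exprn_gt0.
have m0 : 0 < m by rewrite divr_gt0.
have mrho : m * rho ^+ 2 = 2 by rewrite /m divfK// gt_eqF.
have -> : 6 * s0 / rho ^+ 2 = 3 * m * s0 by rewrite /m; field; rewrite gt_eqF.
apply/ler_addgt0Pr => al al0.
pose y u t := e1 * X u t + e2 * Y u t - X0.
pose yu u t := e1 * a u t + e2 * b u t.
pose yuu u t := e1 * a1 u t + e2 * b1 u t.
pose yt u t := e1 * Xt u t + e2 * Yt u t.
pose mu u t := nu e2 (- e1) u t.
pose J u t := nu e1 e2 u t - 1 + m * (y u t * y u t) + 3 * m * t + al.
pose Ju u t := mu u t * thu u t + m * (2 * (y u t * yu u t)).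
pose Juu u t := - nu e1 e2 u t * thu u t * thu u t + mu u t * thuu u t +
  m * (2 * (yu u t * yu u t + y u t * yuu u t)).
pose Jt u t := mu u t * tht u t + m * (2 * (y u t * yt u t)) + 3 * m.
suff JP : forall u t, I u -> ub <= u -> 0 <= t <= t0 -> 0 < J u t.
  have := JP u0 s0 Iu0 ubu0 hs0; rewrite /J.
  have -> : y u0 s0 = 0 by rewrite /y subrr.
  by rewrite mulr0 mulr0; qlra.
have near_ u t : I u -> 0 <= t <= t0 -> J u t <= 0 -> y u t ^+ 2 <= rho ^+ 2.
  move=> Iu ht Jle; have /andP[n1 _] : -1 <= nu e1 e2 u t <= 1 by apply: tdot_bound => //; qlra.
  have mt : 0 <= m * t by apply: mulr_ge0; [exact: ltW|qlra].
  rewrite -(ler_pM2l m0) mrho; move: Jle; rewrite /J; qlra.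
have dy u t : I u -> 0 <= t <= t0 -> isD (y ^~ t) u (yu u t).
  move=> Iu ht; have ht' : 0 <= t < T1 by qlra.
  apply: (isD_eq (isD_sub (isD_add (isD_mul (isD_cst e1 u) (j0_du (fX F) Iu ht'))
    (isD_mul (isD_cst e2 u) (j0_du (fY F) Iu ht'))) (isD_cst X0 u))); rewrite /yu; ring.
refine (@max_principle _ _ _ F ub t0 ((`|X0| + rho) ^+ 2 + H) J Ju Juu Jt Iub ht0 _ _ _ _ _ _ _ _).
- move=> u t Iu ubu ht; have tT : t < T1 by qlra.
  have cy : cont2 y u t.
    apply: cont2B; last exact: cont2C.
    by apply: cont2D; apply: cont2M; [exact: cont2C|exact: j0_c|exact: cont2C|exact: j0_c].
  apply: cont2D; last exact: cont2C.
  apply: cont2D; last by apply: cont2M; [exact: cont2C|exact: cont2t].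
  apply: cont2D; first by apply: cont2B; [exact: tdot_c|exact: cont2C].
  by apply: cont2M; [exact: cont2C|apply: cont2M].
- move=> u t Iu ubu ht /(near_ _ _ Iu ht) hy.
  rewrite (unit_frame_norm _ _ ee) lerD ?hH//.
  have y1 : `|y u t| <= rho by rewrite ler_norm_sqr// ltW.
  have -> : e1 * X u t + e2 * Y u t = X0 + y u t by rewrite /y; ring.
  rewrite -ler_norm_sqr; last by apply: addr_ge0 => //; exact: ltW.
  by apply: (le_trans (ler_normD _ _)); rewrite lerD2l.
- move=> u Iu ubu; rewrite /J init// mulr0 addr0 subrr add0r -expr2.
  by apply: ltr_wpDl => //; apply: mulr_ge0; [exact: ltW|exact: sqr_ge0].
- move=> t ht; have hl := lat t ht; rewrite ltNge; apply/negP => Jle.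
  have /andP[n1 _] : -1 <= nu e1 e2 ub t <= 1 by apply: tdot_bound => //; qlra.
  have mt : 0 <= m * t by apply: mulr_ge0; [exact: ltW|qlra].
  have : m * rho ^+ 2 <= m * (y ub t * y ub t).
    rewrite ler_pM2l// -expr2 -[leRHS]sqrrN ler_pXn2r ?nnegrE//; [|by apply: ltW|]; rewrite /y /rho; qlra.
  by move: Jle; rewrite /J mrho; qlra.
- move=> u t Iu ht; have ht' : 0 <= t < T1 by qlra.
  have dy' := dy u t Iu ltac:(qlra).
  have H1 := isD_add (isD_add (isD_add (isD_sub (isD_tdot_u F e1 e2 Iu ht') (isD_cst 1 u))
    (isD_mul (isD_cst m u) (isD_mul dy' dy'))) (isD_cst (3 * m * t) u)) (isD_cst al u).
  by apply: (isD_eq H1); rewrite /Ju /mu; ring.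
- move=> u t Iu ht; have ht' : 0 < t < T1 by qlra. have ht'' : 0 <= t < T1 by qlra.
  have dy' := dy u t Iu ltac:(qlra).
  have dyu : isD (yu ^~ t) u (yuu u t).
    apply: (isD_eq (isD_add (isD_mul (isD_cst e1 u) (j1_du (fX F) Iu ht''))
      (isD_mul (isD_cst e2 u) (j1_du (fY F) Iu ht'')))); rewrite /yuu; ring.
  have H1 := isD_add (isD_mul (isD_tdot_u F e2 (- e1) Iu ht'') (isD_ang_u_u F Iu ht'))
   (isD_mul (isD_cst m u) (isD_mul (isD_cst 2 u) (isD_mul dy' dyu))).
  by apply: (isD_eq H1); rewrite /Juu /mu tdotN; ring.
- move=> u t Iu ht; have ht' : 0 < t < T1 by qlra.
  have dy' : isD (y u) t (yt u t).
    apply: (isD_eq (isD_sub (isD_add (isD_mul (isD_cst e1 t) (j0_dt (fX F) Iu ht'))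
      (isD_mul (isD_cst e2 t) (j0_dt (fY F) Iu ht'))) (isD_cst X0 t))); rewrite /yt; ring.
  have H1 := isD_add (isD_add (isD_add (isD_sub (isD_tdot_t F e1 e2 Iu ht') (isD_cst 1 t))
    (isD_mul (isD_cst m t) (isD_mul dy' dy'))) (isD_mul (isD_cst (3 * m) t) (isD_id t))) (isD_cst al t).
  by apply: (isD_eq H1); rewrite /Jt /mu; ring.
- move=> u t tau Iu ubu ht Ju0 hX hY hth; have ht' : 0 < t < T1 by qlra.
  have tT : t < T1 by qlra.
  have q0 : 0 < q u t by apply: speed2_gt0.
  have hth' : 0 <= t <= t0 by qlra.
  have /andP[n1 n2] : -1 <= nu e1 e2 u t <= 1 by apply: tdot_bound.
  have mt : 0 <= m * t by apply: mulr_ge0; [exact: ltW|qlra].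
  have hy2 : y u t ^+ 2 < rho ^+ 2 by rewrite -(ltr_pM2l m0) mrho; move: Ju0; rewrite /J; qlra.
  have hy1 : `|y u t| < rho by rewrite ltr_norm_sqr// ltW.
  have nu0 : 0 < nu e1 e2 u t.
    apply: nupos => //; first exact: ltW.
    by move: hy1; rewrite ltr_norml /y /rho; qlra.
  (* The reaction term has a good sign by [nupos], and the quadratic term contributes [- 2 m nu^2],
     which [3 m] outweighs since [nu <= 1]. *)
  have -> : Jt u t - Juu u t / q u t - tau * Ju u t =
      nu e1 e2 u t * (thu u t ^+ 2 / q u t) + m * (3 - 2 * nu e1 e2 u t ^+ 2).
    have e3 : yu u t = Num.sqrt (q u t) * nu e1 e2 u t by exact: tdot_speed.
    have e4 : Num.sqrt (q u t) ^+ 2 = q u t by rewrite sqr_sqrtr// ltW.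
    have e5 : yt u t = yuu u t / q u t + tau * yu u t by rewrite /yt /yuu /yu hX hY; ring.
    have Sn : Num.sqrt (q u t) != 0 by rewrite gt_eqF// sqrtr_gt0.
    rewrite /Jt /Juu /Ju hth e5 e3; move: (Num.sqrt (q u t)) e4 Sn => S <- Sn.
    rewrite /mu; field.
    by [].
  have h1 : 0 <= nu e1 e2 u t * (thu u t ^+ 2 / q u t).
    by apply: mulr_ge0; [exact: ltW|apply: divr_ge0; [exact: sqr_ge0|exact: ltW]].
  have h2 : nu e1 e2 u t ^+ 2 <= 1 by apply: exprn_ile1 => //; exact: ltW.
  have h3 : 0 < m * (3 - 2 * nu e1 e2 u t ^+ 2) by apply: mulr_gt0 => //; qlra.
  qlra.
Qed.

End Graph.

(** * Confinement and asymptotic direction of a radial end *)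

Section RadialEnd.
Context {R : realType} {I : set R} {T1 : R} (F : flow I T1).
Local Notation X := (j0 (fX F)). Local Notation Y := (j0 (fY F)).
Local Notation a := (j1 (fX F)). Local Notation b := (j1 (fY F)).
Local Notation a1 := (j2 (fX F)). Local Notation b1 := (j2 (fY F)).
Local Notation Xt := (jt (fX F)). Local Notation Yt := (jt (fY F)).
Local Notation q := (speed2 F). Local Notation thu := (ang_u F).
Local Notation thuu := (ang_uu F). Local Notation tht := (ang_t F).
Local Notation nu := (tdot F).

(** That the tangent points outwards is a clause of its own; [radial_end_of] derives it from
    properness. *)
Definition radial_end ub e1 e2 := [/\ I ub, e1 ^+ 2 + e2 ^+ 2 = 1,
  forall u, I u -> ub <= u -> exists2 r, 0 <= r & X u 0 = r * e1 /\ Y u 0 = r * e2 &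
  forall u, I u -> ub <= u -> nu e1 e2 u 0 = 1].

Lemma lin_c k1 k2 u t : I u -> t < T1 -> cont2 (fun u t => k1 * X u t + k2 * Y u t) u t.
Proof.
by move=> Iu tT; apply: cont2D; (apply: cont2M; [exact: cont2C|exact: j0_c]).
Qed.

(** Three linear functions that are nonpositive on the ray stay bounded by [lin_max]: the distance
    from its line with either sign, and the component opposite to the ray. At the boundary parameter
    [ub] the bound comes from compactness in time. *)
Lemma radial_end_bounds ub e1 e2 t0 : radial_end ub e1 e2 -> 0 <= t0 < T1 ->
  exists2 C, 0 <= C & forall u t, I u -> ub <= u -> 0 <= t <= t0 ->
    `|e1 * Y u t - e2 * X u t| <= C /\ - C <= e1 * X u t + e2 * Y u t.
Proof.
move=> [Iub ee ray _] ht0.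
have lin (k1 k2 : R) : (forall u, I u -> ub <= u -> k1 * X u 0 + k2 * Y u 0 <= 0) ->
    exists2 C, 0 <= C & forall u t, I u -> ub <= u -> 0 <= t <= t0 -> k1 * X u t + k2 * Y u t <= C.
  move=> k0; have [|||C HC] := @box_bounded R ub ub t0 (fun u t => k1 * X u t + k2 * Y u t).
  - exact: lexx.
  - qlra.
  - move=> u t hu ht; have -> : u = ub by apply/eqP; rewrite eq_le andbC.
    by apply: lin_c => //; qlra.
  exists (Num.max 0 C); first by rewrite le_max lexx.
  apply: (lin_max (F := F)) => //.
    by move=> u Iu ubu; rewrite le_max k0.
  by move=> t ht; rewrite le_max HC ?orbT// lexx.
have [|C1 C10 H1] := lin (- e2) e1.
  move=> u Iu ubu; have [r r0 [-> ->]] := ray u Iu ubu; rewrite (_ : _ + _ = 0)//; ring.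
have [|C2 C20 H2] := lin e2 (- e1).
  move=> u Iu ubu; have [r r0 [-> ->]] := ray u Iu ubu; rewrite (_ : _ + _ = 0)//; ring.
have [|C3 C30 H3] := lin (- e1) (- e2).
  move=> u Iu ubu; have [r r0 [-> ->]] := ray u Iu ubu.
  have -> : - e1 * (r * e1) + - e2 * (r * e2) = - (r * (e1 ^+ 2 + e2 ^+ 2)) by ring.
  by rewrite ee mulr1 oppr_le0.
exists (C1 + C2 + C3); first qlra.
move=> u t Iu ubu ht; have h1 := H1 u t Iu ubu ht; have h2 := H2 u t Iu ubu ht; have h3 := H3 u t Iu ubu ht.
by split; [rewrite ler_norml|]; qlra.
Qed.

(** The component across the ray is bounded, and the one along it is bounded below. Points where the
    latter is at most [M] thus lie in a disc, and properness confines their parameters. *)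
Lemma radial_end_far ub e1 e2 t0 : radial_end ub e1 e2 -> 0 <= t0 < T1 ->
  forall M, exists uc, [/\ I uc, ub <= uc & forall u t, I u -> uc <= u -> 0 <= t <= t0 ->
    M < e1 * X u t + e2 * Y u t].
Proof.
move=> rE ht0 M; have [C C0 HC] := radial_end_bounds rE ht0.
have [Iub ee _ _] := rE; have t0T : t0 < T1 by qlra.
pose N := `|M| + C.
have N0 : 0 <= N by apply: addr_ge0.
have [c [d [Ic Id cd Hcd]]] := f_proper F (N ^+ 2 + C ^+ 2) t0T.
have [e e0 He] := f_open F Id.
pose m := Num.max (d + e / 2) ub.
exists m; have mub : ub <= m by rewrite le_max lexx orbT.
have md : d + e / 2 <= m by rewrite le_max lexx.
split => //; first by rewrite /m; case: (leP (d + e / 2) ub) => // _; apply: He; qlra.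
move=> u t Iu mu ht; have [h1 h2] := HC u t Iu (le_trans mub mu) ht.
rewrite ltNge; apply/negP => lM.
have : c <= u <= d.
  apply: (Hcd u t Iu ht); rewrite (unit_frame_norm _ _ ee); apply: lerD.
    by rewrite -ler_norm_sqr// ler_norml /N; have := ler_norm M; have := normr_ge0 M; qlra.
  by rewrite -ler_norm_sqr.
qlra.
Qed.

Lemma radial_end_tangent ub e1 e2 t0 : radial_end ub e1 e2 -> 0 <= t0 < T1 ->
  forall M eps, 0 < eps -> exists uc, [/\ I uc, ub <= uc &
    forall u t, I u -> uc <= u -> 0 <= t <= t0 ->
    M < e1 * X u t + e2 * Y u t /\ 1 - eps <= nu e1 e2 u t].
Proof.
move=> rE ht0 M eps eps0; have [C C0 HC] := radial_end_bounds rE ht0.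
have [Iub ee ray init] := rE.
have hH u t : I u -> ub <= u -> 0 <= t <= t0 -> (e1 * Y u t - e2 * X u t) ^+ 2 <= C ^+ 2.
  by move=> Iu ubu ht; rewrite -ler_norm_sqr//; case: (HC u t Iu ubu ht).
have [|||B HB] := @box_bounded R ub ub t0 (fun u t => e1 * X u t + e2 * Y u t).
- exact: lexx.
- qlra.
- move=> u t hu ht; have -> : u = ub by apply/eqP; rewrite eq_le andbC.
  by apply: lin_c => //; qlra.
have lat t : 0 <= t <= t0 -> e1 * X ub t + e2 * Y ub t <= B by apply: HB; rewrite lexx.
pose R1 := B + 1.
have np := @graph_end R I T1 F ub t0 e1 e2 (C ^+ 2) R1 ee Iub ht0 init hH.
have {}np := np ltac:(by move=> t /lat; rewrite /R1; qlra).
have td := @tangent_decay R I T1 F ub t0 e1 e2 (C ^+ 2) R1 ee Iub ht0 init hH.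
have {}td := td ltac:(by move=> t /lat; rewrite /R1; qlra) np.
(* Where the distance [z] beyond [R1] exceeds [K >= 1], also [z ^+ 2 >= K], and the error
   [6 t / z^2] of [tangent_decay] is at most [eps]. *)
pose K := 6 * t0 / eps + 1.
have K1 : 1 <= K by rewrite lerDr divr_ge0//; [qlra|exact: ltW].
have [uc [Iuc ubuc Huc]] := radial_end_far rE ht0 (Num.max M (R1 + K)).
exists uc; split => // u t Iu ucu ht.
have := Huc u t Iu ucu ht; rewrite gt_max => /andP[h1 h2]; split => //.
have ubu := le_trans ubuc ucu.
apply: le_trans (td u t Iu ubu ht _); last qlra.
set z := _ + _ - R1; have zK : K < z by rewrite /z; qlra.
have z2 : K <= z ^+ 2.
  have : 1 * z <= z * z by apply: ler_wpM2r; qlra.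
  by rewrite mul1r -expr2; qlra.
rewrite lerD2l lerN2 ler_pdivrMr; last by apply: lt_le_trans z2; qlra.
have : eps * K <= eps * z ^+ 2 by rewrite ler_pM2l.
have -> : eps * K = 6 * t0 + eps by rewrite /K; field; rewrite gt_eqF.
qlra.
Qed.

End RadialEnd.

(** * The area minus angle estimate *)

Section Primitive.
Context {R : realType}.

Lemma primitive_on (c d : R) (f : R -> R) : c < d -> cont_on c d f ->
  exists P, forall u, c < u < d -> isD P u (f u).
Proof.
move=> cd cf; pose g := f \o clamp c d.
have cg : continuous g.
  move=> x; apply: continuous_comp; first exact: clamp_cont.
  by apply: cf; apply: clamp_itv; exact: ltW.
have ig : (@lebesgue_measure R).-integrable `[c, d] (EFin \o g).
  by apply: continuous_compact_integrable; [exact: segment_compact|exact: continuous_subspaceT].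
exists (fun x => (\int[@lebesgue_measure R]_(t in [set` `[c, x]]) (g t))%R) => u /andP[cu ud].
have [d1 d2] := continuous_FTC1_closed ud ig cu (cg u).
by split => //; rewrite -derive1E d2 /g /= clampK// !ltW.
Qed.

Lemma isD_const_diff (a b : R) (P Q f : R -> R) : a <= b ->
  (forall x, a <= x <= b -> isD P x (f x)) -> (forall x, a <= x <= b -> isD Q x (f x)) ->
  P b - P a = Q b - Q a.
Proof.
rewrite le_eqVlt => /predU1P[->|ab dP dQ]; first by rewrite !subrr.
have [|c _] := @mvt R a b (fun x => P x - Q x) (fun x => f x - f x) ab.
  by move=> x hx; exact: isD_sub (dP x hx) (dQ x hx).
by rewrite subrr mul0r; qlra.
Qed.

(** [primitive_on] needs a compact interval. For each [u] a primitive is chosen around both [m] and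
    [u]; normalised to vanish at [m], these agree where they overlap. *)
Lemma primitive_exists (I : set R) (f : R -> R) :
  (forall u, I u -> exists2 e, 0 < e & forall v, u - e < v < u + e -> I v) ->
  (forall u v w, I u -> I v -> u <= w <= v -> I w) ->
  (forall u, I u -> {for u, continuous f}) ->
  exists P, forall u, I u -> isD P u (f u).
Proof.
move=> Iop Iit cf.
have [I0|I0] := pselect (exists m, I m); last first.
  by exists f => u Iu; case: I0; exists u.
have [m Im] := I0.
have H u : exists Q : R -> R, I u -> exists c d, [/\ c < u < d, c < m < d, I c, I d &
    forall v, c < v < d -> isD Q v (f v)].
  have [Iu|] := pselect (I u); last by exists f.
  pose a := Num.min u m. pose b := Num.max u m.
  have Ia : I a by rewrite /a; case: (leP u m).
  have Ib : I b by rewrite /b; case: (leP u m).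
  have [au am ub mb] : [/\ a <= u, a <= m, u <= b & m <= b].
    by split; rewrite ?ge_min ?le_max lexx ?orbT.
  have [e1 e10 H1] := Iop a Ia; have [e2 e20 H2] := Iop b Ib.
  have Ic : I (a - e1 / 2) by apply: H1; qlra.
  have Id : I (b + e2 / 2) by apply: H2; qlra.
  have [||Q HQ] := @primitive_on (a - e1 / 2) (b + e2 / 2) f; first qlra.
    by move=> v hv; apply: cf; exact: Iit hv.
  by exists Q => _; exists (a - e1 / 2), (b + e2 / 2); split => //; qlra.
have [Q HQ] := choice H.
exists (fun u => Q u u - Q u m) => u Iu.
have [c [d [cud cmd Ic Id dQ]]] := HQ u Iu.
apply: (@isD_near _ (fun v => Q u v - Q u m)); last first.
  by apply: (isD_eq (isD_sub (dQ u cud) (isD_cst _ _))); rewrite subr0.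
have : \near u, c < u < d by apply: near_in_itvoo; rewrite in_itv.
apply: filterS => v cvd.
have Iv : I v by apply: (Iit _ _ _ Ic Id); qlra.
have [c' [d' [cvd' cmd' Ic' Id' dQ']]] := HQ v Iv.
have [vm|mv] := leP v m.
  have := @isD_const_diff v m (Q u) (Q v) f vm (fun x hx => dQ x ltac:(qlra)) (fun x hx => dQ' x ltac:(qlra)).
  qlra.
have := @isD_const_diff m v (Q u) (Q v) f (ltW mv) (fun x hx => dQ x ltac:(qlra)) (fun x hx => dQ' x
  ltac:(qlra)).
qlra.
Qed.

Lemma isD_eps (f : R -> R) (x l : R) :
  (forall e : R, 0 < e -> exists2 d : R, 0 < d & forall y : R, `|y - x| < d ->
    `|f y - f x - l * (y - x)| <= e * `|y - x|) ->
  isD f x l.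
Proof.
move=> H; have C : (fun h : R => h^-1 *: (f (h *: 1 + x) - f x)) @ 0^' --> l.
  apply/cvgrPdist_le => e e0; have [d d0 Hd] := H e e0.
  near=> h; have h0 : h != 0 by near: h; exact: nbhs_dnbhs_neq.
  have hd : `|h| < d by near: h; apply: dnbhs0_lt.
  have := Hd (h + x); rewrite addrK => /(_ hd) hh; rewrite -[h *: 1]/(h * 1) mulr1.
  have -> : l - h^-1 *: (f (h + x) - f x) = - h^-1 * (f (h + x) - f x - l * h).
    by rewrite -[_ *: _]/(h^-1 * _); field.
  by rewrite normrM normrN normfV ler_pdivrMl ?normr_gt0// [leRHS]mulrC.
split; first by apply/cvg_ex; exists l; exact: C.
by apply/cvg_lim; [exact: Rhausdorff|exact: C].
Unshelve. all: by end_near. Qed.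

Lemma tube (c d s : R) (g : R -> R -> R) : (forall u, c <= u <= d -> cont2 g u s) ->
  forall e : R, 0 < e -> exists2 del : R, 0 < del & forall u t : R, c <= u <= d -> `|t - s| < del ->
    `|g u t - g u s| < e.
Proof.
move=> cg e e0; have /compact_near_coveringP nc := @segment_compact R c d.
have [|del /= del0 H] := nc R (nbhs s) (fun t u => `|g u t - g u s| < e) _.
- move=> x; rewrite /= in_itv/= => hx; have := cg x hx.
  move=> /cvgrPdist_lt/(_ (e / 2) ltac:(qlra)) H.
  have H2 : \forall u \near x, `|g x s - g u s| < e / 2.
    have : {for x, continuous (fun u => (u, s))}.
      by apply: cont_pair; [exact: cvg_id|exact: cvg_cst].
    by move=> /(_ _ H).
  case: H => -[A B] [/= nA nB] AB.
  exists (A `&` [set u | `|g x s - g u s| < e / 2], B) => /=.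
    by split => //; exact: filterI.
  move=> [u t] [[/= Au h2] Bt]; have /= h1 := AB (u, t) (conj Au Bt).
  by move: h1 h2; rewrite !ltr_norml; qlra.
exists del => // u t hu ht; apply: (H t) => //=.
by rewrite /ball/= distrC.
Qed.

Section Potential.
Variables (c d s e0 : R) (f P : R -> R -> R).
Hypothesis cd : c <= d.
Hypothesis e00 : 0 < e0.
Hypothesis dP : forall u t, c <= u <= d -> `|t - s| < e0 -> isD (P ^~ t) u (f u t).

(** The primitives [P ^~ t] are chosen time by time, with unrelated constants, so only differences
    of two values can be expected to be continuous in [t]. *)
Lemma primitive_cont u m : c < u < d -> c <= m <= d -> (forall v, c <= v <= d -> cont2 f v s) ->
  cont2 (fun v t => P v t - P m t) u s.
Proof.
move=> hu hm cf; apply/cvgrPdist_lt => e ep.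
pose k := e / (2 * (d - c + 1)).
have k0 : 0 < k by rewrite divr_gt0// mulr_gt0//; qlra.
have [del del0 Hdel] := tube cf k0.
have ss : `|s - s| < e0 by rewrite subrr normr0.
have cu : {for u, continuous (fun v => P v s)} by apply: isD_cont (dP _ ss); qlra.
have nu : \forall p \near (u, s), `|P u s - P p.1 s| < e / 2.
  have := @cont_fst R R R (fun v => P v s) (u, s) cu.
  by move=> /cvgrPdist_lt/(_ (e / 2) ltac:(qlra)).
have nt : \forall p \near (u, s), `|p.2 - s| < Num.min del e0.
  have := @cont_snd R R R id (u, s) (@cvg_id _ _) => /cvgrPdist_lt/(_ (Num.min del e0)).
  rewrite lt_min del0 e00 => /(_ isT); by under eq_near do rewrite /= distrC.
have nv : \forall p \near (u, s), c < p.1 < d.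
  have : \forall v \near u, c < v < d by apply: near_in_itvoo; rewrite in_itv.
  by move=> h; exact: (@cont_fst R R R id (u, s) (@cvg_id _ _) _ h).
apply: filterS3 nu nt nv => -[v t] /= h1; rewrite lt_min => /andP[h2 h3] h4.
have key : `|(P v t - P m t) - (P v s - P m s)| <= k * (d - c).
  have lem x y : c <= x -> y <= d -> x < y -> `|(P y t - P x t) - (P y s - P x s)| <= k * (d - c).
    move=> cx yd xy.
    have [|z hz] := @mvt R x y (fun w => P w t - P w s) (fun w => f w t - f w s) xy.
      by move=> w hw; apply: isD_sub; apply: dP => //; qlra.
    have -> : P y t - P x t - (P y s - P x s) = P y t - P y s - (P x t - P x s) by ring.
    move=> ->; rewrite normrM; apply: ler_pM => //; first by apply/ltW/Hdel => //; qlra.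
    by rewrite gtr0_norm; qlra.
  have [vm|mv|->] := ltgtP v m.
  - have -> : P v t - P m t - (P v s - P m s) = - (P m t - P v t - (P m s - P v s)) by ring.
    by rewrite normrN; apply: lem; qlra.
  - by apply: lem; qlra.
  - by rewrite !subrr normr0 mulr_ge0//; [exact: ltW|qlra].
have kd : k * (d - c) < e / 2.
  rewrite /k mulrAC ltr_pdivrMr; last by rewrite mulr_gt0//; qlra.
  have -> : e / 2 * (2 * (d - c + 1)) = e * (d - c) + e by field.
  by qlra.
have -> : P u s - P m s - (P v t - P m t) = (P u s - P v s) - (P v t - P m t - (P v s - P m s)) by ring.
apply: le_lt_trans (ler_normB _ _) _; qlra.
Qed.

(* The mean value theorem replaces differentiation under the integral sign. *)
Lemma primitive_dt (ft G : R -> R -> R) :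
  (forall u t, c <= u <= d -> `|t - s| < e0 -> isD (f u) t (ft u t)) ->
  (forall u, c <= u <= d -> isD (G ^~ s) u (ft u s)) ->
  (forall v, c <= v <= d -> cont2 ft v s) ->
  isD (fun t => P d t - P c t) s (G d s - G c s).
Proof.
move=> df dG cft; apply: isD_eps => e ep.
move: cd; rewrite le_eqVlt => /predU1P[->|cd'].
  by exists 1 => // y _; rewrite !subrr mul0r subr0 normr0 mulr_ge0// ltW.
pose k := e / (d - c).
have dc : 0 < d - c by qlra.
have k0 : 0 < k by rewrite divr_gt0.
have [del del0 Hdel] := tube cft k0.
exists (Num.min del e0); first by rewrite lt_min del0.
move=> t; rewrite lt_min => /andP[h1 h2].
have ss : `|s - s| < e0 by rewrite subrr normr0.
have fest w : c <= w <= d -> `|f w t - f w s - ft w s * (t - s)| <= k * `|t - s|.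
  move=> hw; have lem x y : x < y -> `|x - s| < e0 -> `|y - s| < e0 -> `|x - s| < del -> `|y - s| < del ->
      `|f w y - f w x - ft w s * (y - x)| <= k * `|y - x|.
    move=> xy hx hy hx' hy'; have [|z hz ->] := @mvt R x y (f w) (ft w) xy.
      by move=> z hz; apply: df => //; move: hx hy; rewrite !ltr_norml; qlra.
    rewrite -mulrBl normrM ler_wpM2r//; apply/ltW/Hdel => //.
    by move: hx' hy'; rewrite !ltr_norml; qlra.
  have [ts|st|->] := ltgtP t s.
  - have -> : f w t - f w s - ft w s * (t - s) = - (f w s - f w t - ft w s * (s - t)) by ring.
    by rewrite normrN [`|t - s|]distrC; apply: lem; rewrite // subrr normr0.
  - by apply: lem; rewrite // subrr normr0.
  - by rewrite !subrr mulr0 subr0 normr0 mulr0.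
have [|z hz] := @mvt R c d (fun w => P w t - P w s - G w s * (t - s))
    (fun w => f w t - f w s - ft w s * (t - s)) cd'.
  move=> w hw; have H := isD_sub (isD_sub (dP hw h2) (dP hw ss)) (isD_mul (dG w hw) (isD_cst (t - s) w)).
  by apply: (isD_eq H); ring.
have -> : P d t - P d s - G d s * (t - s) - (P c t - P c s - G c s * (t - s)) =
  P d t - P c t - (P d s - P c s) - (G d s - G c s) * (t - s) by ring.
move=> ->; rewrite normrM [`|d - c|]gtr0_norm//.
have := fest z ltac:(qlra); rewrite -(ler_pM2r dc) /k => /le_trans; apply.
by rewrite mulrAC divfK// gt_eqF.
Qed.

End Potential.
End Primitive.

(** * Growth of the potential along the ends *)

Section Growth.
Context {R : realType} {I : set R} {T1 : R} (F : flow I T1).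
Local Notation X := (j0 (fX F)). Local Notation Y := (j0 (fY F)).
Local Notation a := (j1 (fX F)). Local Notation b := (j1 (fY F)).
Local Notation a1 := (j2 (fX F)). Local Notation b1 := (j2 (fY F)).
Local Notation q := (speed2 F). Local Notation thu := (ang_u F).
Local Notation nu := (tdot F). Local Notation alp := (area_u F).

(** Up to constants, the arctangent of the slope in the frame of [(e1, e2)] is a tangent angle. Its
    values are bounded by [pi / 2], which controls the angle term along an end. *)
Lemma isD_slope e1 e2 u t : e1 ^+ 2 + e2 ^+ 2 = 1 -> I u -> 0 <= t < T1 -> e1 * a u t + e2 * b u t != 0 ->
  isD (fun w => atan ((e1 * b w t - e2 * a w t) / (e1 * a w t + e2 * b w t))) u (thu u t).
Proof.
move=> ee Iu ht x0; have da := j1_du (fX F) Iu ht; have db := j1_du (fY F) Iu ht.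
have H := isD_div (isD_sub (isD_mul (isD_cst e1 u) db) (isD_mul (isD_cst e2 u) da))
  (isD_add (isD_mul (isD_cst e1 u) da) (isD_mul (isD_cst e2 u) db)) x0.
apply: (isD_eq (isD_comp H (is_derive1_atan _))).
have q0 : q u t != 0 by rewrite gt_eqF// speed2_gt0//; qlra.
have qE : q u t = (e1 * a u t + e2 * b u t) ^+ 2 + (e1 * b u t - e2 * a u t) ^+ 2.
  exact: (unit_frame_norm _ _ ee).
rewrite /ang_u; rewrite qE in q0 *.
have -> : a u t * b1 u t - b u t * a1 u t = (e1 * a u t + e2 * b u t) * (e1 * b1 u t - e2 * a1 u t)
   - (e1 * b u t - e2 * a u t) * (e1 * a1 u t + e2 * b1 u t).
  by rewrite -[LHS]mul1r -ee; ring.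
move: (e1 * a u t + e2 * b u t) (e1 * b u t - e2 * a u t) x0 q0 => x y x0 q0.
have y0 : 1 + (y / x) ^+ 2 != 0 by rewrite gt_eqF// ltr_pwDl// sqr_ge0.
field.
by rewrite x0 q0.
Qed.

Variables (t0 : R) (P : R -> R -> R).
Hypothesis ht0 : 0 <= t0 < T1.
Hypothesis dP : forall u t, I u -> t < T1 -> isD (P ^~ t) u (alp u t).

(** With [x] along the ray and [h] across it, the area form is [x' h] minus the derivative of
    [x h / 2]. Since [h] is bounded and the angle varies by at most [pi], the potential grows at
    most linearly in [x], hence more slowly than any multiple of [|gamma|^2]. *)
Lemma end_growth ub e1 e2 : radial_end F ub e1 e2 -> exists2 uc, I uc &
  forall del : R, 0 < del -> exists K : R, forall u t : R, I u -> uc <= u -> 0 <= t <= t0 ->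
    `|P u t - P uc t| <= K + del * (X u t ^+ 2 + Y u t ^+ 2).
Proof.
have ht0' := ht0.
move=> rE; have [Iub ee _ _] := rE.
have [C C0 HC] := radial_end_bounds rE ht0.
have [|uc [Iuc ubuc Huc]] := radial_end_tangent rE ht0 0 (eps := 2^-1); first qlra.
exists uc => // del del0.
have [|||B HB] := @box_bounded R uc uc t0 (fun u t => e1 * X u t + e2 * Y u t).
- exact: lexx.
- qlra.
- move=> u t hu ht; have -> : u = uc by apply/eqP; rewrite eq_le andbC.
  by apply: lin_c => //; qlra.
(* [C x] bounds the growth of [Phi] below, and [C x / 2] the term [x h / 2]. *)
pose k := 3 / 2 * C.
exists (k ^+ 2 / (4 * del) + (2^-1 * C * B + t0 * pi)) => u t Iu ucu ht.
have tT : t < T1 by qlra. have ht' : 0 <= t < T1 by qlra.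
pose x w := e1 * X w t + e2 * Y w t.
pose h w := e1 * Y w t - e2 * X w t.
pose ps w := atan ((e1 * b w t - e2 * a w t) / (e1 * a w t + e2 * b w t)).
pose Phi w := P w t + 2^-1 * (x w * h w) + t * ps w.
have Iw w : uc <= w <= u -> I w by move=> hw; exact: (f_itv F Iuc Iu hw).
have xu0 w : uc <= w <= u -> 0 < e1 * a w t + e2 * b w t.
  move=> hw; have [_ n0] := Huc w t (Iw _ hw) ltac:(qlra) ht.
  rewrite tdot_speed//; last exact: Iw.
  by apply: mulr_gt0; [rewrite sqrtr_gt0 speed2_gt0//; exact: Iw|qlra].
have dx w : uc <= w <= u -> isD x w (e1 * a w t + e2 * b w t).
  move=> hw; apply: (isD_eq (isD_add (isD_mul (isD_cst e1 w) (j0_du (fX F) (Iw w hw) ht'))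
    (isD_mul (isD_cst e2 w) (j0_du (fY F) (Iw w hw) ht')))); ring.
have dh w : uc <= w <= u -> isD h w (e1 * b w t - e2 * a w t).
  move=> hw; apply: (isD_eq (isD_sub (isD_mul (isD_cst e1 w) (j0_du (fY F) (Iw w hw) ht'))
    (isD_mul (isD_cst e2 w) (j0_du (fX F) (Iw w hw) ht')))); ring.
have dPhi w : uc <= w <= u -> isD Phi w ((e1 * a w t + e2 * b w t) * h w).
  move=> hw; have x0 : e1 * a w t + e2 * b w t != 0 by rewrite gt_eqF// xu0.
  have H := isD_add (isD_add (dP (Iw w hw) tT) (isD_mul (isD_cst 2^-1 w) (isD_mul (dx w hw) (dh w hw))))
    (isD_mul (isD_cst t w) (isD_slope ee (Iw w hw) ht' x0)).
  apply: (isD_eq H); rewrite /area_u.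
  have -> : a w t * Y w t - b w t * X w t = (e1 * a w t + e2 * b w t) * h w
     - (e1 * b w t - e2 * a w t) * x w by rewrite -[LHS]mul1r -ee /h /x; ring.
  by field.
have hb w : uc <= w <= u -> `|h w| <= C.
  by move=> hw; have [] := HC w t (Iw w hw) ltac:(qlra) ht.
have m1 : C * x uc - Phi uc <= C * x u - Phi u.
  apply: (isD_nondecr (f := fun w => C * x w - Phi w)
    (f' := fun w => C * (e1 * a w t + e2 * b w t) - (e1 * a w t + e2 * b w t) * h w) ucu) => w hw.
    by apply: (isD_eq (isD_sub (isD_mul (isD_cst C w) (dx w hw)) (dPhi w hw))); ring.
  have -> : C * (e1 * a w t + e2 * b w t) - (e1 * a w t + e2 * b w t) * h w =
    (e1 * a w t + e2 * b w t) * (C - h w) by ring.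
  by apply: mulr_ge0; [exact/ltW/xu0|have := hb w hw; rewrite ler_norml; qlra].
have m2 : C * x uc + Phi uc <= C * x u + Phi u.
  apply: (isD_nondecr (f := fun w => C * x w + Phi w)
    (f' := fun w => C * (e1 * a w t + e2 * b w t) + (e1 * a w t + e2 * b w t) * h w) ucu) => w hw.
    by apply: (isD_eq (isD_add (isD_mul (isD_cst C w) (dx w hw)) (dPhi w hw))); ring.
  have -> : C * (e1 * a w t + e2 * b w t) + (e1 * a w t + e2 * b w t) * h w =
    (e1 * a w t + e2 * b w t) * (C + h w) by ring.
  by apply: mulr_ge0; [exact/ltW/xu0|have := hb w hw; rewrite ler_norml; qlra].
have xpos w : uc <= w <= u -> 0 < x w by move=> hw; have [] := Huc w t (Iw w hw) ltac:(qlra) ht.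
have xh w : uc <= w <= u -> `|x w * h w| <= C * x w.
  move=> hw; have x0 := xpos w hw; rewrite normrM mulrC (gtr0_norm x0).
  by apply: ler_wpM2r; [exact: ltW|exact: hb].
have hu : uc <= u <= u by qlra. have huc : uc <= uc <= u by qlra.
have := xh u hu; have := xh uc huc; rewrite !ler_norml => xh1 xh2.
have x1 := xpos u hu; have x2 := xpos uc huc.
have x3 : C * x uc <= C * B by apply: ler_wpM2l => //; apply: HB; qlra.
have x4 : 0 <= C * x uc by apply: mulr_ge0 => //; exact: ltW.
have psb w : - (pi / 2) <= ps w <= pi / 2 by rewrite !ltW ?atan_ltpi2 ?atan_gtNpi2.
have psd : t * ps u - t * ps uc <= t0 * pi /\ - (t0 * pi) <= t * ps u - t * ps uc.
  have := psb u; have := psb uc => p1 p2; have pi0 := pi_ge0 R.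
  have q1 : t * pi <= t0 * pi by apply: ler_wpM2r => //; case/andP: ht.
  have t00 : 0 <= t by case/andP: ht.
  have q2 : t * (ps u - ps uc) <= t * pi by apply: ler_wpM2l => //; clear -p1 p2; qlra.
  have q3 : t * (ps uc - ps u) <= t * pi by apply: ler_wpM2l => //; clear -p1 p2; qlra.
  by clear -q1 q2 q3; split; qlra.
have amgm : k * x u <= k ^+ 2 / (4 * del) + del * x u ^+ 2.
  have := sqr_ge0 (x u - k / (2 * del)); rewrite -(pmulr_rge0 _ del0).
  have -> : del * (x u - k / (2 * del)) ^+ 2 = k ^+ 2 / (4 * del) + del * x u ^+ 2 - k * x u.
    by field; rewrite gt_eqF.
  by rewrite subr_ge0.
have r2 : del * x u ^+ 2 <= del * (X u t ^+ 2 + Y u t ^+ 2).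
  by rewrite ler_pM2l// (unit_frame_norm _ _ ee) lerDl sqr_ge0.
have kx : k * x u = 3 / 2 * C * x u by [].
clear -m1 m2 xh1 xh2 x1 x2 x3 x4 psd amgm r2 kx; rewrite /Phi in m1 m2; clearbody k x h ps.
qlra.
Qed.

End Growth.

Section AreaBound.
Context {R : realType} {I : set R} {T1 : R} (F : flow I T1).
Local Notation X := (j0 (fX F)). Local Notation Y := (j0 (fY F)).
Local Notation a := (j1 (fX F)). Local Notation b := (j1 (fY F)).
Local Notation a1 := (j2 (fX F)). Local Notation b1 := (j2 (fY F)).
Local Notation Xt := (jt (fX F)). Local Notation Yt := (jt (fY F)).
Local Notation q := (speed2 F).
Local Notation alp := (area_u F).
Variables (t0 : R) (P : R -> R -> R) (ub e1 e2 ub' e1' e2' : R).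
Hypothesis ht0 : 0 <= t0 < T1.
Hypothesis dP : forall u t, I u -> t < T1 -> isD (P ^~ t) u (alp u t).
Hypothesis rR : radial_end F ub e1 e2.
Hypothesis rL : radial_end (flow_rev F) ub' e1' e2'.

Lemma area_u_c u t : I u -> t < T1 -> cont2 alp u t.
Proof.
move=> Iu tT; have qn : q u t != 0 by rewrite gt_eqF// speed2_gt0.
have cX := j0_c (j := fX F) Iu tT; have cY := j0_c (j := fY F) Iu tT.
have ca := j1_c (j := fX F) Iu tT; have cb := j1_c (j := fY F) Iu tT.
have ca1 := j2_c (j := fX F) Iu tT; have cb1 := j2_c (j := fY F) Iu tT.
have cq : cont2 q u t by apply: cont2D; apply: cont2M.
have cth : cont2 (ang_u F) u t by apply: cont2M; [apply: cont2B; apply: cont2M|apply: cont2V].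
apply: cont2B; last by apply: cont2M => //; exact: cont2t.
by apply: cont2M; [exact: cont2C|apply: cont2B; apply: cont2M].
Qed.

Lemma potential_c m u t : I m -> I u -> t < T1 -> cont2 (fun v t => P v t - P m t) u t.
Proof.
move=> Im Iu tT.
have [Imin Imax] : I (Num.min u m) /\ I (Num.max u m) by case: (leP u m).
have [d1 d10 H1] := f_open F Imin; have [d2 d20 H2] := f_open F Imax.
have [au am ub_ mb] : [/\ Num.min u m <= u, Num.min u m <= m, u <= Num.max u m & m <= Num.max u m].
  by split; rewrite ?ge_min ?le_max lexx ?orbT.
have Ic : I (Num.min u m - d1 / 2) by apply: H1; qlra.
have Id : I (Num.max u m + d2 / 2) by apply: H2; qlra.
have Iv v : Num.min u m - d1 / 2 <= v <= Num.max u m + d2 / 2 -> I v by exact: (f_itv F Ic Id).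
apply: (@primitive_cont R (Num.min u m - d1 / 2) (Num.max u m + d2 / 2) t (T1 - t) alp P) => //; try qlra.
- by move=> v s hv; rewrite ltr_norml => hs; apply: dP; [exact: Iv|qlra].
- by move=> v hv; apply: area_u_c => //; exact: Iv.
Qed.

(** [end_growth] covers the two ends, and the part between them is a compact box on which the
    differences are continuous. *)
Lemma potential_growth : exists2 m, I m &
  forall del : R, 0 < del -> exists K : R, forall u t : R, I u -> 0 <= t <= t0 ->
    `|P u t - P m t| <= K + del * (X u t ^+ 2 + Y u t ^+ 2).
Proof.
have ht0' := ht0.
have [m Im HR] := end_growth ht0 dP rR.
have dP' u t : I (- u) -> t < T1 -> isD (fun u => P (- u) t) u (area_u (flow_rev F) u t).
  move=> Iu tT; apply: (isD_eq (isD_rev (dP Iu tT))).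
  by rewrite /area_u /ang_u /speed2 /= !sqrrN; ring.
have [m' Im' HL] := @end_growth R _ T1 (flow_rev F) t0 (fun u t => P (- u) t) ht0 dP' ub' e1' e2' rL.
pose c := Num.min (- m') m. pose d := Num.max (- m') m.
have [Ic Id] : I c /\ I d by rewrite /c /d; case: (leP (- m') m).
have [cm' cm m'd md] : [/\ c <= - m', c <= m, - m' <= d & m <= d].
  by split; rewrite ?ge_min ?le_max lexx ?orbT.
have cb v t : c <= v <= d -> 0 <= t <= t0 -> cont2 (fun v t => P v t - P m t) v t.
  by move=> hv ht; apply: potential_c => //; [exact: (f_itv F Ic Id)|qlra].
have [|||B1 HB1] := @box_bounded R c d t0 (fun v t => P v t - P m t); [qlra|qlra|exact: cb|].
have [|||B2 HB2] := @box_bounded R c d t0 (fun v t => - (P v t - P m t)).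
- qlra.
- qlra.
- by move=> v t hv ht; apply: cont2N; exact: cb.
exists m => // del del0.
have [KR HKR] := HR del del0; have [KL HKL] := HL del del0.
exists (`|KR| + `|KL| + `|B1| + `|B2|) => u t Iu ht.
have r0 : 0 <= del * (X u t ^+ 2 + Y u t ^+ 2).
  by apply: mulr_ge0; [exact: ltW|apply: addr_ge0; exact: sqr_ge0].
have [n1 n2 n3 n4] : [/\ KR <= `|KR|, KL <= `|KL|, B1 <= `|B1| & B2 <= `|B2|] by split; exact: ler_norm.
have [p1 p2 p3 p4] : [/\ 0 <= `|KR|, 0 <= `|KL|, 0 <= `|B1| & 0 <= `|B2|] by [].
rewrite ler_norml.
have [mu|um] := leP m u.
  by have := HKR u t Iu mu ht; rewrite ler_norml; qlra.
have [um'|m'u] := leP u (- m').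
  have := HKL (- u) t; rewrite /= !opprK => /(_ Iu ltac:(qlra) ht); rewrite ler_norml.
  by have := HB1 (- m') t ltac:(qlra) ht; have := HB2 (- m') t ltac:(qlra) ht; qlra.
by have := HB1 u t ltac:(qlra) ht; have := HB2 u t ltac:(qlra) ht; qlra.
Qed.

End AreaBound.

(** * The two-point maximum principle *)

Section AreaBound.
Context {R : realType} {I : set R} {T1 : R} (F : flow I T1).
Local Notation X := (j0 (fX F)). Local Notation Y := (j0 (fY F)).
Local Notation a := (j1 (fX F)). Local Notation b := (j1 (fY F)).
Local Notation a1 := (j2 (fX F)). Local Notation b1 := (j2 (fY F)).
Local Notation Xt := (jt (fX F)). Local Notation Yt := (jt (fY F)).
Local Notation q := (speed2 F).
Local Notation alp := (area_u F).
Variables (t0 : R) (P : R -> R -> R) (ub e1 e2 ub' e1' e2' : R).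
Hypothesis ht0 : 0 <= t0 < T1.
Hypothesis dP : forall u t, I u -> t < T1 -> isD (P ^~ t) u (alp u t).
Hypothesis rR : radial_end F ub e1 e2.
Hypothesis rL : radial_end (flow_rev F) ub' e1' e2'.

Lemma area_ut_c u t : I u -> 0 < t < T1 -> cont2 (area_ut F) u t.
Proof.
move=> Iu tT; have tT' : t < T1 by qlra.
have qn : q u t != 0 by rewrite gt_eqF// speed2_gt0.
have cX := j0_c (j := fX F) Iu tT'; have cY := j0_c (j := fY F) Iu tT'.
have ca := j1_c (j := fX F) Iu tT'; have cb := j1_c (j := fY F) Iu tT'.
have ca1 := j2_c (j := fX F) Iu tT'; have cb1 := j2_c (j := fY F) Iu tT'.
have cXt := jt_c (j := fX F) Iu tT; have cYt := jt_c (j := fY F) Iu tT.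
have cat := j1t_c (j := fX F) Iu tT; have cbt := j1t_c (j := fY F) Iu tT.
have ca1t := j2t_c (j := fX F) Iu tT; have cb1t := j2t_c (j := fY F) Iu tT.
have cq : cont2 q u t by apply: cont2D; apply: cont2M.
have cqi : cont2 (fun u t => (q u t)^-1) u t by apply: cont2V.
have cth : cont2 (ang_u F) u t by apply: cont2M => //; apply: cont2B; apply: cont2M.
apply: cont2B; last first.
  apply: cont2M; first exact: cont2t.
  apply: cont2B.
    apply: cont2M => //; apply: cont2B; last exact: cont2M.
    apply: cont2B; last exact: cont2M.
    by apply: cont2D; apply: cont2M.
  apply: cont2M => //; apply: cont2M => //; apply: cont2M; first exact: cont2C.
  by apply: cont2D; apply: cont2M.
apply: cont2B => //; apply: cont2M; first exact: cont2C.
apply: cont2B; last exact: cont2M.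
apply: cont2B; last exact: cont2M.
by apply: cont2D; apply: cont2M.
Qed.

Lemma isD_area_t u v t : I u -> I v -> 0 < t < T1 ->
  isD (fun t => P v t - P u t) t (area_t F v t - area_t F u t).
Proof.
move=> Iu Iv ht.
have lem c d : c <= d -> I c -> I d -> isD (fun t => P d t - P c t) t (area_t F d t - area_t F c t).
  move=> cd Ic Id; have Iw w : c <= w <= d -> I w by exact: (f_itv F Ic Id).
  apply: (@primitive_dt R c d t (Num.min t (T1 - t)) alp P cd _ _ (area_ut F) (area_t F)).
  - by rewrite lt_min; qlra.
  - move=> w s hw; rewrite lt_min !ltr_norml => hs; apply: dP; [exact: Iw|qlra].
  - move=> w s hw; rewrite lt_min !ltr_norml => hs; apply: isD_area_u_t; [exact: Iw|qlra].
  - by move=> w hw; apply: isD_area_t_u => //; exact: Iw.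
  - by move=> w hw; apply: area_ut_c => //; exact: Iw.
have [uv|vu] := leP u v; first exact: lem.
apply: (isD_ext (f := fun t => - (P u t - P v t))); first by move=> s; rewrite opprB.
by apply: (isD_eq (isD_opp (lem v u (ltW vu) Iv Iu))); rewrite opprB.
Qed.

Local Notation r2 := (fun u t => X u t * X u t + Y u t * Y u t).

Lemma cont_fst2 (f : R -> R -> R) (u v t : R) : cont2 f u t ->
  {for ((u, v), t), continuous (fun p : (R * R) * R => f p.1.1 p.2)}.
Proof.
move=> cf; have cp : {for ((u, v), t), continuous (fun p : (R * R) * R => (p.1.1, p.2))}.
  apply: cont_pair; last exact: cvg_snd.
  by apply: (@cont_fst _ _ _ (fun p : R * R => p.1)); exact: cvg_fst.
exact: (@continuous_comp _ _ _ _ (fun p : R * R => f p.1 p.2) _ cp cf).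
Qed.

Lemma cont_snd2 (f : R -> R -> R) (u v t : R) : cont2 f v t ->
  {for ((u, v), t), continuous (fun p : (R * R) * R => f p.1.2 p.2)}.
Proof.
move=> cf; have cp : {for ((u, v), t), continuous (fun p : (R * R) * R => (p.1.2, p.2))}.
  apply: cont_pair; last exact: cvg_snd.
  by apply: (@cont_fst _ _ _ (fun p : R * R => p.2)); exact: cvg_snd.
exact: (@continuous_comp _ _ _ _ (fun p : R * R => f p.1 p.2) _ cp cf).
Qed.

(** At each time [J] is a sum of a function of [u] and one of [v], so the conditions at a touching
    point can be used in each variable separately. The time derivative of the potential difference
    is a difference of fluxes, and [area_t_heat] expresses these through the derivatives that the
    conditions control. *)
Lemma area_bound D : (forall u v, I u -> I v -> P v 0 - P u 0 <= D) ->
  forall u v t, I u -> I v -> 0 <= t <= t0 -> P v t - P u t <= D.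
Proof.
move=> init u v t Iu Iv ht; have ht0' := ht0.
have t0T : t0 < T1 by qlra.
apply/ler_addgt0Pr => e e0.
have r20 w s : 0 <= X w s * X w s + Y w s * Y w s by rewrite addr_ge0// -expr2 sqr_ge0.
(* Each [|gamma|^2] has source [- 2], and the coefficient [5] leaves a surplus of [1] over both. *)
pose M := 1 + (r2 u t + r2 v t) + 5 * t.
have M0 : 0 < M by rewrite /M; have := r20 u t; have := r20 v t; qlra.
pose dl := e / M.
have dl0 : 0 < dl by rewrite divr_gt0.
pose J (p : (R * R) * R) := D + dl * (1 + (r2 p.1.1 p.2 + r2 p.1.2 p.2) + 5 * p.2) - (P p.1.2 p.2 - P
  p.1.1 p.2).
suff H : 0 < J ((u, v), t).
  move: H; rewrite /J /= -/M (_ : dl * M = e); first by qlra.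
  by rewrite /dl divfK// gt_eqF.
have [m Im gr] := potential_growth ht0 dP rR rL.
have [K0 HK0] := gr (dl / 2) ltac:(qlra).
(* The growth bound with [dl / 2] uses up half of the barrier; the other half limits [|gamma|^2] at
   both points where [J <= 0]. *)
pose B := 2 * (2 * K0 - D) / dl.
have [c [d [Ic Id cd Hcd]]] := f_proper F B t0T.
pose K : set ((R * R) * R) := (`[c, d] `*` `[c, d]) `*` `[0, t0].
pose Dom : set (R * R) := [set p | I p.1 /\ I p.2].
have Iw w : c <= w <= d -> I w by exact: (f_itv F Ic Id).
have [|||||H|[[u1 v1] [s1 [[/= Iu1 Iv1] hs1 J1 Jt1 Ju1]]]] :=
  @first_touching R _ Dom K t0 J.
- by apply: compact_setX; [apply: compact_setX|]; exact: segment_compact.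
- move=> [[x y] s] [[/=]]; rewrite !in_itv/= => h1 h2 h3; split => //.
  by split; exact: Iw.
- move=> [[x y] s] [[/=]]; rewrite !in_itv/= => h1 h2 h3.
  have sT : s < T1 by qlra.
  have cX := j0_c (j := fX F) (Iw _ h1) sT; have cY := j0_c (j := fY F) (Iw _ h1) sT.
  have cX' := j0_c (j := fX F) (Iw _ h2) sT; have cY' := j0_c (j := fY F) (Iw _ h2) sT.
  have cr : {for ((x, y), s), continuous (fun p : (R * R) * R => r2 p.1.1 p.2)}.
    by apply: (@cont_fst2 r2); apply: cont2D; apply: cont2M.
  have cr' : {for ((x, y), s), continuous (fun p : (R * R) * R => r2 p.1.2 p.2)}.
    by apply: (@cont_snd2 r2); apply: cont2D; apply: cont2M.
  have cp := @cont_fst2 _ x y s (potential_c dP Im (Iw _ h1) sT).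
  have cp' := @cont_snd2 _ x y s (potential_c dP Im (Iw _ h2) sT).
  (* Subtracting the value at [m] makes each of the two potentials continuous in time. *)
  have -> : J = fun p => D + dl * (1 + (r2 p.1.1 p.2 + r2 p.1.2 p.2) + 5 * p.2)
      - ((P p.1.2 p.2 - P m p.2) - (P p.1.1 p.2 - P m p.2)).
    by apply/funext => p; rewrite /J; ring.
  apply: cvgB; last exact: cvgB.
  apply: cvgD; first exact: cvg_cst.
  apply: cvgM; first exact: cvg_cst.
  apply: cvgD; last by apply: cvgM; [exact: cvg_cst|exact: cvg_snd].
  apply: cvgD; first exact: cvg_cst.
  exact: cvgD.
- move=> [x y] s [/= Ix Iy] hs; rewrite /J /= => Jle.
  have g1 := HK0 x s Ix hs; have g2 := HK0 y s Iy hs.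
  rewrite !ler_norml in g1 g2.
  have q1 := r20 x s; have q2 := r20 y s.
  have sum : dl * (r2 x s + r2 y s) <= dl * B.
    rewrite /B mulrC [dl * _]mulrC divfK ?gt_eqF//.
    have : 0 <= dl * s by apply: mulr_ge0; [exact: ltW|qlra].
    by clear -g1 g2 Jle dl0; rewrite !expr2 in g1 g2; qlra.
  rewrite ler_pM2l// in sum.
  split => //; split; rewrite /= in_itv/=; apply: (Hcd _ s) => //; rewrite !expr2; qlra.
- move=> [x y] [/= Ix Iy]; rewrite /J /= mulr0 addr0.
  have : 0 < dl * (1 + (r2 x 0 + r2 y 0)) by apply: mulr_gt0 => //; have := r20 x 0; have := r20 y 0; qlra.
  by have := init x y Ix Iy; qlra.
- by apply: H.
have hs' : 0 < s1 < T1 by qlra. have hs'' : 0 <= s1 < T1 by qlra.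
have [tu [hXu hYu htu]] := csf_heat F Iu1 hs'.
have [tv [hXv hYv htv]] := csf_heat F Iv1 hs'.
have qu0 : 0 < q u1 s1 by apply: speed2_gt0 => //; qlra.
have qv0 : 0 < q v1 s1 by apply: speed2_gt0 => //; qlra.
have Gu := area_t_heat Iu1 hs' hXu hYu htu.
have Gv := area_t_heat Iv1 hs' hXv hYv htv.
have dr w : I w -> isD (r2 ^~ s1) w (2 * (X w s1 * a w s1 + Y w s1 * b w s1)).
  move=> Iw1; have dX := j0_du (fX F) Iw1 hs''; have dY := j0_du (fY F) Iw1 hs''.
  by apply: (isD_eq (isD_add (isD_mul dX dX) (isD_mul dY dY))); ring.
have dr' w : I w -> isD (fun w => 2 * (X w s1 * a w s1 + Y w s1 * b w s1)) w
    (2 * (a w s1 * a w s1 + X w s1 * a1 w s1 + (b w s1 * b w s1 + Y w s1 * b1 w s1))).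
  move=> Iw1; have dX := j0_du (fX F) Iw1 hs''; have dY := j0_du (fY F) Iw1 hs''.
  have da := j1_du (fX F) Iw1 hs''; have db := j1_du (fY F) Iw1 hs''.
  by apply: (isD_eq (isD_mul (isD_cst 2 w) (isD_add (isD_mul dX da) (isD_mul dY db)))); ring.
have drt w : I w -> isD (r2 w) s1 (2 * (X w s1 * Xt w s1 + Y w s1 * Yt w s1)).
  move=> Iw1; have dX := j0_dt (fX F) Iw1 hs'; have dY := j0_dt (fY F) Iw1 hs'.
  by apply: (isD_eq (isD_add (isD_mul dX dX) (isD_mul dY dY))); ring.
have s1T : s1 < T1 by qlra.
pose ru w := 2 * (X w s1 * a w s1 + Y w s1 * b w s1).
pose ruu w := 2 * (a w s1 * a w s1 + X w s1 * a1 w s1 + (b w s1 * b w s1 + Y w s1 * b1 w s1)).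
have [eu eu0 Heu] := f_open F Iu1. have [ev ev0 Hev] := f_open F Iv1.
have [|||Ju0 Juu0] := @second_derivative_min _ (fun w => J ((w, v1), s1))
    (fun w => dl * ru w + alp w s1) (dl * ruu u1 + area_uu F u1 s1) u1 eu eu0.
- move=> w hw; have Iw1 := Heu w hw.
  have H := isD_sub (isD_add (isD_cst D w) (isD_mul (isD_cst dl w) (isD_add (isD_add (isD_cst 1 w)
    (isD_add (dr w Iw1) (isD_cst (r2 v1 s1) w))) (isD_cst (5 * s1) w))))
    (isD_sub (isD_cst (P v1 s1) w) (dP Iw1 s1T)).
  by apply: (isD_eq H); rewrite /ru; ring.
- have H := isD_add (isD_mul (isD_cst dl u1) (dr' u1 Iu1)) (isD_area_u_u F Iu1 hs').
  by apply: (isD_eq H); rewrite /ruu; ring.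
- by move=> w hw; rewrite J1; apply: (Ju1 (w, v1)); split => //=; exact: Heu.
have [|||Jv0 Jvv0] := @second_derivative_min _ (fun w => J ((u1, w), s1))
    (fun w => dl * ru w - alp w s1) (dl * ruu v1 - area_uu F v1 s1) v1 ev ev0.
- move=> w hw; have Iw1 := Hev w hw.
  have H := isD_sub (isD_add (isD_cst D w) (isD_mul (isD_cst dl w) (isD_add (isD_add (isD_cst 1 w)
    (isD_add (isD_cst (r2 u1 s1) w) (dr w Iw1))) (isD_cst (5 * s1) w))))
    (isD_sub (dP Iw1 s1T) (isD_cst (P u1 s1) w)).
  by apply: (isD_eq H); rewrite /ru; ring.
- have H := isD_sub (isD_mul (isD_cst dl v1) (dr' v1 Iv1)) (isD_area_u_u F Iv1 hs').
  by apply: (isD_eq H); rewrite /ruu; ring.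
- by move=> w hw; rewrite J1; apply: (Ju1 (u1, w)); split => //=; exact: Hev.
pose rt w := 2 * (X w s1 * Xt w s1 + Y w s1 * Yt w s1).
have Jt0 : dl * (rt u1 + rt v1 + 5) - (area_t F v1 s1 - area_t F u1 s1) <= 0.
  have dJt : isD (fun s => J ((u1, v1), s)) s1 (dl * (rt u1 + rt v1 + 5) - (area_t F v1 s1 - area_t F u1 s1)).
    have H := isD_sub (isD_add (isD_cst D s1) (isD_mul (isD_cst dl s1) (isD_add (isD_add (isD_cst 1 s1)
      (isD_add (drt u1 Iu1) (drt v1 Iv1))) (isD_mul (isD_cst 5 s1) (isD_id s1)))))
      (isD_area_t Iu1 Iv1 hs').
    by apply: (isD_eq H); rewrite /rt; ring.
  apply: (isD_min_left (a := 0) dJt); first qlra.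
  move=> y hy; rewrite J1.
  have [->|ys] := eqVneq y s1; first by rewrite J1.
  by apply/ltW/Jt1; move: ys; rewrite neq_lt; qlra.
have E w tw : 0 < q w s1 -> Xt w s1 = a1 w s1 / q w s1 + tw * a w s1 ->
   Yt w s1 = b1 w s1 / q w s1 + tw * b w s1 -> rt w = ruu w / q w s1 + tw * ru w - 2.
  move=> q0 hX hY; rewrite /rt /ruu /ru hX hY; have : q w s1 != 0 by rewrite gt_eqF.
  by rewrite /speed2 => qn; field.
have hu : 0 <= (dl * ruu u1 + area_uu F u1 s1) / q u1 s1 by apply: divr_ge0 => //; exact: ltW.
have hv : 0 <= (dl * ruu v1 - area_uu F v1 s1) / q v1 s1 by apply: divr_ge0 => //; exact: ltW.
have hu' : tu * (dl * ru u1 + alp u1 s1) = 0 by rewrite Ju0 mulr0.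
have hv' : tv * (dl * ru v1 - alp v1 s1) = 0 by rewrite Jv0 mulr0.
rewrite (E u1 tu)// (E v1 tv)// Gu Gv in Jt0.
by exfalso; clear -hu hv hu' hv' Jt0 dl0; qlra.
Qed.

End AreaBound.

(** * The cone estimate on a time slice *)

Section Angles.
Context {R : realType}.

Lemma cos_norm (x : R) : cos `|x| = cos x.
Proof. by have [x0|x0] := ger0P x; rewrite ?cosN. Qed.

Lemma cos_ge_norm (x w : R) : 0 <= w <= pi -> `|x| <= pi -> cos w <= cos x -> `|x| <= w.
Proof.
move=> hw hx; rewrite leNgt; apply: contraLR; rewrite negbK -ltNge => wx.
by rewrite -(cos_norm x) ltr_cos// in_itv/= ?normr_ge0.
Qed.

Lemma unit_angle (x y w : R) : x ^+ 2 + y ^+ 2 = 1 -> 0 <= w <= pi -> cos w <= x ->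
  exists2 th, `|th| <= w & x = cos th /\ y = sin th.
Proof.
move=> xy hw wx; have x1 : -1 <= x <= 1.
  have := sqr_ge0 y; rewrite -ler_norml => y0; rewrite -(ler_pXn2r (n := 2))// ?nnegrE// real_normK
    ?num_real// expr1n; qlra.
have ca : cos (acos x) = x by rewrite acosK// in_itv.
have sa : sin (acos x) = Num.sqrt (y ^+ 2).
  by rewrite sin_acos//; congr (Num.sqrt _); qlra.
have a0 : 0 <= acos x by exact: acos_ge0.
have api : acos x <= pi by exact: acos_lepi.
have aw : `|acos x| <= w by apply: cos_ge_norm; rewrite ?ca// ger0_norm.
rewrite sqrtr_sqr in sa.
have [y0|y0] := ger0P y.
  by exists (acos x) => //; rewrite ca sa ger0_norm.
by exists (- acos x); rewrite ?normrN// cosN sinN ca sa ltr0_norm// opprK.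
Qed.

(** [z1] and [z2] are components in the frame of a direction inclined by [phi]. A vector within
    [eps] of that direction is within [phi + eps] of the horizontal; the absolute value covers
    inclinations of either sign. *)
Lemma cone (phi eps z1 z2 : R) : 0 <= phi -> 0 < eps -> phi + eps < pi / 2 ->
  `|z2| * cos eps <= z1 * sin eps -> 0 <= z1 ->
  cos (phi + eps) * Num.sqrt (z1 ^+ 2 + z2 ^+ 2) <= z1 * cos phi - `|z2| * sin phi.
Proof.
move=> p0 e0 pe h z10; have pi0 := pi_gt0 R.
have ce : 0 < cos eps by apply: cos_gt0_pihalf; qlra.
have cpe : 0 < cos (phi + eps) by apply: cos_gt0_pihalf; qlra.
have sp : 0 <= sin phi by apply: sin_ge0_pi; qlra.
have se : 0 <= sin eps by apply: sin_ge0_pi; qlra.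
have r0 : Num.sqrt (z1 ^+ 2 + z2 ^+ 2) * cos eps <= z1.
  rewrite -[leRHS](ger0_norm z10) -sqrtr_sqr -[cos eps](ger0_norm (ltW ce)) -sqrtr_sqr -sqrtrM
    ?addr_ge0 ?sqr_ge0//.
  apply: ler_wsqrtr.
  have : (`|z2| * cos eps) ^+ 2 <= (z1 * sin eps) ^+ 2.
    by rewrite ler_pXn2r ?nnegrE// mulr_ge0// ltW.
  rewrite !exprMn real_normK ?num_real//; have := cos2Dsin2 eps => cs.
  have -> : sin eps ^+ 2 = 1 - cos eps ^+ 2 by qlra.
  by qlra.
rewrite -(ler_pM2r ce); apply: (@le_trans _ _ (z1 * cos (phi + eps))).
  by rewrite -mulrA mulrC ler_pM2r.
rewrite cosD.
have : `|z2| * cos eps * sin phi <= z1 * sin eps * sin phi by apply: ler_wpM2r.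
qlra.
Qed.

End Angles.

Section ArcUpper.
Context {R : realType} (D t eta eps : R).

Lemma arc_crit a b (G : arc D t eta eps a b) u : a < u < b ->
  (forall v, a <= v <= b -> aA G v <= aA G u) ->
  exists r, aX G u = r * cos (ath G u) /\ aY G u = r * sin (ath G u).
Proof.
move=> hu umax; have hu' : a <= u <= b by qlra.
have dA := a_dA G hu'.
have A0 : 2^-1 * (aX' G u * aY G u - aY' G u * aX G u) = 0.
  have dN := isD_opp dA.
  have h1 : - (2^-1 * (aX' G u * aY G u - aY' G u * aX G u)) <= 0.
    by apply: (isD_min_left (a := a) dN) => [|y hy]; [qlra|rewrite lerN2; apply: umax; qlra].
  have h2 : 0 <= - (2^-1 * (aX' G u * aY G u - aY' G u * aX G u)).
    by apply: (isD_min_right (b := b) dN) => [|y hy]; [qlra|rewrite lerN2; apply: umax; qlra].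
  by qlra.
have m0 := a_m G hu'.
rewrite (a_X' G hu') (a_Y' G hu') in A0.
set c := ath G u in A0 *; have cs := cos2Dsin2 c.
have w0 : cos c * aY G u - sin c * aX G u = 0.
  have : am G u * (cos c * aY G u - sin c * aX G u) = 0 by qlra.
  by move/eqP; rewrite mulf_eq0 gt_eqF//= => /eqP.
exists (cos c * aX G u + sin c * aY G u); split.
  rewrite -[LHS]mulr1 -cs.
  have -> : aX G u * (cos c ^+ 2 + sin c ^+ 2) = (cos c * aX G u + sin c * aY G u) * cos c
     - sin c * (cos c * aY G u - sin c * aX G u) by ring.
  by rewrite w0 mulr0 subr0.
rewrite -[LHS]mulr1 -cs.
have -> : aY G u * (cos c ^+ 2 + sin c ^+ 2) = (cos c * aX G u + sin c * aY G u) * sin c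
   + cos c * (cos c * aY G u - sin c * aX G u) by ring.
by rewrite w0 mulr0 addr0.
Qed.

(* At a maximum of [A] the position is parallel to the tangent; the direction decides which of the
   two long chords contradicts [rising]. *)
Lemma arc_upper a b (G : arc D t eta eps a b) uL uR w : 0 < t -> 0 < eta -> 0 < eps ->
  D + t * eta < t * (pi / 2) -> a < uL -> uL <= uR -> uR < b ->
  (forall v, a <= v <= uL -> ath G v <= w) -> (forall v, uR <= v <= b -> ath G v <= w) ->
  (forall v, uL <= v <= uR -> aTh G v b <= w /\ aTh G a v <= w) ->
  forall u, a <= u <= b -> ath G u <= w + D / t.
Proof.
move=> t0 eta0 eps0 Dt auL uLR uRb HL HR Hch u0 hu0; rewrite leNgt; apply/negP => hth.
have ab : a <= b by qlra.
have cA : cont_on a b (aA G) by apply: isD_cont_on => x hx; exact: a_dA.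
have [us hus umax] := evt_max ab cA.
(* Passing from [u0] to the maximum [us] costs at most [D / t] of angle, because the area does not
   decrease. *)
have thus : w < ath G us.
  have := a_F G hu0 hus; have := umax u0 hu0 => h1 h2.
  have h3 : t * (w - ath G us) < 0.
    have : t * (w + D / t) < t * ath G u0 by rewrite ltr_pM2l.
    have -> : t * (w + D / t) = t * w + D by field; rewrite gt_eqF.
    qlra.
  by rewrite pmulr_rlt0// in h3; qlra.
have usL : uL < us by rewrite ltNge; apply/negP => h; have := HL us ltac:(qlra); qlra.
have usR : us < uR by rewrite ltNge; apply/negP => h; have := HR us ltac:(qlra); qlra.
have [||r [rX rY]] := @arc_crit a b G us; [qlra|exact: umax|].
have [c1 c2] := Hch us ltac:(qlra).
have [aus usb] : a <= us /\ us <= b by split; qlra.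
have [r0|r0] := leP 0 r.
  pose G' := arc_sub aus (lexx b) G.
  have [|||||v [hv]] := @rising_all R D t eta eps t0 eta0 eps0 Dt us b G' r.
  - qlra.
  - exact: r0.
  - exact: rX.
  - exact: rY.
  - by rewrite /=; qlra.
  by have := umax v; rewrite /=; qlra.
pose G1 := arc_sub (lexx a) usb G.
pose G' := arc_rev G1.
have [|||||v [hv]] := @rising_all R D t eta eps t0 eta0 eps0 Dt (- us) (- a) G' (- r).
- qlra.
- qlra.
- by rewrite /= opprK cosDpi rX; ring.
- by rewrite /= opprK sinDpi rY; ring.
- by rewrite /= !opprK; qlra.
by rewrite /= opprK; have := umax (- v); qlra.
Qed.

End ArcUpper.

(** * The difference quotient across the diagonal *)

Section ChordQuotient.
Context {R : realType}.
Variable (I : set R).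
Hypothesis I_open : forall u, I u -> exists2 e, 0 < e & forall v, u - e < v < u + e -> I v.

(** Division by [p.2 - p.1] gives chords the same limit on both sides of the diagonal, so that one
    continuous angle can serve chords and tangents. *)
Definition chord_quot (f f' : R -> R) (p : R * R) :=
  if p.1 == p.2 then f' p.1 else (f p.2 - f p.1) / (p.2 - p.1).

Lemma chord_quot_c (f f' : R -> R) : (forall u, I u -> isD f u (f' u)) ->
  (forall u, I u -> {for u, continuous f'}) ->
  forall p, I p.1 -> I p.2 -> {for p, continuous (chord_quot f f')}.
Proof.
move=> df cf' [u v] /= Iu Iv; have [uv|uv] := eqVneq u v; last first.
  have H : {for (u, v), continuous (fun p : R * R => (f p.2 - f p.1) / (p.2 - p.1))}.
    apply: cvgM.
      by apply: cvgB; [exact: (@cont_snd _ _ _ f (u, v) (isD_cont (df _ Iv)))|exact: (@cont_fst _ _ _ f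
        (u, v) (isD_cont (df _ Iu)))].
    by apply: cvgV; [rewrite subr_eq0 eq_sym|apply: cvgB; [exact: cvg_snd|exact: cvg_fst]].
  have E : \forall p \near (u, v), (f p.2 - f p.1) / (p.2 - p.1) = chord_quot f f' p.
    have c12 : {for (u, v), continuous (fun p : R * R => p.1 - p.2)}.
      by apply: cvgB; [exact: cvg_fst|exact: cvg_snd].
    have nz : nbhs (u - v) [set y : R | y != 0].
      by apply: open_nbhs_nbhs; split; [exact: open_neq|rewrite /= subr_eq0].
    have h : nbhs (u, v) [set p : R * R | p.1 - p.2 != 0] by exact: (c12 _ nz).
    apply: filterS h => -[x y] /= xy.
    by rewrite /chord_quot /= -subr_eq0 (negbTE xy).
  rewrite /prop_for /continuous_at {2}/chord_quot /= (negbTE uv).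
  exact: cvg_trans (near_eq_cvg E) H.
subst v; apply/cvgrPdist_lt => e e0.
have [d1 d10 H1] := I_open Iu; have [d2 d20 H2] := cont_nbhs (cf' _ Iu) e0.
have n1 (g : R * R -> R) : {for (u, u), continuous g} -> g (u, u) = u ->
    nbhs ((u, u) : (R * R)%type) [set p | `|u - g p| < Num.min d1 d2].
  move=> cg gu; have := cg; rewrite /prop_for /continuous_at gu => /cvgrPdist_lt/(_ (Num.min d1 d2)).
  by rewrite lt_min d10 d20 => /(_ isT).
have c1 : {for (u, u), continuous (@fst R R)} by exact: cvg_fst.
have c2 : {for (u, u), continuous (@snd R R)} by exact: cvg_snd.
have N1 := n1 fst c1 erefl; have N2 := n1 snd c2 erefl.
apply: filterS2 N1 N2 => -[x y] /=; rewrite !lt_min => /andP[hx1 hx2] /andP[hy1 hy2];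
  move: hx1 hx2 hy1 hy2; rewrite [`|u - x| < _]ltr_norml [`|u - x| < _]ltr_norml [`|u - y|
  < _]ltr_norml [`|u - y| < _]ltr_norml => hx1 hx2 hy1 hy2.
have nb w : u - d2 < w < u + d2 -> `|f' u - f' w| < e by move=> /H2; rewrite ltr_norml; qlra.
rewrite /chord_quot /= eqxx; case: eqVneq => [_|xy]; first by apply: nb; qlra.
have lem p q : u - d1 < p < u + d1 -> u - d2 < p < u + d2 -> u - d1 < q < u + d1 -> u - d2 < q < u + d2 ->
    p < q -> `|f' u - (f q - f p) / (q - p)| < e.
  move=> hp hp' hq hq' pq; have [|z hz ->] := @mvt R p q f f' pq.
    by move=> z hz; apply: df; apply: H1; qlra.
  by rewrite mulfK ?subr_eq0 ?gt_eqF//; apply: nb; qlra.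
move: xy; rewrite neq_lt => /orP[xy|yx]; first by apply: lem; qlra.
have -> : (f y - f x) / (y - x) = (f x - f y) / (x - y).
  by field; rewrite !subr_eq0 gt_eqF// lt_eqF.
by apply: lem; qlra.
Qed.

End ChordQuotient.

(** One time slice: [pP] is a primitive of the density [alpha] at time [t], and [p_D] is the
    two-point estimate. It is stated without a tangent angle, which is chosen later on compact
    pieces. *)
Record planar_curve {R : realType} (I : set R) (D t : R) := PlanarCurve {
  pX : R -> R; pY : R -> R; pX1 : R -> R; pY1 : R -> R; pX2 : R -> R; pY2 : R -> R;
  pA : R -> R; pP : R -> R;
  p_open : forall u, I u -> exists2 e, 0 < e & forall v, u - e < v < u + e -> I v;
  p_itv : forall u v w, I u -> I v -> u <= w <= v -> I w;
  p_dX : forall u, I u -> isD pX u (pX1 u);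
  p_dY : forall u, I u -> isD pY u (pY1 u);
  p_dX1 : forall u, I u -> isD pX1 u (pX2 u);
  p_dY1 : forall u, I u -> isD pY1 u (pY2 u);
  p_reg : forall u, I u -> 0 < pX1 u ^+ 2 + pY1 u ^+ 2;
  p_inj : forall u v, I u -> I v -> pX u = pX v -> pY u = pY v -> u = v;
  p_dA : forall u, I u -> isD pA u (2^-1 * (pX1 u * pY u - pY1 u * pX u));
  p_dP : forall u, I u -> isD pP u (2^-1 * (pX1 u * pY u - pY1 u * pX u) -
    t * ((pX1 u * pY2 u - pY1 u * pX2 u) / (pX1 u ^+ 2 + pY1 u ^+ 2)));
  p_D : forall u v, I u -> I v -> pP v - pP u <= D
}.

Section Static.
Context {R : realType} {I : set R} {D t : R} (C : planar_curve I D t).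
Local Notation X := (pX C). Local Notation Y := (pY C).
Local Notation X' := (pX1 C). Local Notation Y' := (pY1 C).
Local Notation X2 := (pX2 C). Local Notation Y2 := (pY2 C).
Local Notation A := (pA C). Local Notation P := (pP C).

(** Near [u] a continuous angle equals its value at [u] plus the arctangent of cross over dot
    product of the two tangents, and this expression can be differentiated. *)
Lemma isD_lift (th : R -> R) a b u : a < u < b -> (forall v, a <= v <= b -> I v) ->
  {for u, continuous th} ->
  (forall v, a <= v <= b -> X' v = Num.sqrt (X' v ^+ 2 + Y' v ^+ 2) * cos (th v) /\
                            Y' v = Num.sqrt (X' v ^+ 2 + Y' v ^+ 2) * sin (th v)) ->
  isD th u ((X' u * Y2 u - Y' u * X2 u) / (X' u ^+ 2 + Y' u ^+ 2)).
Proof.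
move=> hu Iab cth hth; have pi0 := pi_gt0 R.
have hu' : a <= u <= b by qlra.
have Iu := Iab u hu'; have q0 := p_reg C Iu.
have qn : X' u * X' u + Y' u * Y' u != 0 by rewrite -!expr2 gt_eqF.
have H := isD_div (isD_sub (isD_mul (isD_cst (X' u) u) (p_dY1 C Iu)) (isD_mul (isD_cst (Y' u) u) (p_dX1
  C Iu)))
  (isD_add (isD_mul (isD_cst (X' u) u) (p_dX1 C Iu)) (isD_mul (isD_cst (Y' u) u) (p_dY1 C Iu))) qn.
have H2 := isD_add (isD_cst (th u) u) (isD_comp H (is_derive1_atan _)).
refine (isD_near _ (isD_eq H2 _)); last first.
  have -> : X' u * Y' u - Y' u * X' u = 0 by ring.
  rewrite -!expr2 in qn *; field.
  by rewrite qn.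
have [d d0 Hd] := cont_nbhs cth (divr_gt0 pi0 (ltr0n R 2)).
have n1 : \near u, a < u < b by apply: near_in_itvoo; rewrite in_itv.
have n2 : \forall v \near u, u - d < v < u + d by apply: near_in_itvoo; rewrite in_itv/=; qlra.
apply: filterS2 n1 n2 => v hv /Hd hthv.
have hv' : a <= v <= b by qlra.
have [eX eY] := hth v hv'; have [eXu eYu] := hth u hu'.
have mu0 : 0 < Num.sqrt (X' u ^+ 2 + Y' u ^+ 2) by rewrite sqrtr_gt0.
have mv0 : 0 < Num.sqrt (X' v ^+ 2 + Y' v ^+ 2) by rewrite sqrtr_gt0 p_reg//; exact: Iab.
have c0 : 0 < cos (th v - th u) by apply: cos_gt0_pihalf; qlra.
have -> : (X' u * Y' v - Y' u * X' v) / (X' u * X' v + Y' u * Y' v) = tan (th v - th u).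
  move: mu0 mv0 eX eY eXu eYu; move: (Num.sqrt (X' u ^+ 2 + _)) (Num.sqrt (X' v ^+ 2 + _)) => mu mv mu0
    mv0 -> -> -> ->.
  rewrite /tan; rewrite sinB cosB in c0 *; field.
  rewrite gt_eqF//=; set z := _ + _; have -> : z = mu * mv * (cos (th v) * cos (th u) + sin (th v) *
    sin (th u)).
    by rewrite /z; ring.
  by rewrite gt_eqF// !mulr_gt0.
by rewrite tanK ?in_itv/=; qlra.
Qed.

(** The difference quotient vanishes nowhere, by [p_inj] off the diagonal and [p_reg] on it, so its
    angle can be lifted. [A - t th] and [P] then have the same derivative, which turns [p_D] into
    [a_F]. *)
Lemma build_arc a b eta phi0 : I a -> I b -> a < b -> 0 < eta ->
  X' b = Num.sqrt (X' b ^+ 2 + Y' b ^+ 2) * cos phi0 ->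
  Y' b = Num.sqrt (X' b ^+ 2 + Y' b ^+ 2) * sin phi0 ->
  exists eps, 0 < eps /\ exists G : arc D t eta eps a b,
    [/\ aX G = X, aY G = Y, aX' G = X', aY' G = Y' & ath G b = phi0 /\ cont_on a b (ath G)].
Proof.
move=> Ia Ib ab eta0 Xb Yb.
(* The lift is made on a slightly larger interval, so that the tangent angle is differentiable at
   [a] and [b] too. *)
have [da da0 Ha] := p_open C Ia; have [db db0 Hb] := p_open C Ib.
pose a' := a - da / 2. pose b' := b + db / 2.
have [aa' bb'] : a' < a /\ b < b' by rewrite /a' /b'; split; qlra.
have Ia' : I a' by apply: Ha; rewrite /a'; qlra.
have Ib' : I b' by apply: Hb; rewrite /b'; qlra.
clearbody a' b'.
have Iab u : a' <= u <= b' -> I u by exact: (p_itv C Ia' Ib').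
pose q1 := chord_quot X X'. pose q2 := chord_quot Y Y'.
have cX' u : I u -> {for u, continuous X'} by move=> Iu; exact: isD_cont (p_dX1 C Iu).
have cY' u : I u -> {for u, continuous Y'} by move=> Iu; exact: isD_cont (p_dY1 C Iu).
have qpos p : a' <= p.1 <= b' -> a' <= p.2 <= b' -> 0 < q1 p ^+ 2 + q2 p ^+ 2.
  move=> h1 h2; rewrite /q1 /q2 /chord_quot; case: eqVneq => [_|ne]; first by apply: p_reg; exact: Iab.
  rewrite lt_neqAle addr_ge0 ?sqr_ge0// andbT eq_sym paddr_eq0 ?sqr_ge0// !sqrf_eq0 !mulf_eq0 !invr_eq0.
  rewrite !subr_eq0 [p.2 == p.1]eq_sym (negbTE ne) !orbF; apply/negP => /andP[/eqP eX /eqP eY].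
  by move: ne; rewrite (p_inj (Iab _ h2) (Iab _ h1) eX eY) eqxx.
have [||||Th0 [cTh0 HTh0]] := @lift_square R a' b' q1 q2.
- qlra.
- by move=> p h1 h2; apply: (chord_quot_c (p_open C) (p_dX C) cX'); exact: Iab.
- by move=> p h1 h2; apply: (chord_quot_c (p_open C) (p_dY C) cY'); exact: Iab.
- exact: qpos.
(* A multiple of [2 pi], by which the lift is shifted to have the value [phi0] at [b]. *)
pose k := Th0 (b, b) - phi0.
have bw : a' <= b <= b' by qlra.
have mb0 : Num.sqrt (X' b ^+ 2 + Y' b ^+ 2) != 0 by rewrite gt_eqF// sqrtr_gt0 p_reg.
have [ck sk] : cos k = 1 /\ sin k = 0.
  have := HTh0 (b, b) bw bw; rewrite /q1 /q2 /chord_quot /= eqxx => -[e1 e2].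
  have c1 : cos (Th0 (b, b)) = cos phi0 by apply: (mulfI mb0); rewrite -e1 -Xb.
  have s1 : sin (Th0 (b, b)) = sin phi0 by apply: (mulfI mb0); rewrite -e2 -Yb.
  by rewrite /k cosB sinB c1 s1 -!expr2 cos2Dsin2; split => //; ring.
pose Th p := Th0 p - k.
have cTh : continuous Th by move=> p; apply: cvgB; [exact: cTh0|exact: cvg_cst].
have HTh p : a' <= p.1 <= b' -> a' <= p.2 <= b' ->
    q1 p = Num.sqrt (q1 p ^+ 2 + q2 p ^+ 2) * cos (Th p) /\
    q2 p = Num.sqrt (q1 p ^+ 2 + q2 p ^+ 2) * sin (Th p).
  move=> h1 h2; rewrite /Th cosB sinB ck sk !mulr1 !mulr0 addr0 subr0; exact: HTh0.
have Thb : Th (b, b) = phi0 by rewrite /Th /k; ring.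
clearbody Th.
pose th u := Th (u, u).
have cth u : {for u, continuous th}.
  apply: (@continuous_comp _ _ _ (fun u => (u, u)) Th); last exact: cTh.
  by apply: cont_pair; exact: cvg_id.
have Hth u : a' <= u <= b' -> X' u = Num.sqrt (X' u ^+ 2 + Y' u ^+ 2) * cos (th u) /\
    Y' u = Num.sqrt (X' u ^+ 2 + Y' u ^+ 2) * sin (th u).
  by move=> hu; have := HTh (u, u) hu hu; rewrite /q1 /q2 /chord_quot /= eqxx.
have [eps eps0 Heps] := @unif_cont R a b Th eta cTh eta0.
(* Halved because the modulus of an arc admits differences equal to its step, while [Heps] wants
   strict inequality. *)
exists (eps / 2); split; first qlra.
have w u : a <= u <= b -> a' <= u <= b' by qlra.
have Iw u : a <= u <= b -> I u by move=> /w /Iab.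
have chord u v : a <= u -> u < v -> v <= b ->
    [/\ 0 < (v - u) * Num.sqrt (q1 (u, v) ^+ 2 + q2 (u, v) ^+ 2),
      X v - X u = (v - u) * Num.sqrt (q1 (u, v) ^+ 2 + q2 (u, v) ^+ 2) * cos (Th (u, v)) &
      Y v - Y u = (v - u) * Num.sqrt (q1 (u, v) ^+ 2 + q2 (u, v) ^+ 2) * sin (Th (u, v))].
  move=> au uv vb; have hu : a' <= u <= b' by qlra. have hv : a' <= v <= b' by qlra.
  have [e1 e2] := HTh (u, v) hu hv; have vu : 0 < v - u by qlra.
  split; first by rewrite mulr_gt0// sqrtr_gt0; exact: qpos.
    by rewrite -mulrA -e1 /q1 /chord_quot /= lt_eqF//; field; rewrite gt_eqF.
  by rewrite -mulrA -e2 /q2 /chord_quot /= lt_eqF//; field; rewrite gt_eqF.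
unshelve eexists (@Arc R D t eta (eps / 2) a b X Y X' Y' A th (fun u v => Th (u, v))
  (fun u => Num.sqrt (X' u ^+ 2 + Y' u ^+ 2))
  (fun u v => (v - u) * Num.sqrt (q1 (u, v) ^+ 2 + q2 (u, v) ^+ 2)) _ _ _ _ _ _ _ _ _ _ _ _ _ _).
- by move=> u /Iw; exact: p_dX.
- by move=> u /Iw; exact: p_dY.
- by move=> u /Iw; exact: p_dA.
- by move=> u /Iw Iu; rewrite sqrtr_gt0; exact: p_reg.
- by move=> u /w /Hth[].
- by move=> u /w /Hth[].
- by move=> u v h1 h2 h3; case: (chord u v h1 h2 h3).
- by move=> u v h1 h2 h3; case: (chord u v h1 h2 h3).
- by move=> u v h1 h2 h3; case: (chord u v h1 h2 h3).
- by [].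
- move=> u hu v hv; apply: (@continuous_comp _ _ _ (fun v => (u, v)) Th); last exact: cTh.
  by apply: cont_pair; [exact: cvg_cst|exact: cvg_id].
- move=> v hv u hu; apply: (@continuous_comp _ _ _ (fun u => (u, v)) Th); last exact: cTh.
  by apply: cont_pair; [exact: cvg_id|exact: cvg_cst].
- move=> u v u' v' h1 h2 h3 h4 h5 h6 h7 h8.
  by apply: (Heps (u, v) (u', v')); rewrite /= ?ltr_norml; qlra.
- move=> u v hu hv.
  have dth z : a <= z <= b -> isD (fun z => A z - t * th z) z (2^-1 * (X' z * Y z - Y' z * X z) -
      t * ((X' z * Y2 z - Y' z * X2 z) / (X' z ^+ 2 + Y' z ^+ 2))).
    move=> hz; have dt := @isD_lift th a' b' z ltac:(qlra) Iab (cth z) Hth.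
    by apply: (isD_eq (isD_sub (p_dA C (Iw z hz)) (isD_mul (isD_cst t z) dt))); ring.
  have E : A v - t * th v - (A u - t * th u) = P v - P u.
    have [uv|vu] := leP u v.
      by apply: (isD_const_diff uv (fun z hz => dth z ltac:(qlra)) (fun z hz => p_dP C (Iw z ltac:(qlra)))).
    have := isD_const_diff (ltW vu) (fun z hz => dth z ltac:(qlra)) (fun z hz => p_dP C (Iw z ltac:(qlra))).
    by qlra.
  by have := p_D C (Iw u hu) (Iw v hv); rewrite -E; qlra.
by split=> //; split=> // x _; exact: cth.
Qed.

End Static.

Section Static.
Context {R : realType} {I : set R} {D t : R} (C : planar_curve I D t).
Local Notation X := (pX C). Local Notation Y := (pY C).
Local Notation X' := (pX1 C). Local Notation Y' := (pY1 C).
Local Notation X2 := (pX2 C). Local Notation Y2 := (pY2 C).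
Local Notation A := (pA C). Local Notation P := (pP C).

(** A continuous angle with positive cosine cannot cross [pi / 2] or [- pi / 2]. *)
Lemma branch (f : R -> R) a b x0 : cont_on a b f -> (forall x, a <= x <= b -> 0 < cos (f x)) ->
  a <= x0 <= b -> `|f x0| < pi / 2 -> forall x, a <= x <= b -> `|f x| < pi / 2.
Proof.
move=> cf cos0 hx0 fx0 x hx; have pi0 := pi_gt0 R.
have lem (g : R -> R) y z : a <= y <= b -> a <= z <= b -> cont_on a b g ->
   (forall x, a <= x <= b -> 0 < cos (g x)) -> g y < pi / 2 -> g z < pi / 2.
  move=> hy hz cg cosg gy; rewrite ltNge; apply/negP => gz.
  have bad c : a <= c <= b -> g c = pi / 2 -> False.
    by move=> /cosg + gc; rewrite gc cos_pihalf ltxx.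
  have [yz|zy] := leP y z.
    have [||c hc] := @ivt R y z g (pi / 2) yz; [by apply: cont_on_sub cg; qlra|qlra|].
    by apply: bad; qlra.
  have [||c hc] := @ivt_dec R z y g (pi / 2) (ltW zy); [by apply: cont_on_sub cg; qlra|qlra|].
  by apply: bad; qlra.
move: fx0; rewrite !ltr_norml => fx0.
have h1 := lem f x0 x hx0 hx cf cos0 ltac:(qlra).
have cosN0 y : a <= y <= b -> 0 < cos (- f y) by move=> hy; rewrite cosN; exact: cos0.
have fx0' : - f x0 < pi / 2 by qlra.
have /= h2 := lem (fun x => - f x) x0 x hx0 hx (cont_onN cf) cosN0 fx0'.
qlra.
Qed.

Local Notation m u := (Num.sqrt (X' u ^+ 2 + Y' u ^+ 2)).

(** Cosines determine angles only up to the branch. The branch fixed at [b] is carried along the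
    chords into [b] to the chord from [a] to [b], and from there along the chords out of [a] to the
    tangent at [a]. Then [arc_upper] applies to the arc and to its reflection. *)
Lemma arc_cone (eta eps a b c d w : R) (G : arc D t eta eps a b) : 0 < t -> 0 < eta -> 0 < eps ->
  D + t * eta < t * (pi / 2) -> a < c -> c <= d -> d < b -> 0 <= w < pi / 2 ->
  cont_on a b (ath G) -> `|ath G b| <= w ->
  (forall v, a <= v <= c \/ d <= v <= b -> cos w <= cos (ath G v)) ->
  (forall v, a <= v < b -> 0 < cos (aTh G v b)) -> (forall v, a < v <= b -> 0 < cos (aTh G a v)) ->
  (forall v, c <= v <= d -> cos w <= cos (aTh G v b) /\ cos w <= cos (aTh G a v)) ->
  forall u, a <= u <= b -> `|ath G u| <= w + D / t.
Proof.
move=> t0 eta0 eps0 Dt ac cd db hw cth thb costh posR posL ch.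
have pi0 := pi_gt0 R; have cw : 0 < cos w by apply: cos_gt0_pihalf; qlra.
have ab : a < b := lt_trans ac (le_lt_trans cd db).
have aab : a <= a <= b by rewrite lexx ltW.
have bab : a <= b <= b by rewrite lexx ltW.
have thb2 : `|ath G b| < pi / 2 by case/andP: hw => _; exact: le_lt_trans.
have brR v : a <= v <= b -> `|aTh G v b| < pi / 2.
  move=> hv; apply: (branch (f := fun v => aTh G v b) (x0 := b) (a_cl (a := G) bab)) => //; last by
    rewrite a_diag.
  move=> x /andP[ax xb]; have [->|nxb] := eqVneq x b.
    by rewrite a_diag//; apply: cos_gt0_pihalf; rewrite -ltr_norml.
  by apply: posR; rewrite ax lt_neqAle nxb.
have brL v : a <= v <= b -> `|aTh G a v| < pi / 2.
  move=> hv; apply: (branch (f := aTh G a) (x0 := b) (a_cr (a := G) aab)) => //; last exact: brR.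
  move=> x /andP[ax xb]; have [->|nxa] := eqVneq x a.
    by rewrite a_diag//; apply: lt_le_trans cw _; apply: costh; left; rewrite lexx ltW.
  by apply: posL; rewrite xb lt_neqAle eq_sym nxa ax.
have small x : `|x| < pi / 2 -> cos w <= cos x -> `|x| <= w.
  have hpi : pi / 2 <= pi :> R by qlra.
  case/andP: hw => w0 wpi h1; apply: cos_ge_norm; last exact: ltW (lt_le_trans h1 hpi).
  by rewrite w0 (ltW (lt_le_trans wpi hpi)).
have thR v : d <= v <= b -> `|ath G v| <= w.
  move=> hv; apply: small; last by apply: costh; right.
  refine (branch (f := ath G) (a := d) (b := b) (x0 := b) _ _ _ thb2 hv).
  - by apply: cont_on_sub cth => //; exact: ltW (lt_le_trans ac cd).
  - by move=> x hx; apply: lt_le_trans cw _; apply: costh; right.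
  - by rewrite lexx ltW.
have thL v : a <= v <= c -> `|ath G v| <= w.
  move=> hv; apply: small; last by apply: costh; left.
  refine (branch (f := ath G) (a := a) (b := c) (x0 := a) _ _ _ _ hv).
  - by apply: cont_on_sub cth => //; exact: ltW (le_lt_trans cd db).
  - by move=> x hx; apply: lt_le_trans cw _; apply: costh; left.
  - by rewrite lexx ltW.
  - by rewrite -(a_diag G aab); exact: brL.
have wab v : c <= v <= d -> a <= v <= b.
  by move=> /andP[cv vd]; rewrite (ltW (lt_le_trans ac cv)) (ltW (le_lt_trans vd db)).
have chR v : c <= v <= d -> `|aTh G v b| <= w by move=> hv; apply: small; [exact/brR/wab|case: (ch v hv)].
have chL v : c <= v <= d -> `|aTh G a v| <= w by move=> hv; apply: small; [exact/brL/wab|case: (ch v hv)].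
have ler_n x : `|x| <= w -> x <= w /\ - x <= w by rewrite ler_norml => /andP[h1 h2]; split => //;
  rewrite lerNl.
move=> u hu; rewrite ler_norml lerNl; apply/andP; split.
  apply: (arc_upper (G := arc_mirror G) t0 eta0 eps0 Dt ac cd db) hu => v /=.
  - by move=> /thL/ler_n[].
  - by move=> /thR/ler_n[].
  - by move=> hv; split; [case: (ler_n _ (chR v hv))|case: (ler_n _ (chL v hv))].
apply: (arc_upper (G := G) t0 eta0 eps0 Dt ac cd db) hu => v.
- by move=> /thL/ler_n[].
- by move=> /thR/ler_n[].
- by move=> hv; split; [case: (ler_n _ (chR v hv))|case: (ler_n _ (chL v hv))].
Qed.

(** Makes all chords out of [a] and into [b] point to the right, as the transport of the branch in
    [arc_cone] requires. Near the ends [X] increases, and the cone conditions on long chords cover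
    the middle part. *)
Lemma extremal_ends a b c d uL uR w : 0 < cos w -> I a -> I b -> a < c -> c <= d -> d < b ->
  c <= uL -> uL <= uR -> uR <= d -> (forall u, I u -> u <= uL \/ uR <= u -> cos w * m u <= X' u) ->
  (forall u, c <= u <= d ->
     cos w * Num.sqrt ((X b - X u) ^+ 2 + (Y b - Y u) ^+ 2) <= X b - X u) ->
  (forall u, c <= u <= d ->
     cos w * Num.sqrt ((X u - X a) ^+ 2 + (Y u - Y a) ^+ 2) <= X u - X a) ->
  (forall v, a <= v < b -> X v < X b) /\ (forall v, a < v <= b -> X a < X v).
Proof.
move=> cw Ia Ib ac cd db cL LR Rd H1 Hb Ha.
have Iab u : a <= u <= b -> I u by exact: (p_itv C Ia Ib).
have m0 u : I u -> 0 < m u by move=> Iu; rewrite sqrtr_gt0 p_reg.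
have X'0 u : I u -> u <= uL \/ uR <= u -> 0 < X' u.
  by move=> Iu /(H1 u Iu); apply: lt_le_trans; rewrite mulr_gt0// m0.
have incR x y : uR <= x -> x < y -> y <= b -> X x < X y.
  move=> h1 xy yb; apply: (isD_incr (f' := X') xy) => z hz; first by apply: p_dX; apply: Iab; qlra.
  by apply: X'0; [apply: Iab; qlra|right; qlra].
have incL x y : a <= x -> x < y -> y <= uL -> X x < X y.
  move=> h1 xy yb; apply: (isD_incr (f' := X') xy) => z hz; first by apply: p_dX; apply: Iab; qlra.
  by apply: X'0; [apply: Iab; qlra|left; qlra].
have sep x y : I x -> I y -> x != y -> 0 < Num.sqrt ((X y - X x) ^+ 2 + (Y y - Y x) ^+ 2).
  move=> Ix Iy xy; rewrite sqrtr_gt0 lt_neqAle addr_ge0 ?sqr_ge0// andbT eq_sym paddr_eq0 ?sqr_ge0//.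
  rewrite !sqrf_eq0 !subr_eq0; apply/negP => /andP[/eqP eX /eqP eY].
  by move: xy; rewrite (p_inj Iy Ix eX eY) eqxx.
have midR v : c <= v <= d -> X v < X b.
  move=> hv; rewrite -subr_gt0; apply: lt_le_trans (Hb v hv).
  by rewrite mulr_gt0// sep//; [apply: Iab; qlra|rewrite lt_eqF//; qlra].
have midL v : c <= v <= d -> X a < X v.
  move=> hv; rewrite -subr_gt0; apply: lt_le_trans (Ha v hv).
  by rewrite mulr_gt0// sep//; [apply: Iab; qlra|rewrite lt_eqF//; qlra].
split=> v hv.
  have [vc|cv] := ltP v c.
    by apply: lt_trans (incL v c _ _ _) (midR c _); qlra.
  have [dv|vd] := ltP d v; last by apply: midR; qlra.
  by apply: incR; qlra.
have [vc|cv] := ltP v c; first by apply: incL; qlra.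
have [dv|vd] := ltP d v; last by apply: midL; qlra.
by apply: lt_trans (midL d _) (incR d v _ _ _); qlra.
Qed.

(** The given point is enclosed in a compact piece with far endpoints, whose end tangents and long
    chords are within [w] of the horizontal; the turning estimate adds [D / t]. *)
Lemma static_cone w uL uR : 0 < t -> 0 <= w -> w + D / t < pi / 2 -> I uL -> I uR -> uL <= uR ->
  (forall u, I u -> u <= uL \/ uR <= u -> cos w * m u <= X' u) ->
  (forall c d, I c -> I d -> c <= d -> exists b, [/\ I b, d < b & forall u, c <= u <= d ->
     cos w * Num.sqrt ((X b - X u) ^+ 2 + (Y b - Y u) ^+ 2) <= X b - X u]) ->
  (forall c d, I c -> I d -> c <= d -> exists a, [/\ I a, a < c & forall u, c <= u <= d ->
     cos w * Num.sqrt ((X u - X a) ^+ 2 + (Y u - Y a) ^+ 2) <= X u - X a]) ->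
  forall u, I u -> cos (w + D / t) * m u <= X' u.
Proof.
move=> t0 w0 wD IL IR LR H1 H2 H3 u0 Iu0; have pi0 := pi_gt0 R.
have D0 : 0 <= D by have := p_D C IL IL; rewrite subrr.
have Dt0 : 0 <= D / t by apply: divr_ge0 => //; exact: ltW.
have cw : 0 < cos w by apply: cos_gt0_pihalf; qlra.
pose c := Num.min uL u0. pose d := Num.max uR u0.
have Ic : I c by rewrite /c; case: (leP uL u0).
have Id : I d by rewrite /d; case: (leP uR u0).
have [cL cu Rd ud] : [/\ c <= uL, c <= u0, uR <= d & u0 <= d].
  by split; rewrite ?ge_min ?le_max lexx ?orbT.
have cd : c <= d by qlra.
have [b [Ib db Hb]] := H2 c d Ic Id cd. have [a [Ia ac Ha]] := H3 c d Ic Id cd.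
clearbody c d.
have Iab u : a <= u <= b -> I u by exact: (p_itv C Ia Ib).
have m0 u : I u -> 0 < m u by move=> Iu; rewrite sqrtr_gt0 p_reg.
have [allR allL] := extremal_ends cw Ia Ib ac cd db cL LR Rd H1 Hb Ha.
have unit_m u : I u -> (X' u / m u) ^+ 2 + (Y' u / m u) ^+ 2 = 1.
  move=> Iu; rewrite !expr_div_n -mulrDl sqr_sqrtr ?ltW ?p_reg//.
  by rewrite divff// gt_eqF// p_reg.
have [|||phi0 phiw [cphi sphi]] := @unit_angle R (X' b / m b) (Y' b / m b) w.
- exact: unit_m.
- qlra.
- by rewrite ler_pdivlMr ?m0//; apply: H1 => //; right; qlra.
(* Half of the room that [D / t < pi / 2] leaves for the hypothesis of [rising_all]. *)
pose eta := (pi / 2 - D / t) / 2.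
have eta0 : 0 < eta by rewrite /eta; qlra.
have etaD : D + t * eta < t * (pi / 2).
  have -> : t * eta = (t * (pi / 2) - D) / 2 by rewrite /eta; field; rewrite gt_eqF.
  have : t * (D / t) < t * (pi / 2) by rewrite ltr_pM2l//; qlra.
  by rewrite mulrC divfK ?gt_eqF//; qlra.
have ab : a < b by qlra.
have [||eps [eps0 [G [GX GY GX' GY' [Gb cth]]]]] := build_arc (C := C) Ia Ib ab eta0 (phi0 := phi0).
- by rewrite -cphi mulrC divfK// gt_eqF// m0.
- by rewrite -sphi mulrC divfK// gt_eqF// m0.
have aab : a <= a <= b by qlra. have bab : a <= b <= b by qlra.
have thE u : a <= u <= b -> X' u = m u * cos (ath G u) /\ Y' u = m u * sin (ath G u).
  move=> hu; have := a_X' G hu; have := a_Y' G hu; rewrite GX' GY' => e2 e1.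
  have -> : m u = am G u; last by [].
  rewrite e1 e2 !exprMn -mulrDr cos2Dsin2 mulr1 sqrtr_sqr gtr0_norm//; exact: a_m.
have cos_th u : a <= u <= b -> u <= uL \/ uR <= u -> cos w <= cos (ath G u).
  move=> hu h; have Iu := Iab u hu; have := H1 u Iu h.
  by rewrite [leRHS](thE u hu).1 mulrC ler_pM2l// m0.
have cos_ch u v : a <= u -> u < v -> v <= b -> X u < X v -> 0 < cos (aTh G u v).
  move=> h1 h2 h3 h4; have := a_chX G h1 h2 h3; rewrite GX => e.
  have d0 := a_d G h1 h2 h3; have : 0 < ad G u v * cos (aTh G u v) by rewrite -e subr_gt0.
  by rewrite pmulr_rgt0.
have chord u v : a <= u -> u < v -> v <= b ->
    cos w * Num.sqrt ((X v - X u) ^+ 2 + (Y v - Y u) ^+ 2) <= X v - X u -> cos w <= cos (aTh G u v).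
  move=> h1 h2 h3; have := a_chX G h1 h2 h3; have := a_chY G h1 h2 h3; rewrite GX GY => -> ->.
  have d0 := a_d G h1 h2 h3; rewrite !exprMn -mulrDr cos2Dsin2 mulr1 sqrtr_sqr (gtr0_norm d0).
  by rewrite mulrC (ler_pM2l d0).
have hu0 : a <= u0 <= b.
  by rewrite (ltW (lt_le_trans ac cu)) (ltW (le_lt_trans ud db)).
have nth : `|ath G u0| <= w + D / t.
  apply: (arc_cone t0 eta0 eps0 etaD ac cd db _ cth) hu0.
  - by rewrite w0; qlra.
  - by rewrite Gb.
  - move=> v [] /andP[h1 h2].
      by apply: cos_th; [rewrite h1 (le_trans h2 (le_trans cd (ltW db)))|left; exact: le_trans cL].
    by apply: cos_th; [rewrite h2 (le_trans (ltW ac) (le_trans cd h1))|right; exact: le_trans h1].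
  - by move=> v /andP[h1 h2]; apply: cos_ch => //; apply: allR; rewrite h1.
  - by move=> v /andP[h1 h2]; apply: cos_ch => //; apply: allL; rewrite h1.
  - move=> v hv; have /andP[cv vd] := hv; have av := lt_le_trans ac cv; have vb := le_lt_trans vd db.
    by split; apply: chord; rewrite ?lexx// ?(ltW av) ?(ltW vb)//; [exact: Hb|exact: Ha].
have wpi : w + D / t <= pi by clear -wD pi0; qlra.
have w0' : 0 <= w + D / t by rewrite addr_ge0.
have nth' : `|ath G u0| <= pi by apply: le_trans wpi.
rewrite [leRHS](thE u0 hu0).1 mulrC ler_pM2l ?m0//.
by rewrite -(cos_norm (ath G u0)) leNgt ltr_cos ?in_itv/= -?leNgt ?normr_ge0 ?w0'.
Qed.

End Static.

(** * The cone estimate along the flow *)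

Section Cone.
Context {R : realType}.

Lemma cone_tangent (phi eps z1 z2 : R) : 0 <= phi -> 0 < eps -> phi + eps < pi / 2 ->
  z1 ^+ 2 + z2 ^+ 2 = 1 -> cos eps <= z1 -> cos (phi + eps) <= z1 * cos phi - `|z2| * sin phi.
Proof.
move=> p0 e0 pe zz ez; have pi0 := pi_gt0 R.
have ce : 0 < cos eps by apply: cos_gt0_pihalf; lra.
have se : 0 < sin eps by apply: sin_gt0_pi; lra.
have z10 : 0 < z1 by exact: lt_le_trans ez.
have z2e : `|z2| <= sin eps.
  rewrite ler_norm_sqr; last exact: ltW.
  have := cos2Dsin2 eps; have : cos eps ^+ 2 <= z1 ^+ 2 by rewrite ler_pXn2r// nnegrE ltW.
  by lra.
have := @cone R phi eps z1 z2 p0 e0 pe _ (ltW z10).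
rewrite zz sqrtr1 mulr1; apply.
apply: (@le_trans _ _ (sin eps * cos eps)); first by apply: ler_wpM2r => //; exact: ltW.
by rewrite mulrC; apply: ler_wpM2r => //; exact: ltW.
Qed.

End Cone.

Section ChordFar.
Context {R : realType} {I : set R} {T1 : R}.

(** Seen from a compact part of the curve, far points of the end have bounded deviation across the
    ray and arbitrarily large component along it. *)
Lemma chord_far (F : flow I T1) ub e1 e2 t eps : radial_end F ub e1 e2 -> 0 <= t < T1 ->
  0 < eps < pi / 2 -> forall c d, I c -> I d -> c <= d -> exists b, [/\ I b, d < b &
   forall u, c <= u <= d ->
    0 <= e1 * (j0 (fX F) b t - j0 (fX F) u t) + e2 * (j0 (fY F) b t - j0 (fY F) u t) /\
    `|e1 * (j0 (fY F) b t - j0 (fY F) u t) - e2 * (j0 (fX F) b t - j0 (fX F) u t)| * cos eps <=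
    (e1 * (j0 (fX F) b t - j0 (fX F) u t) + e2 * (j0 (fY F) b t - j0 (fY F) u t)) * sin eps].
Proof.
move=> rE ht he c d Ic Id cd; have pi0 := pi_gt0 R.
have ce : 0 < cos eps by apply: cos_gt0_pihalf; lra.
have se : 0 < sin eps by apply: sin_gt0_pi; lra.
have tT : t < T1 by lra.
have Iu u : c <= u <= d -> I u by exact: (f_itv F Ic Id).
have bd k1 k2 : exists2 B, 0 <= B & forall u, c <= u <= d -> k1 * j0 (fX F) u t + k2 * j0 (fY F) u t <= B.
  have cf : cont_on c d (fun u => k1 * j0 (fX F) u t + k2 * j0 (fY F) u t).
    apply: isD_cont_on => x hx.
    exact: (isD_add (isD_mul (isD_cst k1 x) (j0_du (fX F) (Iu x hx) ht))
      (isD_mul (isD_cst k2 x) (j0_du (fY F) (Iu x hx) ht))).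
  have [m hm Hm] := evt_max cd cf.
  exists `|k1 * j0 (fX F) m t + k2 * j0 (fY F) m t| => // u hu.
  by apply: le_trans (Hm u hu) (ler_norm _).
have [B1 B10 HB1] := bd e1 e2. have [B2 B20 HB2] := bd (- e2) e1. have [B3 B30 HB3] := bd e2 (- e1).
have [C C0 HC] := radial_end_bounds rE ht.
pose N := C + B2 + B3.
have N0 : 0 <= N by rewrite /N; lra.
pose M := B1 + N * cos eps / sin eps.
have [uc [Iuc ubuc Huc]] := radial_end_far rE ht M.
have [e0 e00 He] := f_open F Id.
pose b := Num.max uc (d + e0 / 2).
have Ib : I b by rewrite /b; case: (leP uc (d + e0 / 2)) => // _; apply: He; lra.
have [bu bd'] : uc <= b /\ d + e0 / 2 <= b by rewrite !le_max !lexx orbT.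
exists b; split => //; first lra.
move=> u hu; have ht' : 0 <= t <= t by lra.
have hb := Huc b t Ib bu ht'. have [hb2 _] := HC b t Ib (le_trans ubuc bu) ht'.
have h1 := HB1 u hu; have h2 := HB2 u hu; have h3 := HB3 u hu.
set z1 := e1 * _ + e2 * _; set z2 := e1 * _ - e2 * _.
have z1M : N * cos eps / sin eps <= z1 by rewrite /z1; rewrite /M in hb; lra.
have z2N : `|z2| <= N.
  by move: hb2; rewrite !ler_norml /z2 /N; lra.
have z10 : 0 <= z1.
  by apply: le_trans z1M; apply: divr_ge0; [apply: mulr_ge0 => //|]; exact: ltW.
split => //; rewrite -ler_pdivrMr//; apply: le_trans z1M.
by rewrite ler_pM2r ?invr_gt0// ler_pM2r.
Qed.

End ChordFar.

Section EndCones.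
Context {R : realType} {I : set R} {T1 : R}.
Variables (F : flow I T1) (t phi eps : R).

Lemma right_tangents ub : radial_end F ub (cos phi) (sin phi) -> 0 <= t < T1 -> 0 <= phi -> 0 < eps ->
  phi + eps < pi / 2 -> exists2 uR, I uR &
  forall v, I v -> uR <= v -> cos (phi + eps) * Num.sqrt (speed2 F v t) <= j1 (fX F) v t.
Proof.
move=> rR ht0 phi0 eps0 pe; have pi0 := pi_gt0 R.
have ee : cos phi ^+ 2 + sin phi ^+ 2 = 1 :> R by exact: cos2Dsin2.
have sp : 0 <= sin phi by apply: sin_ge0_pi; lra.
have ce1 : 0 < 1 - cos eps.
  have : cos eps < cos 0 by rewrite ltr_cos ?in_itv//=; lra.
  by rewrite cos0; lra.
have htt : 0 <= t <= t by lra.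
have tT : t < T1 by lra.
have qs v : I v -> 0 < Num.sqrt (speed2 F v t) by move=> Iv; rewrite sqrtr_gt0 speed2_gt0.
have [uR [IuR ubuR HuR]] := radial_end_tangent rR ht0 0 ce1.
exists uR => // v Iv uv; have [_ n1] := HuR v t Iv uv htt.
have := @cone_tangent R phi eps (tdot F (cos phi) (sin phi) v t) (tdot F (sin phi) (- cos phi) v t)
  phi0 eps0 pe.
move=> /(_ (tdot_sqr F ee Iv tT) ltac:(lra)) h.
have q0 := qs v Iv.
have h2 : tdot F (sin phi) (- cos phi) v t * - sin phi <= `|tdot F (sin phi) (- cos phi) v t| * sin phi.
  by rewrite mulrN -mulNr; apply: ler_wpM2r => //; rewrite -normrN ler_norm.
have : cos (phi + eps) <= tdot F (cos phi) (sin phi) v t * cos phi + tdot F (sin phi) (- cos phi) v t *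
  sin phi.
  have := ler_norm (- tdot F (sin phi) (- cos phi) v t); rewrite normrN => h3.
  have : - tdot F (sin phi) (- cos phi) v t * sin phi <= `|tdot F (sin phi) (- cos phi) v t|
    * sin phi by apply: ler_wpM2r.
  lra.
have -> : tdot F (cos phi) (sin phi) v t * cos phi + tdot F (sin phi) (- cos phi) v t * sin phi = j1
  (fX F) v t / Num.sqrt (speed2 F v t).
  by rewrite /tdot -[in RHS](mul1r (j1 _ _ _)) -ee; ring.
by rewrite ler_pdivlMr.
Qed.

(** In the reversed flow the left end is a right end of direction [(- cos phi, sin phi)]; its
    tangents, reversed back, point along [(cos phi, - sin phi)] up to [eps]. *)
Lemma left_tangents ub : radial_end (flow_rev F) ub (- cos phi) (sin phi) -> 0 <= t < T1 -> 0 <= phi ->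
  0 < eps -> phi + eps < pi / 2 -> exists2 uL, I uL &
  forall v, I v -> v <= uL -> cos (phi + eps) * Num.sqrt (speed2 F v t) <= j1 (fX F) v t.
Proof.
move=> rL ht0 phi0 eps0 pe; have pi0 := pi_gt0 R.
have ee : cos phi ^+ 2 + sin phi ^+ 2 = 1 :> R by exact: cos2Dsin2.
have sp : 0 <= sin phi by apply: sin_ge0_pi; lra.
have ce1 : 0 < 1 - cos eps.
  have : cos eps < cos 0 by rewrite ltr_cos ?in_itv//=; lra.
  by rewrite cos0; lra.
have htt : 0 <= t <= t by lra.
have tT : t < T1 by lra.
have qs v : I v -> 0 < Num.sqrt (speed2 F v t) by move=> Iv; rewrite sqrtr_gt0 speed2_gt0.
have [uL' [IuL' ubuL HuL]] := radial_end_tangent rL ht0 0 ce1.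
exists (- uL') => // v Iv uv; have Iv' : I (- - v) by rewrite opprK.
have [_ n1] := HuL (- v) t Iv' ltac:(lra) htt.
have ee' : (- cos phi) ^+ 2 + sin phi ^+ 2 = 1 :> R by rewrite sqrrN.
have := @cone_tangent R phi eps (tdot (flow_rev F) (- cos phi) (sin phi) (- v) t) (tdot (flow_rev F)
  (sin phi) (- - cos phi) (- v) t) phi0 eps0 pe.
move=> /(_ (tdot_sqr (flow_rev F) ee' Iv' tT) ltac:(lra)) h.
have q0 := qs v Iv.
have : cos (phi + eps) <= tdot (flow_rev F) (- cos phi) (sin phi) (- v) t * cos phi - tdot (flow_rev F)
  (sin phi) (- - cos phi) (- v) t * sin phi.
  have : tdot (flow_rev F) (sin phi) (- - cos phi) (- v) t * sin phi <= `|tdot (flow_rev F) (sin phi)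
    (- - cos phi) (- v) t| * sin phi.
    by apply: ler_wpM2r => //; exact: ler_norm.
  lra.
have -> : tdot (flow_rev F) (- cos phi) (sin phi) (- v) t * cos phi - tdot (flow_rev F) (sin phi) (- -
  cos phi) (- v) t * sin phi = j1 (fX F) v t / Num.sqrt (speed2 F v t).
  by rewrite /tdot /speed2 /= !opprK !sqrrN -[RHS]mul1r -ee; ring.
by rewrite ler_pdivlMr.
Qed.

Lemma right_chords ub : radial_end F ub (cos phi) (sin phi) -> 0 <= t < T1 -> 0 <= phi -> 0 < eps ->
  phi + eps < pi / 2 -> forall c d, I c -> I d -> c <= d -> exists b, [/\ I b, d < b &
  forall v, c <= v <= d -> cos (phi + eps) * Num.sqrt ((j0 (fX F) b t - j0 (fX F) v t) ^+ 2 +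
    (j0 (fY F) b t - j0 (fY F) v t) ^+ 2) <= j0 (fX F) b t - j0 (fX F) v t].
Proof.
move=> rR ht0 phi0 eps0 pe; have pi0 := pi_gt0 R.
have ee : cos phi ^+ 2 + sin phi ^+ 2 = 1 :> R by exact: cos2Dsin2.
have sp : 0 <= sin phi by apply: sin_ge0_pi; lra.
have he : 0 < eps < pi / 2 by lra.
move=> c d Ic Id cd; have [b [Ib db Hb]] := chord_far rR ht0 he Ic Id cd.
exists b; split => // v hv; have [z10 hz] := Hb v hv.
rewrite (unit_frame_norm _ _ ee); apply: le_trans (cone phi0 eps0 pe hz z10) _.
set z2 := _ - sin phi * _.
have h3 : - `|z2| * sin phi <= - z2 * sin phi by apply: ler_wpM2r => //; rewrite lerN2 ler_norm.
apply: le_trans (_ : _ <= (cos phi * (j0 (fX F) b t - j0 (fX F) v t) +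
  sin phi * (j0 (fY F) b t - j0 (fY F) v t)) * cos phi - z2 * sin phi) _; first by lra.
rewrite -[leRHS]mul1r -ee /z2 -subr_ge0; set w := (X in 0 <= X); have -> : w = 0 by rewrite /w; ring.
by [].
Qed.

Lemma left_chords ub : radial_end (flow_rev F) ub (- cos phi) (sin phi) -> 0 <= t < T1 -> 0 <= phi ->
  0 < eps -> phi + eps < pi / 2 -> forall c d, I c -> I d -> c <= d -> exists a, [/\ I a, a < c &
  forall v, c <= v <= d -> cos (phi + eps) * Num.sqrt ((j0 (fX F) v t - j0 (fX F) a t) ^+ 2 +
    (j0 (fY F) v t - j0 (fY F) a t) ^+ 2) <= j0 (fX F) v t - j0 (fX F) a t].
Proof.
move=> rL ht0 phi0 eps0 pe; have pi0 := pi_gt0 R.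
have ee : cos phi ^+ 2 + sin phi ^+ 2 = 1 :> R by exact: cos2Dsin2.
have sp : 0 <= sin phi by apply: sin_ge0_pi; lra.
have he : 0 < eps < pi / 2 by lra.
move=> c d Ic Id cd.
have Ic' : [set u | I (- u)] (- c) by rewrite /= opprK.
have Id' : [set u | I (- u)] (- d) by rewrite /= opprK.
have [|b [Ib db Hb]] := chord_far rL ht0 he Id' Ic'; first by rewrite lerN2.
exists (- b); split => //; first by lra.
move=> v hv; have [|z10 hz] := Hb (- v); first by lra.
rewrite /= !opprK in z10 hz.
have ee' : (- cos phi) ^+ 2 + sin phi ^+ 2 = 1 :> R by rewrite sqrrN.
have := cone phi0 eps0 pe hz z10; rewrite -(unit_frame_norm _ _ ee').
rewrite -[X in Num.sqrt (X + _)]sqrrN opprB -[X in Num.sqrt (_ + X)]sqrrN opprB => h.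
apply: (le_trans h).
set z2 := - cos phi * _ - sin phi * _.
have h3 : - `|z2| * sin phi <= z2 * sin phi.
  by apply: ler_wpM2r => //; rewrite lerNl -normrN ler_norm.
apply: le_trans (_ : _ <= (- cos phi * (j0 (fX F) (- b) t - j0 (fX F) v t) +
  sin phi * (j0 (fY F) (- b) t - j0 (fY F) v t)) * cos phi + z2 * sin phi) _; first by lra.
rewrite -[leRHS]mul1r -ee /z2 -subr_ge0; set w := (X in 0 <= X); have -> : w = 0 by rewrite /w; ring.
by [].
Qed.

End EndCones.

Section FlowCone.
Context {R : realType} {I : set R} {T1 : R}.
Variables (F : flow I T1) (t phi D ubR ubL : R).
Hypothesis ht : 0 < t < T1.
Hypothesis phi0 : 0 <= phi.
Hypothesis phiD : phi + D / t < pi / 2.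
Hypothesis rR : radial_end F ubR (cos phi) (sin phi).
Hypothesis rL : radial_end (flow_rev F) ubL (- cos phi) (sin phi).
Hypothesis init : forall A0 : R -> R, (forall u, I u -> isD A0 u
    (2^-1 * (j1 (fX F) u 0 * j0 (fY F) u 0 - j1 (fY F) u 0 * j0 (fX F) u 0))) ->
  forall u v, I u -> I v -> A0 v - A0 u <= D.

Lemma slice_curve : exists C : planar_curve I D t, [/\ pX C = j0 (fX F) ^~ t, pY C = j0 (fY F) ^~ t,
  pX1 C = j1 (fX F) ^~ t & pY1 C = j1 (fY F) ^~ t].
Proof.
have ht' := ht; have ht0 : 0 <= t < T1 by lra.
have IbR : I ubR by case: rR.
have [P dP] : exists P : R -> R -> R, forall u s, I u -> s < T1 -> isD (P ^~ s) u (area_u F u s).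
  have H s : exists p : R -> R, s < T1 -> forall u, I u -> isD p u (area_u F u s).
    have [sT|] := ltP s T1; last by exists id.
    have [|p Hp] := @primitive_exists R I (area_u F ^~ s) (f_open F) (f_itv F); last by exists p.
    move=> v Iv; have c2 := area_u_c Iv sT (F := F).
    apply: (@continuous_comp _ _ _ (fun v => (v, s)) (fun p => area_u F p.1 p.2)) => //.
    by apply: cont_pair; [exact: cvg_id|exact: cvg_cst].
  by have [p Hp] := choice H; exists (fun u s => p s u) => v s Iv sT; exact: Hp.
have PD : forall u v, I u -> I v -> P v t - P u t <= D.
  move=> v w Iv Iw; apply: (area_bound ht0 dP rR rL) => //; last by lra.
  (* At time [0] the angle term vanishes, so [P ^~ 0] is a primitive of the area density. *)
  apply: init => z Iz; have := dP z 0 Iz ltac:(lra); rewrite /area_u mul0r subr0; exact.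
have [A dA] : exists A : R -> R, forall u, I u -> isD A u
   (2^-1 * (j1 (fX F) u t * j0 (fY F) u t - j1 (fY F) u t * j0 (fX F) u t)).
  apply: (@primitive_exists R I (fun u => 2^-1 * (j1 (fX F) u t * j0 (fY F) u t -
    j1 (fY F) u t * j0 (fX F) u t)) (f_open F) (f_itv F)) => v Iv.
  exact: (isD_cont (isD_mul (isD_cst _ _) (isD_sub (isD_mul (j1_du (fX F) Iv ht0) (j0_du (fY F) Iv ht0))
    (isD_mul (j1_du (fY F) Iv ht0) (j0_du (fX F) Iv ht0))))).
unshelve eexists (@PlanarCurve R I D t (j0 (fX F) ^~ t) (j0 (fY F) ^~ t) (j1 (fX F) ^~ t) (j1 (fY F) ^~ t)
  (j2 (fX F) ^~ t) (j2 (fY F) ^~ t) A (P ^~ t) (f_open F) (f_itv F) _ _ _ _ _ _ dA _ PD) => //.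
- by move=> v Iv; exact: j0_du.
- by move=> v Iv; exact: j0_du.
- by move=> v Iv; exact: j1_du.
- by move=> v Iv; exact: j1_du.
- by move=> v Iv; apply: f_reg => //; case/andP: ht0.
- by move=> v w Iv Iw; exact: (f_inj Iv Iw ht0).
- by move=> v Iv; apply: dP => //; case/andP: ht0.
Qed.

(** At positive times tangents and long chords are known to have the directions of the rays only up
    to [eps], so the slice estimate is applied with [phi + eps]. *)
Lemma flow_cone_eps eps u : 0 < eps -> phi + eps + D / t < pi / 2 -> I u ->
  cos (phi + eps + D / t) * Num.sqrt (speed2 F u t) <= j1 (fX F) u t.
Proof.
move=> eps0 epsD Iu; have t0 : 0 < t by case/andP: ht.
have ht0 : 0 <= t < T1 by rewrite ltW//; case/andP: ht.
have phi0' := phi0.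
have [C0 [CX CY CX1 CY1]] := slice_curve.
have D0 : 0 <= D by have := p_D C0 Iu Iu; rewrite subrr.
have Dt0 : 0 <= D / t by apply: divr_ge0 => //; exact: ltW.
have pe : phi + eps < pi / 2 by lra.
have [uR IuR HR] := right_tangents rR ht0 phi0 eps0 pe.
have [uL' IuL HL] := left_tangents rL ht0 phi0 eps0 pe.
pose uL := Num.min uL' uR.
have IL : I uL by rewrite /uL; case: (leP uL' uR).
have [uLL uLR] : uL <= uL' /\ uL <= uR by rewrite !ge_min !lexx orbT.
have := @static_cone R I D t C0 (phi + eps) uL uR t0 _ epsD IL IuR uLR.
rewrite CX CY CX1 CY1; apply => //.
- by rewrite addr_ge0// ltW.
- by move=> v Iv [h|h]; [apply: HL => //; exact: le_trans h uLL|exact: HR].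
- by move=> c d Ic Id cd; exact: (right_chords rR ht0 phi0 eps0 pe).
- by move=> c d Ic Id cd; exact: (left_chords rL ht0 phi0 eps0 pe).
Qed.

Lemma flow_cone u : I u -> cos (phi + D / t) * Num.sqrt (speed2 F u t) <= j1 (fX F) u t.
Proof.
move=> Iu; have phiD' := phiD; apply/ler_addgt0Pr => e e0.
have tT : t < T1 by case/andP: ht.
have q0 : 0 < Num.sqrt (speed2 F u t) by rewrite sqrtr_gt0 speed2_gt0.
have [d d0 Hd] := cont_nbhs (@continuous_cos R (phi + D / t)) (divr_gt0 e0 q0).
pose eps := Num.min (d / 2) ((pi / 2 - (phi + D / t)) / 2).
have eps0 : 0 < eps by rewrite lt_min; lra.
have ed : eps <= d / 2 by rewrite ge_min lexx.
have ep : eps <= (pi / 2 - (phi + D / t)) / 2 by rewrite ge_min lexx orbT.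
have h := @flow_cone_eps eps u eps0 ltac:(lra) Iu.
have := Hd (phi + eps + D / t) ltac:(lra) => /andP[h1 _].
have : (cos (phi + D / t) - e / Num.sqrt (speed2 F u t)) * Num.sqrt (speed2 F u t) <= cos (phi + eps +
  D / t) * Num.sqrt (speed2 F u t).
  by rewrite ler_pM2r// ltW.
by rewrite mulrBl divfK ?gt_eqF//; lra.
Qed.

End FlowCone.

(** * From the smooth flow to its jets *)

Section Schwarz.
Context {R : realType}.

Lemma cont2_ball (f : R -> R -> R) (u t e : R) : cont2 f u t -> 0 < e ->
  exists2 d : R, 0 < d & forall v s : R, u - d < v < u + d -> t - d < s < t + d ->
    f u t - e < f v s < f u t + e.
Proof.
move=> /cvgrPdist_lt/(_ e) + e0 => /(_ e0)/nbhs_ballP[d /= d0 H]; exists d => // v s hv hs.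
have : ball ((u, t) : (R * R)%type) d (v, s) by split; rewrite /ball /= ltr_norml; lra.
by move/H; rewrite /= ltr_norml; lra.
Qed.

(** Schwarz's theorem: the second difference over a square of side [h] is evaluated by the mean
    value theorem in both orders. *)
Lemma mixed_partials (f fu ft fut ftu : R -> R -> R) (u t r : R) : 0 < r ->
  (forall v s : R, u - r < v < u + r -> t - r < s < t + r ->
    [/\ isD (f ^~ s) v (fu v s), isD (f v) s (ft v s), isD (fu v) s (fut v s) & isD (ft ^~ s) v (ftu v s)]) ->
  cont2 fut u t -> cont2 ftu u t -> fut u t = ftu u t.
Proof.
move=> r0 H c1 c2; apply/eqP; rewrite -subr_eq0 -normr_eq0 eq_le normr_ge0 andbT.
apply/ler_addgt0Pr => e e0; rewrite add0r.
have [d1 d10 H1] := cont2_ball c1 (divr_gt0 e0 (ltr0n R 2)).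
have [d2 d20 H2] := cont2_ball c2 (divr_gt0 e0 (ltr0n R 2)).
pose h := Num.min (r / 2) (Num.min (d1 / 2) (d2 / 2)).
have h0 : 0 < h by rewrite !lt_min; lra.
have [hr hd1 hd2] : [/\ h <= r / 2, h <= d1 / 2 & h <= d2 / 2] by rewrite !ge_min !lexx !orbT.
clearbody h.
have uh : u < u + h by lra. have th : t < t + h by lra.
have [|x hx Ex] := @mvt R u (u + h) (fun v => f v (t + h) - f v t) (fun v => fu v (t + h) - fu v t) uh.
  by move=> v hv; apply: isD_sub; [case: (H v (t + h))|case: (H v t)] => //; lra.
have [|y hy Ey] := @mvt R t (t + h) (fu x) (fut x) th.
  by move=> s hs; case: (H x s) => //; lra.
have [|y' hy' Ey'] := @mvt R t (t + h) (fun s => f (u + h) s - f u s) (fun s => ft (u + h) s - ft u s) th.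
  by move=> s hs; apply: isD_sub; [case: (H (u + h) s)|case: (H u s)] => //; lra.
have [|x' hx' Ex'] := @mvt R u (u + h) (ft ^~ y') (ftu ^~ y') uh.
  by move=> v hv; case: (H v y') => //; lra.
have E : fut x y = ftu x' y'.
  rewrite Ey in Ex; rewrite Ex' in Ey'.
  have : fut x y * (t + h - t) * (u + h - u) = ftu x' y' * (u + h - u) * (t + h - t).
    by rewrite -Ex -Ey'; ring.
  have -> : u + h - u = h by ring. have -> : t + h - t = h by ring.
  by move=> /(mulIf (lt0r_neq0 h0)) /(mulIf (lt0r_neq0 h0)).
have := H1 x y ltac:(lra) ltac:(lra); have := H2 x' y' ltac:(lra) ltac:(lra).
by rewrite E ler_norml; lra.
Qed.

End Schwarz.

Section SmoothJet.
Context {R : realType}.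

Definition coord (b : bool) (p : R * R) : R := if b then p.1 else p.2.

Lemma coord_c b : continuous (coord b).
Proof. by case: b => p; [exact: cvg_fst|exact: cvg_snd]. Qed.

Lemma isD_dir (G : R * R -> R * R) (p v : R * R) (b : bool) : differentiable G p ->
  (fun h : R => h^-1 * (coord b (G (h *: v + p)) - coord b (G p))) @ 0^' --> coord b ('D_v G p).
Proof.
move=> dG; have H : (fun h : R => h^-1 *: (G (h *: v + p) - G p)) @ 0^' --> 'D_v G p.
  exact: diff_derivable.
have H2 := continuous_cvg _ (@coord_c b ('D_v G p)) H.
by case: b H2 => H2; exact: H2.
Qed.

Lemma isD_dir1 (G : R * R -> R * R) (u t : R) (b : bool) : differentiable G (u, t) ->
  isD (fun x => coord b (G (x, t))) u (coord b ('D_(1, 0) G (u, t))).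
Proof.
move=> /(@isD_dir G (u, t) (1, 0) b) H.
have C : (fun h : R => h^-1 *: (coord b (G (h *: 1 + u, t)) - coord b (G (u, t)))) @ 0^' -->
    coord b ('D_(1, 0) G (u, t)).
  rewrite [X in X @ _ --> _](_ : _ = (fun h : R => h^-1 * (coord b (G (h *: (1, 0) + (u,
    t))) - coord b (G (u, t))))) //.
  apply/funext => h; congr (_ * (coord b (G _) - _)).
  by rewrite [RHS]surjective_pairing /= -[h *: 0]/(h * 0) mulr0 add0r.
split; first by apply/cvg_ex; exists (coord b ('D_(1, 0) G (u, t))); exact: C.
by apply/cvg_lim; [exact: Rhausdorff|exact: C].
Qed.

Lemma isD_dir2 (G : R * R -> R * R) (u t : R) (b : bool) : differentiable G (u, t) ->
  isD (fun x => coord b (G (u, x))) t (coord b ('D_(0, 1) G (u, t))).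
Proof.
move=> /(@isD_dir G (u, t) (0, 1) b) H.
have C : (fun h : R => h^-1 *: (coord b (G (u, h *: 1 + t)) - coord b (G (u, t)))) @ 0^' -->
    coord b ('D_(0, 1) G (u, t)).
  rewrite [X in X @ _ --> _](_ : _ = (fun h : R => h^-1 * (coord b (G (h *: (0, 1) + (u,
    t))) - coord b (G (u, t))))) //.
  apply/funext => h; congr (_ * (coord b (G _) - _)).
  by rewrite [RHS]surjective_pairing /= -[h *: 0]/(h * 0) mulr0 add0r.
split; first by apply/cvg_ex; exists (coord b ('D_(0, 1) G (u, t))); exact: C.
by apply/cvg_lim; [exact: Rhausdorff|exact: C].
Qed.

Lemma isD_derive1 (f : R -> R) (x l : R) : isD f x l -> derive1 f x = l.
Proof. by move=> [_ <-]; rewrite derive1E. Qed.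

Variables (I : set R) (T1 : R) (gamma : R * R -> R * R) (b : bool).
Hypothesis I_open : open I.
Hypothesis T10 : 0 < T1.
Hypothesis smooth : smooth_on (I `*` [set t | 0 <= t < T1]) gamma.

(** Freezing the curve at negative times makes continuity at [t = 0] two-sided; time derivatives are
    used only for [t > 0]. *)
Let f u t := coord b (gamma (u, Num.max 0 t)).
Let f1 u t := derive1 (f ^~ t) u.
Let f2 u t := derive1 (f1 ^~ t) u.
Let f3 u t := derive1 (f2 ^~ t) u.
Let ft u t := derive1 (f u) t.
Let f1t u t := derive1 (f1 u) t.
Let f2t u t := derive1 (f2 u) t.

Section Local.
Variables (U : set (R * R)) (g : R * R -> R * R).
Hypothesis oU : open U.
Hypothesis sg : smooth_open U g.
Hypothesis fg : forall q, U q -> (I `*` [set t | 0 <= t < T1]) q -> gamma q = g q.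

Let G s := foldr (fun v (g : R * R -> R * R) x => 'D_v g x) g s.
Let W u t := [/\ I u, t < T1 & U (u, Num.max 0 t)].
Let ag s (h : R -> R -> R) := forall u t, W u t -> h u t = coord b (G s (u, Num.max 0 t)).
Let agp s (h : R -> R -> R) := forall u t, W u t -> 0 < t -> h u t = coord b (G s (u, t)).

Let agp_of s h : ag s h -> agp s h.
Proof. by move=> H u t Wut t0; rewrite H// (max_idPr _)// ltW. Qed.

Let clampt_c (u t : R) : {for (u, t), continuous (fun p : R * R => (p.1, Num.max 0 p.2))}.
Proof.
have cm : {for t, continuous (fun s : R => Num.max 0 s)}.
  by apply: (@continuous_max _ _ (fun _ => 0) id); [exact: cvg_cst|exact: cvg_id].
apply: cont_pair; first exact: cvg_fst.
exact: (@cont_snd R R R (fun s : R => Num.max 0 s) (u, t) cm).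
Qed.

Let W_near u t : W u t -> \forall p \near ((u, t) : (R * R)%type), W p.1 p.2.
Proof.
move=> [Iu tT Uut].
have n1 : nbhs ((u, t) : (R * R)%type) [set p | I p.1].
  have n : nbhs u I by exact: open_nbhs_nbhs.
  have c : {for (u, t), continuous (@fst R R)} by exact: cvg_fst.
  exact: (c _ n).
have n2 : nbhs ((u, t) : (R * R)%type) [set p | p.2 < T1].
  have n : nbhs t [set s | s < T1] by apply: open_nbhs_nbhs; split => //; exact: open_lt.
  have c : {for (u, t), continuous (@snd R R)} by exact: cvg_snd.
  exact: (c _ n).
have n3 : nbhs ((u, t) : (R * R)%type) [set p | U (p.1, Num.max 0 p.2)].
  have n : nbhs ((u, Num.max 0 t) : (R * R)%type) U by exact: open_nbhs_nbhs.
  exact: (@clampt_c u t _ n).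
by apply: filterS3 n1 n2 n3 => p h1 h2 h3; split.
Qed.

Let W_near1 u t : W u t -> \forall v \near u, W v t.
Proof.
move=> /W_near n; have c : {for u, continuous (fun v : R => (v, t))}.
  by apply: cont_pair; [exact: cvg_id|exact: cvg_cst].
exact: (c _ n).
Qed.

Let W_near2 u t : W u t -> \forall s \near t, W u s.
Proof.
move=> /W_near n; have c : {for t, continuous (fun s : R => (u, s))}.
  by apply: cont_pair; [exact: cvg_cst|exact: cvg_id].
exact: (c _ n).
Qed.

Let ag_du s h u t : ag s h -> W u t -> isD (h ^~ t) u (coord b (G ((1, 0) :: s) (u, Num.max 0 t))).
Proof.
move=> hs Wut; have [_ _ Uut] := Wut.
apply: isD_near (isD_dir1 b (sg s Uut)).
by apply: filterS (W_near1 Wut) => v Wvt; rewrite hs.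
Qed.

Let agp_du s h u t : agp s h -> W u t -> 0 < t -> isD (h ^~ t) u (coord b (G ((1, 0) :: s) (u, t))).
Proof.
move=> hs Wut t0; have [_ _] := Wut; rewrite (max_idPr (ltW t0)) => Uut.
apply: isD_near (isD_dir1 b (sg s Uut)).
by apply: filterS (W_near1 Wut) => v Wvt; rewrite hs.
Qed.

Let agp_dt s h u t : agp s h -> W u t -> 0 < t -> isD (h u) t (coord b (G ((0, 1) :: s) (u, t))).
Proof.
move=> hs Wut t0; have [_ _] := Wut; rewrite (max_idPr (ltW t0)) => Uut.
apply: isD_near (isD_dir2 b (sg s Uut)).
have n : \forall s \near t, 0 < s by exact: lt_nbhsr.
by apply: filterS2 (W_near2 Wut) n => v Wvt v0; rewrite hs.
Qed.

Let ag_c s h u t : ag s h -> W u t -> cont2 h u t.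
Proof.
move=> hs Wut; have [_ _ Uut] := Wut.
have c : {for (u, t), continuous (fun p : R * R => coord b (G s (p.1, Num.max 0 p.2)))}.
  apply: (@continuous_comp _ _ _ (fun p : R * R => (p.1, Num.max 0 p.2)) (fun p => coord b (G s p))).
    exact: clampt_c.
  apply: continuous_comp; last exact: coord_c.
  exact: differentiable_continuous (sg s Uut).
have E : \forall p \near ((u, t) : (R * R)%type), coord b (G s (p.1, Num.max 0 p.2)) = h p.1 p.2.
  by apply: filterS (W_near Wut) => p Wp; rewrite hs.
rewrite /cont2 /prop_for /continuous_at /= hs//.
exact: cvg_trans (near_eq_cvg E) c.
Qed.

Let agp_c s h u t : agp s h -> W u t -> 0 < t -> cont2 h u t.
Proof.
move=> hs Wut t0; have [_ _] := Wut; rewrite (max_idPr (ltW t0)) => Uut.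
have c : {for (u, t), continuous (fun p : R * R => coord b (G s p))}.
  apply: continuous_comp; last exact: coord_c.
  exact: differentiable_continuous (sg s Uut).
have n : \forall p \near ((u, t) : (R * R)%type), 0 < p.2.
  have n : nbhs t [set s | 0 < s] by exact: lt_nbhsr.
  have c' : {for (u, t), continuous (@snd R R)} by exact: cvg_snd.
  exact: (c' _ n).
have E : \forall p \near ((u, t) : (R * R)%type), coord b (G s p) = h p.1 p.2.
  by apply: filterS2 (W_near Wut) n => -[v r] Wp v0; rewrite hs.
rewrite /cont2 /prop_for /continuous_at /= hs//.
exact: cvg_trans (near_eq_cvg E) c.
Qed.

(** [f1t] and [f2t] differentiate in [t] last; this identifies them with the [u]-derivatives of [ft]
    and [f1t]. *)
Let schwarz s u t : W u t -> 0 < t ->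
  coord b (G [:: (1, 0), (0, 1) & s] (u, t)) = coord b (G [:: (0, 1), (1, 0) & s] (u, t)).
Proof.
move=> [Iu tT]; move=> + t0; rewrite (max_idPr (ltW t0)) => Uut.
have /nbhs_ballP[r /= r0 Hr] : nbhs ((u, t) : (R * R)%type) U by exact: open_nbhs_nbhs.
have c2 s' : cont2 (fun u t => coord b (G s' (u, t))) u t.
  have c : {for (u, t), continuous (fun p : R * R => coord b (G s' p))}.
    apply: continuous_comp; last exact: coord_c.
    exact: differentiable_continuous (sg s' Uut).
  rewrite /cont2 (_ : (fun p : R * R => _) = (fun p => coord b (G s' p)))//.
  by apply/funext => -[].
symmetry; apply: (@mixed_partials R (fun u t => coord b (G s (u, t))) (fun u t => coord b (G ((1,
  0) :: s) (u, t)))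
  (fun u t => coord b (G ((0, 1) :: s) (u, t))) (fun u t => coord b (G [:: (0, 1), (1, 0) & s] (u, t)))
  (fun u t => coord b (G [:: (1, 0), (0, 1) & s] (u, t))) u t r r0) => [v w hv hw| |]; [|exact: c2|exact: c2].
have Uvw : U (v, w) by apply: Hr; split; rewrite /ball /= ltr_norml; lra.
split; [exact: isD_dir1 b (sg s Uvw)|exact: isD_dir2 b (sg s Uvw)|
  exact: isD_dir2 b (sg ((1, 0) :: s) Uvw)|exact: isD_dir1 b (sg ((0, 1) :: s) Uvw)].
Qed.

Let ag0 : ag [::] f.
Proof.
move=> u t [Iu tT Uut]; rewrite /f /G /= fg//; split => //=.
by rewrite le_max lexx /= gt_max T10.
Qed.

Let ag1 : ag [:: (1, 0)] f1.
Proof. by move=> u t Wut; exact: (isD_derive1 (ag_du ag0 Wut)). Qed.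

Let ag2 : ag [:: (1, 0); (1, 0)] f2.
Proof. by move=> u t Wut; exact: (isD_derive1 (ag_du ag1 Wut)). Qed.

Let agt : agp [:: (0, 1)] ft.
Proof. by move=> u t Wut t0; exact: (isD_derive1 (agp_dt (agp_of ag0) Wut t0)). Qed.

Let ag1t : agp [:: (0, 1); (1, 0)] f1t.
Proof. by move=> u t Wut t0; exact: (isD_derive1 (agp_dt (agp_of ag1) Wut t0)). Qed.

Let ag2t : agp [:: (0, 1); (1, 0); (1, 0)] f2t.
Proof. by move=> u t Wut t0; exact: (isD_derive1 (agp_dt (agp_of ag2) Wut t0)). Qed.

Let local_u u t : W u t -> [/\ isD (f ^~ t) u (f1 u t), isD (f1 ^~ t) u (f2 u t),
  isD (f2 ^~ t) u (f3 u t), cont2 f u t & cont2 f1 u t /\ cont2 f2 u t].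
Proof.
move=> Wut; split.
- by rewrite ag1//; exact: ag_du ag0 Wut.
- by rewrite ag2//; exact: ag_du ag1 Wut.
- by have H := ag_du ag2 Wut; rewrite /f3 (isD_derive1 H).
- exact: ag_c ag0 Wut.
- by split; [exact: ag_c ag1 Wut|exact: ag_c ag2 Wut].
Qed.

Let local_t u t : W u t -> 0 < t -> [/\ isD (f u) t (ft u t), isD (f1 u) t (f1t u t),
  isD (f2 u) t (f2t u t), isD (ft ^~ t) u (f1t u t) & [/\ isD (f1t ^~ t) u (f2t u t),
  cont2 ft u t, cont2 f1t u t & cont2 f2t u t]].
Proof.
move=> Wut t0; split; [..|split].
- by rewrite agt//; exact: agp_dt (agp_of ag0) Wut t0.
- by rewrite ag1t//; exact: agp_dt (agp_of ag1) Wut t0.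
- by rewrite ag2t//; exact: agp_dt (agp_of ag2) Wut t0.
- by rewrite ag1t// -schwarz//; exact: agp_du agt Wut t0.
- by rewrite ag2t// -schwarz//; exact: agp_du ag1t Wut t0.
- exact: agp_c agt Wut t0.
- exact: agp_c ag1t Wut t0.
- exact: agp_c ag2t Wut t0.
Qed.

Lemma jet_local u t : I u -> t < T1 -> U (u, Num.max 0 t) ->
  [/\ isD (f ^~ t) u (f1 u t), isD (f1 ^~ t) u (f2 u t),
  isD (f2 ^~ t) u (f3 u t), cont2 f u t & cont2 f1 u t /\ cont2 f2 u t] /\
  (0 < t -> [/\ isD (f u) t (ft u t), isD (f1 u) t (f1t u t),
  isD (f2 u) t (f2t u t), isD (ft ^~ t) u (f1t u t) & [/\ isD (f1t ^~ t) u (f2t u t),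
  cont2 ft u t, cont2 f1t u t & cont2 f2t u t]]).
Proof. by move=> Iu tT Uut; split; [exact: local_u|exact: local_t]. Qed.

End Local.

Lemma smooth_jet : exists J : jet I T1, forall u t, I u -> t < T1 ->
  j0 J u t = coord b (gamma (u, Num.max 0 t)) /\ isD (j0 J ^~ t) u (j1 J u t).
Proof.
have H u t : I u -> t < T1 ->
  [/\ isD (f ^~ t) u (f1 u t), isD (f1 ^~ t) u (f2 u t),
  isD (f2 ^~ t) u (f3 u t), cont2 f u t & cont2 f1 u t /\ cont2 f2 u t] /\
  (0 < t -> [/\ isD (f u) t (ft u t), isD (f1 u) t (f1t u t),
  isD (f2 u) t (f2t u t), isD (ft ^~ t) u (f1t u t) & [/\ isD (f1t ^~ t) u (f2t u t),
  cont2 ft u t, cont2 f1t u t & cont2 f2t u t]]).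
  move=> Iu tT; have [|U [g [oU Ug sg fg]]] := smooth (p := (u, Num.max 0 t)).
    by split => //=; rewrite le_max lexx /= gt_max T10.
  exact: (jet_local oU sg fg).
unshelve eexists (@Jet R I T1 f f1 f2 f3 ft f1t f2t _ _ _ _ _ _ _ _ _ _ _ _ _ _).
- by move=> u t Iu /andP[t0 tT]; case: (H u t Iu tT) => -[h _ _ _ _] _; exact: h.
- by move=> u t Iu /andP[t0 tT]; case: (H u t Iu tT) => -[_ h _ _ _] _; exact: h.
- by move=> u t Iu /andP[t0 tT]; case: (H u t Iu tT) => -[_ _ h _ _] _; exact: h.
- by move=> u t Iu /andP[t0 tT]; case: (H u t Iu tT) => _ /(_ t0)[h _ _ _ _]; exact: h.
- by move=> u t Iu /andP[t0 tT]; case: (H u t Iu tT) => _ /(_ t0)[_ h _ _ _]; exact: h.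
- by move=> u t Iu /andP[t0 tT]; case: (H u t Iu tT) => _ /(_ t0)[_ _ _ h _]; exact: h.
- by move=> u t Iu /andP[t0 tT]; case: (H u t Iu tT) => _ /(_ t0)[_ _ h _ _]; exact: h.
- by move=> u t Iu /andP[t0 tT]; case: (H u t Iu tT) => _ /(_ t0)[_ _ _ _ []].
- by move=> u t Iu tT; case: (H u t Iu tT) => -[].
- by move=> u t Iu tT; case: (H u t Iu tT) => -[_ _ _ _ []].
- by move=> u t Iu tT; case: (H u t Iu tT) => -[_ _ _ _ []].
- by move=> u t Iu /andP[t0 tT]; case: (H u t Iu tT) => _ /(_ t0)[_ _ _ _ []].
- by move=> u t Iu /andP[t0 tT]; case: (H u t Iu tT) => _ /(_ t0)[_ _ _ _ []].
- by move=> u t Iu /andP[t0 tT]; case: (H u t Iu tT) => _ /(_ t0)[_ _ _ _ []].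
by move=> u t Iu tT; split => //; case: (H u t Iu tT) => -[h _ _ _ _] _; exact: h.
Qed.

End SmoothJet.

(** * Smoothness of time slices *)

Section Slices.
Context {R : realType}.

Lemma isD_cvg (f : R -> R) (u l : R) : isD f u l ->
  (fun h : R => h^-1 *: (f (h + u) - f u)) @ 0^' --> l.
Proof.
move=> [/cvg_ex[k Hk] dl]; have := cvg_lim (@Rhausdorff R) Hk; rewrite [lim _]dl => ->.
rewrite [X in X @ _ --> _](_ : _ = (fun h : R => h^-1 *: ((f \o shift u) (h *: 1) - f u)))//.
by apply/funext => h; rewrite /= -[h *: 1]/(h * 1) mulr1.
Qed.

Lemma derive1_pair (c : R -> R * R) (u x y : R) : isD (fun v => (c v).1) u x ->
  isD (fun v => (c v).2) u y -> derive1 c u = (x, y).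
Proof.
move=> /isD_cvg H1 /isD_cvg H2.
have H := cvg_pair H1 H2; apply/cvg_lim => //.
have -> : (fun h : R => h^-1 *: (c (h + u) - c u)) =
    (fun h => (h^-1 *: ((c (h + u)).1 - (c u).1), h^-1 *: ((c (h + u)).2 - (c u).2))) by [].
exact: H.
Qed.

(** [embedded] yields an immersion only for smooth curves, so smoothness has to pass from the flow
    to its slices. Iterated derivatives of a slice along [a] are those of the flow along
    [(a, 0)]. *)
Lemma slice_smooth (I J : set R) (gamma : R * R -> R * R) (s : R) : open I -> J s ->
  smooth_on (I `*` J) gamma -> smooth_on I (slice gamma s).
Proof.
move=> oI Js sm p Ip; have [|U [g [oU Up sg fg]]] := sm (p, s); first by split.
have cs (v : R) : {for v, continuous (fun v : R => (v, s))}.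
  by apply: cont_pair; [exact: cvg_id|exact: cvg_cst].
pose V := I `&` (fun v : R => (v, s)) @^-1` U.
have oV : open V.
  by apply: openI => //; apply: open_comp => // x _; exact: cs.
exists V, (fun v => g (v, s)); split => //; last by move=> v [Iv Uv] _; exact: fg.
pose G l := foldr (fun v (g : R * R -> R * R) x => 'D_v g x) g l.
pose K l := foldr (fun v (g : R -> R * R) x => 'D_v g x) (fun v => g (v, s)) l.
have step l : (forall v, V v -> K l v = G [seq (a, 0) | a <- l] (v, s)) -> forall a v : R, V v ->
    (fun h : R => h^-1 *: (K l (h *: a + v) - K l v)) @ 0^' --> 'D_(a, 0) (G [seq (a, 0) | a <- l]) (v, s).
  move=> Kl a v Vv; have [_ Uv] := Vv.
  set m := [seq (a, 0) | a <- l].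
  have H : (fun h : R => h^-1 *: (G m (h *: (a, 0) + (v, s)) - G m (v, s))) @ 0^' --> 'D_(a, 0) (G m) (v, s).
    have dG : differentiable (G m) (v, s) := sg m _ Uv.
    exact: diff_derivable.
  refine (cvg_trans (near_eq_cvg _) H).
  have n : \forall h \near (0 : R)^', V (h *: a + v).
    have c : {for 0, continuous (fun h : R => h *: a + v)}.
      by apply: cvgD; [apply: cvgZr_tmp; exact: cvg_id|exact: cvg_cst].
    have nV : nbhs (0 *: a + v) V by rewrite scale0r add0r; exact: open_nbhs_nbhs.
    exact: (nbhs_dnbhs (c _ nV)).
  apply: filterS n => h Vh; rewrite /= !Kl//; congr (_ *: (G _ _ - _)).
  by rewrite [LHS]surjective_pairing /= -[h *: 0]/(h * 0) mulr0 add0r.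
have KG l : forall v, V v -> K l v = G [seq (a, 0) | a <- l] (v, s).
  elim: l => [//|a l IH] v Vv.
  exact: (cvg_lim (@norm_hausdorff _ _) (step l IH a v Vv)).
move=> l v Vv; apply/derivable1_diffP/cvg_ex; exists ('D_(1, 0) (G [seq (a, 0) | a <- l]) (v, s)).
exact: (step l (KG l) 1 v Vv).
Qed.

End Slices.

(** * The flow record of a uniformly proper solution *)

Section Bridge.
Context {R : realType}.
Variables (I : set R) (T : \bar R) (gamma : R * R -> R * R) (T1 : R).
Hypothesis oI : open I.
Hypothesis iI : is_interval I.
Hypothesis I0 : exists u, I u.
Hypothesis T10 : 0 < T1.
Hypothesis T1T : forall s, 0 <= s < T1 -> times0 T s.
Hypothesis proper : uniformly_proper_csf I T gamma.
Hypothesis smooth : smooth_down_to_zero I T gamma.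

Lemma isD_uniq (f : R -> R) (x l m : R) : isD f x l -> isD f x m -> l = m.
Proof. by move=> [_ <-] [_ <-]. Qed.

Lemma flow_of : exists F : flow I T1, forall u t, I u -> 0 <= t < T1 ->
  j0 (fX F) u t = (gamma (u, t)).1 /\ j0 (fY F) u t = (gamma (u, t)).2.
Proof.
have [_ _ prop emb csf] := proper.
have T10' := T10.
have sm1 : smooth_on (I `*` [set t | 0 <= t < T1]) gamma.
  move=> [u t] [/= Iu ht]; have [|U [g [oU Ug sg fg]]] := smooth (p := (u, t)).
    by split => //=; exact: T1T.
  by exists U, g; split => // q Uq [Iq tq]; apply: fg => //; split => //; exact: T1T.
have [JX HX] := smooth_jet true oI T10 sm1.
have [JY HY] := smooth_jet false oI T10 sm1.
have slX u s : I u -> 0 <= s < T1 -> isD (fun v => (gamma (v, s)).1) u (j1 JX u s).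
  move=> Iu hs; have [_ H] := HX u s Iu ltac:(lra).
  apply: isD_near H; have n : \forall v \near u, I v by exact: open_nbhs_nbhs.
  apply: filterS n => v Iv; have [-> _] := HX v s Iv ltac:(lra).
  by rewrite /coord (max_idPr _)//; lra.
have slY u s : I u -> 0 <= s < T1 -> isD (fun v => (gamma (v, s)).2) u (j1 JY u s).
  move=> Iu hs; have [_ H] := HY u s Iu ltac:(lra).
  apply: isD_near H; have n : \forall v \near u, I v by exact: open_nbhs_nbhs.
  apply: filterS n => v Iv; have [-> _] := HY v s Iv ltac:(lra).
  by rewrite /coord (max_idPr _)//; lra.
have d1 u s : I u -> 0 <= s < T1 -> derive1 (slice gamma s) u = (j1 JX u s, j1 JY u s).
  by move=> Iu hs; apply: derive1_pair; [exact: slX|exact: slY].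
have reg0 u s : I u -> 0 <= s < T1 -> 0 < j1 JX u s ^+ 2 + j1 JY u s ^+ 2.
  move=> Iu hs; have [_ _ /(_ _ u Iu) H] := emb s (T1T hs).
  have /H : smooth_on I (slice gamma s) by apply: (slice_smooth oI _ smooth); exact: T1T.
  rewrite d1// => ne; rewrite lt_neqAle addr_ge0 ?sqr_ge0// andbT eq_sym paddr_eq0 ?sqr_ge0// !sqrf_eq0.
  by apply: contraNN ne => /andP[/eqP -> /eqP ->].
(* For negative times the first derivatives are those at time [0], which extends regularity to all
   [t < T1]. *)
have clX u t : I u -> t < T1 -> j1 JX u t = j1 JX u (Num.max 0 t) /\ j1 JY u t = j1 JY u (Num.max 0 t).
  move=> Iu tT; have hm : 0 <= Num.max 0 t < T1 by rewrite le_max lexx /= gt_max T10.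
  have n : \forall v \near u, I v by exact: open_nbhs_nbhs.
  split.
    have [_ H] := HX u t Iu tT; apply: isD_uniq (slX u _ Iu hm); apply: isD_near H.
    by apply: filterS n => v Iv; have [-> _] := HX v t Iv tT.
  have [_ H] := HY u t Iu tT; apply: isD_uniq (slY u _ Iu hm); apply: isD_near H.
  by apply: filterS n => v Iv; have [-> _] := HY v t Iv tT.
have X0 u t : I u -> 0 <= t < T1 -> j0 JX u t = (gamma (u, t)).1.
  by move=> Iu /andP[t0 tT]; have [-> _] := HX u t Iu tT; rewrite /coord (max_idPr t0).
have Y0 u t : I u -> 0 <= t < T1 -> j0 JY u t = (gamma (u, t)).2.
  by move=> Iu /andP[t0 tT]; have [-> _] := HY u t Iu tT; rewrite /coord (max_idPr t0).
have eq0 u t : I u -> 0 < t < T1 ->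
    j1 JX u t * jt JY u t - j1 JY u t * jt JX u t =
    (j1 JX u t * j2 JY u t - j1 JY u t * j2 JX u t) / (j1 JX u t ^+ 2 + j1 JY u t ^+ 2).
  move=> Iu ht; have ht' : 0 <= t < T1 by lra.
  have q0 := reg0 u t Iu ht'.
  have tT : times T t by have [h1 h2] := T1T ht'; split => //; lra.
  have := csf u t Iu tT; rewrite /csf_equation /curvature opprK /curvature_vector.
  have nt : \forall s \near t, 0 < s < T1 by apply: near_in_itvoo; rewrite in_itv.
  have -> : derive1 (fun s => gamma (u, s)) t = (jt JX u t, jt JY u t).
    apply: derive1_pair.
      by apply: isD_near (j0_dt JX Iu ht); apply: filterS nt => s hs; apply: X0 => //; lra.
    by apply: isD_near (j0_dt JY Iu ht); apply: filterS nt => s hs; apply: Y0 => //; lra.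
  pose S v := Num.sqrt (j1 JX v t ^+ 2 + j1 JY v t ^+ 2).
  have tan v : I v -> unit_tangent (slice gamma t) v = (j1 JX v t / S v, j1 JY v t / S v).
    move=> Iv; rewrite /unit_tangent d1// /enorm /dot /= -!expr2 -/(S v).
    by congr pair; exact: mulrC.
  have S0 : 0 < S u by rewrite sqrtr_gt0.
  have S2 : S u ^+ 2 = j1 JX u t ^+ 2 + j1 JY u t ^+ 2 by rewrite sqr_sqrtr// ltW.
  pose th := (j1 JX u t * j2 JY u t - j1 JY u t * j2 JX u t) / (j1 JX u t ^+ 2 + j1 JY u t ^+ 2).
  have n : \forall v \near u, I v by exact: open_nbhs_nbhs.
  have -> : derive1 (unit_tangent (slice gamma t)) u = (- j1 JY u t / S u * th, j1 JX u t / S u * th).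
    apply: derive1_pair.
      have H := unit_deriv 1 0 (j1_du JX Iu ht') (j1_du JY Iu ht') q0.
      apply: isD_near (isD_eq H _); last by rewrite mul0r add0r mulN1r.
      by apply: filterS n => v Iv; rewrite tan//= mul1r mul0r addr0.
    have H := unit_deriv 0 1 (j1_du JX Iu ht') (j1_du JY Iu ht') q0.
    apply: isD_near (isD_eq H _); last by rewrite mul1r oppr0 mul0r addr0.
    by apply: filterS n => v Iv; rewrite tan//= mul1r mul0r add0r.
  rewrite /unit_normal tan// /rot90 /dot /enorm d1//= -/th => E.
  have dS : Num.sqrt (dot (j1 JX u t, j1 JY u t) (j1 JX u t, j1 JY u t)) = S u by rewrite /dot /= -!expr2.
  rewrite dS -![_ *: _]/(_ * _) in E.
  have Sn : S u != 0 by rewrite gt_eqF.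
  have e1 : j1 JX u t * jt JY u t - j1 JY u t * jt JX u t =
     S u * (jt JX u t * - (j1 JY u t / S u) + jt JY u t * (j1 JX u t / S u)) by field.
  rewrite e1 E -/th.
  transitivity (th * (j1 JX u t ^+ 2 + j1 JY u t ^+ 2) / S u ^+ 2); first by field.
  by rewrite -S2; field.
have reg u t : I u -> t < T1 -> 0 < j1 JX u t ^+ 2 + j1 JY u t ^+ 2.
  move=> Iu tT; have [-> ->] := clX u t Iu tT.
  by apply: reg0 => //; rewrite le_max lexx /= gt_max T10.
unshelve eexists (@Flow R I T1 JX JY _ _ reg eq0 _ _).
- move=> u Iu; have /nbhs_ballP[e /= e0 He] : nbhs u I by exact: open_nbhs_nbhs.
  by exists e => // v hv; apply: He; rewrite /ball /= ltr_norml; lra.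
- by move=> u v w Iu Iv hw; exact: (iI Iu Iv hw).
- move=> u v t Iu Iv ht; rewrite !X0// !Y0// => eX eY.
  have [_ [g _ gK] _] := emb t (T1T ht).
  by rewrite -(gK u Iu) -(gK v Iv) /slice [gamma (u, t)]surjective_pairing eX eY -surjective_pairing.
- move=> B t0 t0T; have [u0 Iu0] := I0.
  have triv : (forall u t, I u -> 0 <= t <= t0 -> j0 JX u t ^+ 2 + j0 JY u t ^+ 2 <= B -> False) ->
      exists c d, [/\ I c, I d, c <= d & forall u t, I u -> 0 <= t <= t0 ->
        j0 JX u t ^+ 2 + j0 JY u t ^+ 2 <= B -> c <= u <= d].
    by move=> H; exists u0, u0; split => // u t Iu ht /(H u t Iu ht).
  have [t00|t00] := ltP t0 0; first by apply: triv => u t _ ht _; lra.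
  (* A square around the disc [x^2 + y^2 <= B]. Properness makes its preimage compact, and the
     extreme values of [u] there bound the parameters. *)
  pose K : set (R * R) := `[- (`|B| + 1), `|B| + 1] `*` `[- (`|B| + 1), `|B| + 1].
  have cK : compact K by apply: compact_setX; exact: segment_compact.
  have sub : `[0, t0] `<=` times0 T by move=> s; rewrite /= in_itv/= => hs; apply: T1T; lra.
  have cQ := prop 0 t0 sub K cK.
  set Q := _ `&` _ in cQ.
  have inQ u t : I u -> 0 <= t <= t0 -> j0 JX u t ^+ 2 + j0 JY u t ^+ 2 <= B -> Q (u, t).
    move=> Iu ht; have ht' : 0 <= t < T1 by lra.
    rewrite X0// Y0// => hB; split; first by split; rewrite //= in_itv.
    have B0 := ler_norm B; have B1 := normr_ge0 B.
    have bd x y : x ^+ 2 + y ^+ 2 <= B -> - (`|B| + 1) <= x <= `|B| + 1.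
      move=> h; rewrite -ler_norml ler_norm_sqr; last by lra.
      by have := sqr_ge0 y; have := sqr_ge0 `|B|; rewrite sqrrD; lra.
    by split; rewrite /= in_itv/=; [apply: bd hB|apply: (bd _ (gamma (u, t)).1); rewrite addrC].
  have [Q0|Q0] := pselect (Q !=set0); last by apply: triv => u t Iu ht hB; apply: Q0; exists (u, t);
    exact: inQ.
  have cf : {within Q, continuous (@fst R R)}.
    by apply: continuous_subspaceT => x; exact: cvg_fst.
  have [p + pmax] := compact_EVT_max Q0 cQ cf; have [p' + pmin] := compact_EVT_min Q0 cQ cf.
  rewrite !inE => -[[Ip' _] _] [[Ip _] _].
  exists p'.1, p.1; split => //.
    have [q Qq] := Q0; have hq : q \in Q by rewrite inE.
    exact: le_trans (pmin q hq) (pmax q hq).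
  move=> u t Iu ht hB; have hq : (u, t) \in Q by rewrite inE; exact: inQ.
  by rewrite (pmin _ hq) (pmax _ hq).
by move=> u t Iu ht /=; rewrite X0// Y0.
Qed.

End Bridge.

(** * The orientation of a radial end *)

Section RadialEndOf.
Context {R : realType} {I : set R} {T1 : R} (F : flow I T1).
Local Notation X := (j0 (fX F)). Local Notation Y := (j0 (fY F)).
Local Notation a := (j1 (fX F)). Local Notation b := (j1 (fY F)).
Local Notation nu := (tdot F).

(** On a ray the tangent is plus or minus its direction, with constant sign by continuity. With the
    minus sign the distance from the origin would not increase along the rest of the end, which
    would stay in a disc, against properness. *)
Lemma radial_end_of u2 e1 e2 : 0 < T1 -> e1 ^+ 2 + e2 ^+ 2 = 1 -> I u2 ->
  (forall u, I u -> u2 < u -> exists2 r, 0 <= r & X u 0 = r * e1 /\ Y u 0 = r * e2) ->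
  exists ub, radial_end F ub e1 e2.
Proof.
move=> T10 ee Iu2 ray; have T00 : 0 <= (0 : R) < T1 by lra.
have [e e0 He] := f_open F Iu2.
pose ub := u2 + e / 2; have Iub : I ub by apply: He; rewrite /ub; lra.
have u2ub : u2 < ub by rewrite /ub; lra.
exists ub; split => //.
  by move=> u Iu ubu; apply: ray => //; lra.
have mu0 u : I u -> u2 < u -> e2 * a u 0 + - e1 * b u 0 = 0.
  move=> Iu hu; have H := isD_add (isD_mul (isD_cst e2 u) (j0_du (fX F) Iu T00))
    (isD_mul (isD_cst (- e1) u) (j0_du (fY F) Iu T00)).
  have [e' e'0 He'] := f_open F Iu.
  have H0 : isD (fun v => e2 * X v 0 + - e1 * Y v 0) u 0.
    apply: isD_near (isD_cst 0 u).
    have [m1 m2] : Num.min e' (u - u2) <= e' /\ Num.min e' (u - u2) <= u - u2.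
      by rewrite !ge_min !lexx orbT.
    apply/nbhs_ballP; exists (Num.min e' (u - u2)) => /=; first by rewrite lt_min e'0 subr_gt0.
    move=> v; rewrite /ball /= ltr_norml => hv.
    have [||r _ [-> ->]] := ray v; [apply: He'; lra|lra|ring].
  by apply: isD_uniq (isD_eq H _) H0; ring.
have nu1 u : I u -> u2 < u -> nu e1 e2 u 0 ^+ 2 = 1.
  move=> Iu hu; have := tdot_sqr F ee Iu T10.
  by rewrite {2}/tdot mu0// mul0r expr0n /= addr0.
move=> u Iu ubu; have /eqP := nu1 u Iu ltac:(lra).
rewrite sqrf_eq1 => /orP[/eqP //|/eqP nuN1]; exfalso.
have nuneg v : I v -> u <= v -> nu e1 e2 v 0 < 0.
  move=> Iv uv; rewrite ltNge; apply/negP => nv.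
  have Iw w : u <= w <= v -> I w by exact: (f_itv F Iu Iv).
  have [||w hw w0] := @ivt R u v (nu e1 e2 ^~ 0) 0 uv.
  - by apply: isD_cont_on => w hw; exact: isD_tdot_u (Iw w hw) T00.
  - by rewrite nuN1 nv; lra.
  have := nu1 w (Iw w hw) ltac:(lra); rewrite w0 expr0n /= => /eqP.
  by rewrite eq_sym oner_eq0.
pose l v := e1 * X v 0 + e2 * Y v 0.
have rE v : I v -> u2 < v -> 0 <= l v /\ X v 0 ^+ 2 + Y v 0 ^+ 2 = l v ^+ 2.
  move=> Iv hv; have [r r0 [eX eY]] := ray v Iv hv.
  have -> : l v = r by rewrite /l eX eY -[RHS]mulr1 -ee; ring.
  by split => //; rewrite eX eY !exprMn -mulrDr ee mulr1.
have [c [d [Ic Id cd Hcd]]] := f_proper F (l u ^+ 2) T10.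
have [e' e'0 He'] := f_open F Id.
pose v := Num.max u (d + e' / 2).
have [uv dv] : u <= v /\ d + e' / 2 <= v by rewrite !le_max !lexx orbT.
have Iv : I v by rewrite /v; case: (leP u (d + e' / 2)) => // _; apply: He'; lra.
have lv : - l u <= - l v.
  apply: (isD_nondecr (f := fun w => - l w) (f' := fun w => - (e1 * a w 0 + e2 * b w 0)) uv) => w hw.
    have Iw : I w by exact: (f_itv F Iu Iv hw).
    apply: isD_opp; apply: (isD_eq (isD_add (isD_mul (isD_cst e1 w) (j0_du (fX F) Iw T00))
      (isD_mul (isD_cst e2 w) (j0_du (fY F) Iw T00)))); ring.
  have Iw : I w by exact: (f_itv F Iu Iv hw).
  rewrite tdot_speed// oppr_ge0; apply: mulr_ge0_le0; first exact: sqrtr_ge0.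
  by apply/ltW/nuneg => //; lra.
have [lu0 _] := rE u Iu ltac:(lra). have [lv0 E] := rE v Iv ltac:(lra).
have : c <= v <= d.
  apply: (Hcd v 0) => //; first by rewrite lexx.
  by rewrite E ler_pXn2r// ?nnegrE// -lerN2.
lra.
Qed.

End RadialEndOf.

Section SweptArea.
Context {R : realType}.

Lemma swept_area_primitive (c : R -> R * R) (A f : R -> R) (v w : R) : v <= w ->
  (forall u, v <= u <= w -> isD A u (2^-1 * f u)) -> cont_on v w f ->
  (forall u, v <= u <= w -> star_wedge (derive1 c u) (c u) = f u) ->
  swept_area c v w = A w - A v.
Proof.
move=> + dA cf fE; rewrite le_eqVlt => /predU1P[->|vw].
  by rewrite /swept_area set_itv1 Rintegral_set1 mulr0 subrr.
have dB u : v <= u <= w -> isD (fun u => 2 * A u) u (f u).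
  by move=> hu; apply: (isD_eq (isD_mul (isD_cst 2 u) (dA u hu))); field.
have E : (\int[@lebesgue_measure R]_(x in `[v, w]) (f x)%:E = (2 * A w)%:E - (2 * A v)%:E)%E.
  apply: (@continuous_FTC2 R f (fun u => 2 * A u)) => //.
  - exact: cont_on_within.
  - split.
    + by move=> x; rewrite in_itv/= => hx; have [] := dB x ltac:(lra).
    + by apply: cvg_at_right_filter; apply: isD_cont (dB v ltac:(lra)).
    + by apply: cvg_at_left_filter; apply: isD_cont (dB w ltac:(lra)).
  - by move=> x; rewrite in_itv/= => hx; rewrite derive1E; have [] := dB x ltac:(lra).
rewrite /swept_area; under eq_Rintegral => x.
  rewrite inE /= in_itv/= => hx; rewrite fE//; over.
by rewrite /Rintegral E /=; field.
Qed.

End SweptArea.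

(** * Graphs over lines *)

Section Crossing.
Context {R : realType}.

(** Along the end the component across the ray is bounded, so the component along it, with
    coefficient [p * e1 + q * e2], decides. *)
Lemma lin_unbounded (I : set R) (T1 : R) (F : flow I T1) ub e1 e2 t p q : radial_end F ub e1 e2 ->
  0 <= t < T1 ->
  0 < p * e1 + q * e2 -> forall M, exists2 u, I u & M < p * j0 (fX F) u t + q * j0 (fY F) u t.
Proof.
move=> rE ht al0 M; have [C C0 HC] := radial_end_bounds rE ht.
have [_ ee _ _] := rE.
pose be := `|q * e1 - p * e2|.
have [uc [Iuc ubuc Huc]] := radial_end_far rE ht ((M + be * C) / (p * e1 + q * e2)).
exists uc => //; have htt : 0 <= t <= t by lra.
have := Huc uc t Iuc (lexx _) htt; rewrite ltr_pdivrMr// => h1.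
have [h2 _] := HC uc t Iuc ubuc htt.
have -> : p * j0 (fX F) uc t + q * j0 (fY F) uc t =
    (e1 * j0 (fX F) uc t + e2 * j0 (fY F) uc t) * (p * e1 + q * e2) +
    (q * e1 - p * e2) * (e1 * j0 (fY F) uc t - e2 * j0 (fX F) uc t).
  by rewrite -[LHS]mul1r -ee; ring.
have h3 : `|(q * e1 - p * e2) * (e1 * j0 (fY F) uc t - e2 * j0 (fX F) uc t)| <= be * C.
  by rewrite normrM; apply: ler_wpM2l.
by move: h3; rewrite ler_norml; lra.
Qed.

Variables (I : set R) (T1 : R) (F : flow I T1) (t p q : R).
Hypothesis ht : 0 <= t < T1.
Hypothesis pos : forall u, I u -> 0 < p * j1 (fX F) u t + q * j1 (fY F) u t.

Lemma lin_deriv u : I u -> isD (fun u => p * j0 (fX F) u t + q * j0 (fY F) u t) u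
  (p * j1 (fX F) u t + q * j1 (fY F) u t).
Proof.
move=> Iu; apply: (isD_eq (isD_add (isD_mul (isD_cst p u) (j0_du (fX F) Iu ht))
  (isD_mul (isD_cst q u) (j0_du (fY F) Iu ht)))); ring.
Qed.

Lemma lin_inj u v : I u -> I v ->
  p * j0 (fX F) u t + q * j0 (fY F) u t = p * j0 (fX F) v t + q * j0 (fY F) v t -> u = v.
Proof.
have lem x y : I x -> I y -> x < y ->
    p * j0 (fX F) x t + q * j0 (fY F) x t < p * j0 (fX F) y t + q * j0 (fY F) y t.
  move=> Ix Iy xy; apply: (isD_incr (f := fun u => p * j0 (fX F) u t + q * j0 (fY F) u t) xy) => z hz.
    by apply: lin_deriv; exact: (f_itv F Ix Iy hz).
  by apply: pos; apply: (f_itv F Ix Iy); lra.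
move=> Iu Iv E; have [h|h|//] := ltgtP u v.
  by have := lem u v Iu Iv h; rewrite E ltxx.
by have := lem v u Iv Iu h; rewrite E ltxx.
Qed.

Lemma lin_onto ub e1 e2 ub' e1' e2' : radial_end F ub e1 e2 -> radial_end (flow_rev F) ub' e1' e2' ->
  0 < p * e1 + q * e2 -> 0 < - p * e1' + - q * e2' ->
  forall x, exists2 u, I u & p * j0 (fX F) u t + q * j0 (fY F) u t = x.
Proof.
move=> rR rL hR hL x.
have [v Iv hv] := lin_unbounded rR ht hR x.
have [w Iw hw] := lin_unbounded rL ht hL (- x).
rewrite /= in Iw hw; set w' := - w in Iw hw.
have hw' : p * j0 (fX F) w' t + q * j0 (fY F) w' t < x by lra.
have cf y z : I y -> I z -> cont_on y z (fun u => p * j0 (fX F) u t + q * j0 (fY F) u t).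
  by move=> Iy Iz; apply: isD_cont_on => u hu; apply: lin_deriv; exact: (f_itv F Iy Iz hu).
have [h|h] := leP w' v.
  by have [|u hu <-] := ivt (v := x) h (cf _ _ Iw Iv); [lra|exists u => //; exact: (f_itv F Iw Iv hu)].
by have [|u hu <-] := ivt_dec (v := x) (ltW h) (cf _ _ Iv Iw); [lra|exists u => //;
  exact: (f_itv F Iv Iw hu)].
Qed.

End Crossing.

Lemma Lnorm_oo_le {R : realType} (f : R -> R) (B : R) : 0 <= B -> (forall x, `|f x| <= B) ->
  (Lnorm (@lebesgue_measure R) +oo (EFin \o f) <= B%:E)%E.
Proof.
move=> B0 fB; rewrite unlock /Lnorm; case: ifPn => _; last by rewrite lee_fin.
by apply/ess_supP; apply: nearW => x; rewrite /= lee_fin.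
Qed.

Lemma sin_sector {R : realType} (w th : R) : 0 <= w -> w < th < pi - w ->
  `|cos th| * sin w < sin th * cos w.
Proof.
move=> w0 hth.
have : 0 < sin (th - w) by apply: sin_gt0_pi; lra.
have : 0 < sin (th + w) by apply: sin_gt0_pi; lra.
rewrite sinB sinD; have [_|_] := ger0P (cos th); lra.
Qed.

(** Tangents within [w] of the horizontal cross the line of angle [th] in one direction, so the
    linear form that vanishes on this line increases along the curve. *)
Lemma sector_transverse {R : realType} (w th a b : R) : 0 <= w -> w < th < pi - w -> 0 < cos w ->
  0 < a -> `|b| * cos w <= a * sin w -> 0 < sin th * a + - cos th * b.
Proof.
move=> w0 hth cw a0 h; have cth := sin_sector w0 hth.
have h1 : - (`|cos th| * `|b|) <= - cos th * b.
  by rewrite -normrM -[leRHS]opprK lerN2 mulNr opprK ler_norm.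
rewrite -(pmulr_rgt0 _ cw).
have h2 : `|cos th| * (`|b| * cos w) <= `|cos th| * (a * sin w) by apply: ler_wpM2l.
have h3 : `|cos th| * sin w * a < sin th * cos w * a by rewrite ltr_pM2r.
have h4 : cos w * - (`|cos th| * `|b|) <= cos w * (- cos th * b) by rewrite ler_pM2l.
lra.
Qed.

Lemma cos_gt0_acute {R : realType} (x : R) : 0 <= x -> x < pi / 2 -> 0 < cos x.
Proof. by move=> x0 x2; have pi0 := pi_gt0 R; apply: cos_gt0_pihalf; lra. Qed.

Lemma sin_ge0_acute {R : realType} (x : R) : 0 <= x -> x < pi / 2 -> 0 <= sin x.
Proof. by move=> x0 x2; have pi0 := pi_gt0 R; apply: sin_ge0_pi; lra. Qed.

Section ConeGraph.
Context {R : realType} {I : set R} {T1 : R}.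
Variables (F : flow I T1) (t phi psi ubR ubL : R) (g : R -> R * R).
Hypotheses (oI : open I) (ht0 : 0 <= t < T1) (phi0 : 0 <= phi) (phipsi : phi <= psi).
Hypothesis psi2 : psi < pi / 2.
Hypothesis gE : forall u, I u -> g u = (j0 (fX F) u t, j0 (fY F) u t).
Hypothesis rR : radial_end F ubR (cos phi) (sin phi).
Hypothesis rL : radial_end (flow_rev F) ubL (- cos phi) (sin phi).
Hypothesis cone : forall u, I u -> cos psi * Num.sqrt (speed2 F u t) <= j1 (fX F) u t.

Let psi0 : 0 <= psi := le_trans phi0 phipsi.

Let cpsi : 0 < cos psi := cos_gt0_acute psi0 psi2.
Let spsi : 0 <= sin psi := sin_ge0_acute psi0 psi2.
Let cphi : 0 < cos phi := cos_gt0_acute phi0 (le_lt_trans phipsi psi2).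
Let sphi : 0 <= sin phi := sin_ge0_acute phi0 (le_lt_trans phipsi psi2).

Let apos u : I u -> 0 < j1 (fX F) u t.
Proof.
move=> Iu; apply: lt_le_trans (cone Iu); rewrite mulr_gt0// sqrtr_gt0.
by apply: speed2_gt0 => //; case/andP: ht0.
Qed.

Let slope u : I u -> `|j1 (fY F) u t| * cos psi <= j1 (fX F) u t * sin psi.
Proof.
move=> Iu; have h := cone Iu; have a0 := apos Iu.
rewrite -[leLHS]ger0_norm; last by rewrite mulr_ge0// ltW.
rewrite ler_norm_sqr; last by rewrite mulr_ge0// ltW.
have h2 : (cos psi * Num.sqrt (speed2 F u t)) ^+ 2 <= j1 (fX F) u t ^+ 2.
  by rewrite ler_pXn2r// nnegrE ?mulr_ge0 ?sqrtr_ge0 ?(ltW a0) ?(ltW cpsi).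
rewrite !exprMn sqr_sqrtr in h2 *; last by rewrite ltW// speed2_gt0//; case/andP: ht0.
rewrite real_normK ?num_real//; have := cos2Dsin2 psi => c2.
have -> : sin psi ^+ 2 = 1 - cos psi ^+ 2 by rewrite -c2; ring.
by move: h2; rewrite /speed2; lra.
Qed.

(** The first coordinate is an increasing bijection from [I] to the line, with positive derivative;
    [y] is the second coordinate after its inverse. *)
Lemma cone_graph : exists y : R -> R, [/\ g @` I = range (fun x : R => (x, y x)),
  forall x, derivable y x 1 &
  (Lnorm (@lebesgue_measure R) +oo (EFin \o derive1 y) <= (tan psi)%:E)%E].
Proof.
have Xpos u : I u -> 0 < 1 * j1 (fX F) u t + 0 * j1 (fY F) u t.
  by move=> Iu; rewrite mul1r mul0r addr0; exact: apos.
have /choice[xinv Hx] : forall x, exists u, I u /\ j0 (fX F) u t = x.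
  move=> x.
  have [||u Iu E] := lin_onto (p := 1) (q := 0) ht0 rR rL _ _ x.
  - rewrite mul1r mul0r addr0; exact: cphi.
  - rewrite oppr0 mul0r addr0 mulN1r opprK; exact: cphi.
  by exists u; split => //; rewrite -E mul1r mul0r addr0.
have xK u : I u -> xinv (j0 (fX F) u t) = u.
  move=> Iu; have [Iv E] := Hx (j0 (fX F) u t).
  by apply: (lin_inj ht0 Xpos Iv Iu); rewrite E !mul0r.
pose y (x : R) : R := j0 (fY F) (xinv x) t.
have dy (x : R) : isD y x (j1 (fY F) (xinv x) t / j1 (fX F) (xinv x) t).
  have [Iu E] := Hx x; set u := xinv x in Iu E *.
  have n : \forall v \near u, I v by exact: open_nbhs_nbhs.
  have dinv : isD xinv x (j1 (fX F) u t)^-1.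
    rewrite -E; apply: (@is_derive_inverse R (j0 (fX F) ^~ t)).
    - by apply: filterS n => v; exact: xK.
    - by apply: filterS n => v Iv; exact: isD_cont (j0_du (fX F) Iv ht0).
    - exact: j0_du.
    - by rewrite gt_eqF// apos.
  exact: isD_comp dinv (j0_du (fY F) Iu ht0).
exists y; split.
- apply/seteqP; split => [p [u Iu <-]|p [x _ <-]].
    by exists (j0 (fX F) u t) => //; rewrite /y xK// gE.
  by have [Iu E] := Hx x; exists (xinv x) => //; rewrite gE// E.
- by move=> x; case: (dy x).
- apply: Lnorm_oo_le; first by rewrite /tan divr_ge0// ltW.
  move=> x; have [Iu _] := Hx x; rewrite derive1E; have [_ ->] := dy x.
  rewrite normrM normfV (gtr0_norm (apos Iu)) /tan ler_pdivrMr ?apos//.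
  by rewrite mulrAC ler_pdivlMr// [leRHS]mulrC; exact: slope.
Qed.

(** Each line through the origin with angle in [S] is crossed exactly once: the linear form
    vanishing on it is strictly increasing by the cone condition and onto by the position of the
    ends. The polar radius is the coordinate of the crossing on the line and may be negative. *)
Lemma cone_polar (S : set R) : (forall th, S th -> psi < th < pi - psi) -> exists r : R -> R,
  (g @` I) `&` double_sector S = [set polar (r theta) theta | theta in S].
Proof.
move=> window.
have window0 th : S th -> phi < th < pi - phi.
  move=> /window/andP[h1 h2]; rewrite (le_lt_trans phipsi h1) (lt_le_trans h2)//.
  by rewrite lerD2l lerN2.
have kpos th : S th -> forall u, I u -> 0 < sin th * j1 (fX F) u t + - cos th * j1 (fY F) u t.
  by move=> /window hth u Iu; apply: (sector_transverse psi0 hth cpsi (apos Iu) (slope Iu)).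
have /choice[r Hr] : forall th, exists rho : R, S th -> exists u, [/\ I u,
    g u = polar rho th & forall v, I v -> sin th * j0 (fX F) v t + - cos th * j0 (fY F) v t = 0 -> v = u].
  move=> th; have [Sth|] := pselect (S th); last by exists 0.
  have cth := sin_sector phi0 (window0 th Sth).
  have h1 : cos th * sin phi <= `|cos th| * sin phi by exact: ler_wpM2r sphi _ _ (ler_norm _).
  have h2 : - cos th * sin phi <= `|cos th| * sin phi by rewrite -normrN;
    exact: ler_wpM2r sphi _ _ (ler_norm _).
  have [||u Iu E] := lin_onto (p := sin th) (q := - cos th) ht0 rR rL _ _ 0.
  - by rewrite mulNr subr_gt0; exact: le_lt_trans h1 cth.
  - by rewrite mulrNN opprK -[X in _ + X]opprK subr_gt0 -mulNr; exact: le_lt_trans h2 cth.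
  exists (cos th * j0 (fX F) u t + sin th * j0 (fY F) u t) => _; exists u; split => //.
    have c2 := cos2Dsin2 th; rewrite gE// /polar; congr pair.
      rewrite -[LHS]mul1r -c2; apply/eqP; rewrite -subr_eq0; apply/eqP.
      transitivity (sin th * (sin th * j0 (fX F) u t + - cos th * j0 (fY F) u t)); first by ring.
      by rewrite E mulr0.
    rewrite -[LHS]mul1r -c2; apply/eqP; rewrite -subr_eq0; apply/eqP.
    transitivity (- cos th * (sin th * j0 (fX F) u t + - cos th * j0 (fY F) u t)); first by ring.
    by rewrite E mulr0.
  by move=> v Iv Ev; apply: (lin_inj ht0 (kpos th Sth) Iv Iu); rewrite Ev E.
exists r; apply/seteqP; split => [p [[v Iv <-] [r' [th [Sth E]]]]|p [th Sth <-]].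
  exists th => //; have [u [Iu <- uniq]] := Hr th Sth.
  by rewrite (uniq v Iv)//; move: E; rewrite gE// => -[-> ->]; ring.
have [u [Iu E _]] := Hr th Sth; split; first by exists u.
by exists (r th), th.
Qed.

End ConeGraph.

Theorem theorem1p5 (R : realType) (beta : R) (I : set R) (T : \bar R)
    (gamma : R * R -> R * R) (Aminus Aplus : R)
    (hbeta : 0 < beta <= pi)
    (hIopen : open I) (hIint : is_interval I)
    (hT : (0 < T)%E)
    (hflow : csf_radial_ends I T gamma (pi / 2 + beta / 2) (pi / 2 - beta / 2))
    (hsmooth : smooth_down_to_zero I T gamma)
    (harea : forall v w : R, I v -> I w -> v <= w ->
       Aminus <= swept_area (slice gamma 0) v w <= Aplus)
    (t : R) (ht : times T t) (htA : 2 * (Aplus - Aminus) / beta < t) :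
  (exists y : R -> R,
    [/\ slice gamma t @` I = range (fun x : R => (x, y x)),
        forall x, derivable y x 1
      & (Lnorm (@lebesgue_measure R) +oo (EFin \o derive1 y)
         <= (tan (pi / 2 - beta / 2 + (Aplus - Aminus) / t))%:E)%E])
  /\
  (let S : set R :=
     [set theta | pi / 2 - beta / 2 + (Aplus - Aminus) / t < theta
                  < pi / 2 + beta / 2 - (Aplus - Aminus) / t] in
   exists r : R -> R,
     (slice gamma t @` I) `&` double_sector S =
     [set polar (r theta) theta | theta in S]).
Proof.
have [prop [u1 [u2 [Iu1 Iu2 u12 rayL rayR]]]] := hflow.
have [t0 tT] := ht; have pi0 := pi_gt0 R.
pose phi : R := pi / 2 - beta / 2; pose D := Aplus - Aminus.
rewrite -/phi -/D; have phi0 : 0 <= phi by rewrite /phi; lra.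
have phi2 : phi < pi / 2 by rewrite /phi; lra.
have beta0 : 0 < beta by case/andP: hbeta.
have Dt : phi + D / t < pi / 2.
  have : D / t < beta / 2.
    by rewrite ltr_pdivrMr//; move: htA; rewrite ltr_pdivrMr// -/D; lra.
  by rewrite /phi; lra.
(* A finite time beyond [t]: [T] itself or, if [T] is infinite, [t + 1]. *)
have [T1 [tT1 T1T]] : exists T1 : R, t < T1 /\ forall s, 0 <= s < T1 -> times0 T s.
  case: (T) tT => [T'| |//]; rewrite ?lte_fin => h.
    by exists T'; split => // s /andP[s0 sT]; split; rewrite ?lte_fin.
  by exists (t + 1); split; [lra|move=> s /andP[s0 sT]; split => //; exact: ltry].
have T10 : 0 < T1 by lra. have T00 : 0 <= (0 : R) < T1 by lra.
have ht' : 0 < t < T1 by lra. have ht0 : 0 <= t < T1 by lra.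
have [F FE] := flow_of hIopen hIint (ex_intro _ u1 Iu1) T10 T1T prop hsmooth.
have cs : cos phi ^+ 2 + sin phi ^+ 2 = 1 :> R by exact: cos2Dsin2.
have sphi := sin_ge0_acute phi0 phi2.
have [ubR rR] : exists ub, radial_end F ub (cos phi) (sin phi).
  apply: (radial_end_of (u2 := u2)) => // u Iu hu; have [r r0 E] := rayR u Iu hu.
  by exists r => //; have [-> ->] := FE u 0 Iu T00; rewrite -E.
have [ubL rL] : exists ub, radial_end (flow_rev F) ub (- cos phi) (sin phi).
  apply: (radial_end_of (u2 := - u1)) => //; [by rewrite sqrrN|by rewrite /= opprK|].
  move=> u /= Iu hu; have [|r r0 E] := rayL (- u) Iu; first by lra.
  exists r => //; have [-> ->] := FE (- u) 0 Iu T00; rewrite -E /polar /=.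
  have -> : pi / 2 + beta / 2 = pi - phi by rewrite /phi; lra.
  by rewrite cosB sinB cospi sinpi !mul0r addr0 !mulN1r sub0r opprK.
have init : forall A0 : R -> R, (forall u, I u -> isD A0 u
    (2^-1 * (j1 (fX F) u 0 * j0 (fY F) u 0 - j1 (fY F) u 0 * j0 (fX F) u 0))) ->
    forall u v, I u -> I v -> A0 v - A0 u <= D.
  move=> A0 dA0 u v Iu Iv.
  have sw x y : I x -> I y -> x <= y -> swept_area (slice gamma 0) x y = A0 y - A0 x.
    move=> Ix Iy xy; have Iz z : x <= z <= y -> I z by exact: (f_itv F Ix Iy).
    apply: (swept_area_primitive (f := fun u => j1 (fX F) u 0 * j0 (fY F) u 0 - j1 (fY F) u 0 * j0 (fX
      F) u 0)) => // z hz.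
    - by apply: dA0; exact: Iz.
    - by apply: isD_cont (isD_sub (isD_mul (j1_du (fX F) (Iz z hz) T00) (j0_du (fY F) (Iz z hz) T00))
        (isD_mul (j1_du (fY F) (Iz z hz) T00) (j0_du (fX F) (Iz z hz) T00))).
    have n : \forall v \near z, I v by apply: open_nbhs_nbhs; split => //; exact: Iz.
    have [e1 e2] := FE z 0 (Iz z hz) T00.
    have -> : derive1 (slice gamma 0) z = (j1 (fX F) z 0, j1 (fY F) z 0).
      apply: derive1_pair.
        by apply: isD_near (j0_du (fX F) (Iz z hz) T00); apply: filterS n => w Iw; case: (FE w 0 Iw T00).
      by apply: isD_near (j0_du (fY F) (Iz z hz) T00); apply: filterS n => w Iw; case: (FE w 0 Iw T00).
    by rewrite /star_wedge /slice -e1 -e2.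
  (* The swept area from a point to itself is [0], so [Aminus <= 0 <= Aplus], and [D] bounds the
     difference for both orders of [u] and [v]. *)
  have := harea u u Iu Iu (lexx u); rewrite sw// subrr => h0.
  have [uv|vu] := leP u v.
    by have := harea u v Iu Iv uv; rewrite sw// /D; lra.
  by have := harea v u Iv Iu (ltW vu); rewrite (sw v u Iv Iu (ltW vu)) /D; lra.
have cone := flow_cone ht' phi0 Dt rR rL init.
have Dt0 : 0 <= D / t.
  apply: divr_ge0; last exact: ltW.
  by have := harea u1 u1 Iu1 Iu1 (lexx u1); rewrite /D; lra.
pose psi := phi + D / t; rewrite -/psi in cone Dt *.
have gE u : I u -> slice gamma t u = (j0 (fX F) u t, j0 (fY F) u t).
  by move=> Iu; have [e1 e2] := FE u t Iu ht0; rewrite e1 e2 -surjective_pairing.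
have phipsi : phi <= psi by rewrite /psi lerDl.
split; first exact: (cone_graph hIopen ht0 phi0 phipsi Dt gE rR rL cone).
(* The lower end of the sector is [psi] by definition, and the upper end is [pi - psi]. *)
apply: (cone_polar ht0 phi0 phipsi Dt gE rR rL cone) => th; rewrite /= => /andP[-> h].
by rewrite (lt_le_trans h)// /psi /phi; lra.
Qed.
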